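(* Let $r,n\in\mathbb{N}$, let $d$ be an integer with $d\geqslant r-1$, and let $i\in\{0,1,2\}$. Let $\tau$ be either one of the two knot vectors $$\text{for } i=0:\quad \left\{\tfrac{k\pi}{n+1}\right\}_{k=1}^n \quad\text{or}\quad \left\{\tfrac{k\pi}{n+1}+\tfrac{\pi}{2(n+1)}\right\}_{k=0}^n;$$ $$\text{for } i=1:\quad \left\{\tfrac{k\pi}{n}\right\}_{k=1}^{n-1} \quad\text{or}\quad \left\{\tfrac{k\pi}{n}+\tfrac{\pi}{2n}\right\}_{k=0}^{n-1};$$ $$\text{for } i=2:\quad \left\{\tfrac{k\pi}{2n+1}\right\}_{k=1}^{n} \quad\text{or}\quad \left\{\tfrac{k\pi}{2n+1}+\tfrac{\pi}{2(2n+1)}\right\}_{k=0}^{n-1}.$$ Then (for either choice of knot vector, independently of the parity of $d$) the spline space $S_{d,\tau,i}$ contains an $n$-dimensional subspace $X$ that is optimal for $A_i^r$ in $L_2[0,P_i]$, i.e. $$\sup_{u\in A^r_i}\ \inf_{s\in X}\|u-s\|_{L_2[0,P_i]}=d_n(A_i^r;L_2[0,P_i]).$$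
   Context: $P_0=P_1=\pi$, $P_2=\pi/2$. $\|f\|_{L_2[a,b]}=\left(\int_a^b|f|^2\right)^{1/2}$. $W^{(r)}_2[a,b]$ is the space of $f\in L_2[a,b]$ such that $f^{(r-1)}$ is absolutely continuous and $f^{(r)}\in L_2[a,b]$. Functions are complex-valued and linear spaces are over $\mathbb{C}$. Define $$H_0^r=\{u\in W^{(r)}_2[0,\pi]: u^{(k)}(0)=u^{(k)}(\pi)=0,\ 0\leqslant k<r,\ k\text{ even}\},$$ $$H_1^r=\{u\in W^{(r)}_2[0,\pi]: u^{(k)}(0)=u^{(k)}(\pi)=0,\ 0\leqslant k<r,\ k\text{ odd}\},$$ $$H_2^r=\left\{u\in W^{(r)}_2\left[0,\tfrac{\pi}{2}\right]: u^{(k)}(0)=u^{(l)}\left(\tfrac{\pi}{2}\right)=0,\ 0\leqslant k,l<r,\ k\text{ even},\ l\text{ odd}\right\},$$ and $A_i^r=\{u\in H_i^r:\|u^{(r)}\|_{L_2[0,P_i]}\leqslant1\}$ for $i=0,1,2$. For a knot vector $\tau=(\tau_1,\dots,\tau_p)$ with $0<\tau_1<\dots<\tau_p<P_i$, $S_{d,\tau,i}$ is the space of splines of degree $d$ and defect $1$ on $[0,P_i]$ with knots $\tau$: functions that are polynomials of degree at most $d$ on each of the intervals determined by the knots and that belong to $C^{d-1}[0,P_i]$ (for $d=0$: piecewise constant functions, with no continuity requirement). If $n=1$, the vector $\{k\pi/n\}_{k=1}^{n-1}$ is empty. The Kolmogorov $n$-width of a subset $A$ of a normed space $X$ is $d_n(A;X)=\inf_{X_n}\sup_{x\in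 A}\inf_{y\in X_n}\|x-y\|_X$, the outer infimum being over all subspaces $X_n\subset X$ of dimension at most $n$. It is known (Floater and Sande) that $d_n(A_0^r;L_2[0,\pi])=(n+1)^{-r}$, $d_n(A_1^r;L_2[0,\pi])=n^{-r}$, $d_n(A_2^r;L_2[0,\pi/2])=(2n+1)^{-r}$. *)

(* Defs.v *)
From HB Require Import structures.
From mathcomp Require Import all_boot all_order all_algebra.
From mathcomp Require Import complex.
From mathcomp Require Import all_classical all_reals all_analysis.

Set Implicit Arguments.
Unset Strict Implicit.
Unset Printing Implicit Defensive.

Import Order.TTheory GRing.Theory Num.Theory.
Import numFieldNormedType.Exports.

Local Open Scope classical_set_scope.
Local Open Scope complex_scope.
Local Open Scope ring_scope.

(* The complex numbers are R[i]; the alias R[i]^o carries their topology and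
   their structure of vector space over themselves.  Complex-valued functions
   on a segment [a, b] are represented by functions on R of which only the
   values on [a, b] matter; derivatives at a and b are one-sided. *)

Section OnSegment.
Context {R : realType} (a b : R).
Implicit Types f u : R -> R[i]^o.

Definition diff_quot f (x y : R) : R[i]^o := (f y - f x) / (y - x)%:C.

Definition derivable_within f (x : R) : Prop :=
  cvg (diff_quot f x y @[y --> within `[a, b] x^']).

Definition derive_within f : R -> R[i]^o :=
  fun x => lim (diff_quot f x y @[y --> within `[a, b] x^']).

(* u^(k) is deriven u k.  Where the derivative does not exist (a null set, for
   the r-th derivative of u when u^(r-1) is absolutely continuous) its value
   is a fixed default one. *)
Definition deriven f (k : nat) : R -> R[i]^o := iter k derive_within f.

Definition n_derivable (m : nat) f : Prop :=
  forall k, (k < m)%N -> forall x, a <= x <= b ->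
    derivable_within (deriven f k) x.

Definition n_continuously_derivable (m : nat) f : Prop :=
  n_derivable m f /\ {within `[a, b], continuous (deriven f m)}.

Definition absolutely_continuous f : Prop :=
  forall e : R, 0 < e -> exists2 d : R, 0 < d &
    forall (m : nat) (s t : 'I_m -> R),
      (forall k, [/\ a <= s k, s k <= t k & t k <= b]) ->
      trivIset [set: 'I_m] (fun k => `]s k, t k[%classic) ->
      \sum_(k < m) (t k - s k) < d ->
      \sum_(k < m) Normc.normc (f (t k) - f (s k)) < e.

Definition L2 : set (R -> R[i]^o) := [set f : R -> R[i]^o |
  [/\ measurable_fun `[a, b] (fun x : R => complex.Re (f x)),
      measurable_fun `[a, b] (fun x : R => complex.Im (f x)) &
      (@lebesgue_measure R).-integrable `[a, b]
        (fun x : R => (Normc.normc (f x) ^+ 2)%:E)]].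

Definition L2norm f : R :=
  Num.sqrt (\int[@lebesgue_measure R]_(x in `[a, b]) (Normc.normc (f x) ^+ 2)).

(* W^(r)_2[a, b], for r >= 1. *)
Definition sobolev (r : nat) : set (R -> R[i]^o) := [set u : R -> R[i]^o |
  [/\ L2 u, n_derivable r.-1 u, absolutely_continuous (deriven u r.-1)
    & L2 (deriven u r)]].

(* S_(d, tau) on [a, b]: with a = tau_0 and b = tau_(p+1), the endpoints of the
   j-th interval are nth b (a :: tau) j and nth b tau j.  Intervals are taken
   open: for d > 0 continuity determines the values at the knots, and for
   d = 0 these values do not matter in L2. *)
Definition splines (d : nat) (tau : seq R) : set (R -> R[i]^o) := [set s : R -> R[i]^o |
  (forall j, (j <= size tau)%N ->
     exists2 q : {poly R[i]}, (size q <= d.+1)%N &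
       forall x, nth b (a :: tau) j < x < nth b tau j -> s x = q.[x%:C]) /\
  ((0 < d)%N -> n_continuously_derivable d.-1 s)].

End OnSegment.

(* Kolmogorov widths in a normed space given by representatives: N is a seminorm
   on a linear subspace E of V, and the normed space is E modulo the null
   vectors of N.  Linear independence is that of the classes, so that for
   E = L2 functions that agree almost everywhere are identified. *)
Section Width.
Context {R : realType} {V : lmodType R[i]} (E : set V) (N : V -> R).

Definition subspace_of_dim (k : nat) (X : set V) : Prop :=
  exists e : 'I_k -> V,
    [/\ forall j, E (e j),
        forall c : 'I_k -> R[i],
          N (\sum_(j < k) c j *: e j) = 0 -> forall j, c j = 0
      & X = range (fun c : 'I_k -> R[i] => \sum_(j < k) c j *: e j)].

Definition deviation (A X : set V) : \bar R :=
  ereal_sup [set ereal_inf [set (N (x - y))%:E | y in X] | x in A].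

Definition kolmogorov_width (n : nat) (A : set V) : \bar R :=
  ereal_inf [set deviation A X |
    X in [set X | exists2 k, (k <= n)%N & subspace_of_dim k X]].

End Width.

Section Classes.
Context {R : realType}.

(* P_i *)
Definition seg_end (i : nat) : R := if i == 2%N then pi / 2 else pi.

Definition boundary_conditions (i r : nat) (u : R -> R[i]^o) : Prop :=
  let P := seg_end i in
  let D := deriven 0 P u in
  match i with
  | 0 => forall k, (k < r)%N -> ~~ odd k -> D k 0 = 0 /\ D k P = 0
  | 1 => forall k, (k < r)%N -> odd k -> D k 0 = 0 /\ D k P = 0
  | _ => (forall k, (k < r)%N -> ~~ odd k -> D k 0 = 0) /\
         (forall l, (l < r)%N -> odd l -> D l P = 0)
  end.

Definition Hclass (i r : nat) : set (R -> R[i]^o) := [set u : R -> R[i]^o |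
  sobolev 0 (seg_end i) r u /\ boundary_conditions i r u].

Definition Aclass (i r : nat) : set (R -> R[i]^o) := [set u : R -> R[i]^o |
  Hclass i r u /\
  L2norm 0 (seg_end i) (deriven 0 (seg_end i) u r) <= 1].

Definition knots (i n : nat) : seq R :=
  match i with
  | 0 => [seq k%:R * pi / n.+1%:R | k <- iota 1 n]
  | 1 => [seq k%:R * pi / n%:R | k <- iota 1 n.-1]
  | _ => [seq k%:R * pi / (2 * n + 1)%:R | k <- iota 1 n]
  end.

Definition shifted_knots (i n : nat) : seq R :=
  match i with
  | 0 => [seq k%:R * pi / n.+1%:R + pi / (2 * n.+1)%:R | k <- iota 0 n.+1]
  | 1 => [seq k%:R * pi / n%:R + pi / (2 * n)%:R | k <- iota 0 n]
  | _ => [seq k%:R * pi / (2 * n + 1)%:R + pi / (2 * (2 * n + 1))%:R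
            | k <- iota 0 n]
  end.

End Classes.

(* Main.v *)
(* Write u' = g with boundary conditions b in {both ends, none, left, right}; the
   derivatives of u in A_i^r satisfy alternately b and the complementary
   conditions.

   Degree 0, r = 1.  By duality, dist(u, X) <= sigma |u'| for all u follows from
   |w| <= sigma |w'| for the primitives w, with complementary conditions, of
   functions orthogonal to X.  X is the n-dimensional space of piecewise
   constant functions whose orthogonality to w' means that w takes opposite
   values at consecutive knots.  On each of the intervals of length pi sigma this
   is Wirtinger's inequality for antiperiodic functions; on the intervals of
   length pi sigma / 2 at the ends, w vanishes at one end.

   Higher degree.  The primitives of the functions of X with complementary
   conditions form a space with the same property for the complementary
   problem, and applying it r times gives dist(u, X_d) <= sigma^r |u^(r)| for
   d >= r - 1.

   Lower bound and dimension.  For any n-dimensional space, some combination of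
   the first n + 1 eigenfunctions sin or cos (frequencies at most 1 / sigma) is
   orthogonal to it.  With one eigenfunction less, the same argument
   shows that n functions satisfying the upper bound are independent. *)

Require Import Defs.
From HB Require Import structures.
From mathcomp Require Import all_boot all_order all_algebra.
From mathcomp Require Import complex ring lra zify.
From mathcomp Require Import all_classical all_reals all_analysis.
From mathcomp Require Import measurable_realfun.

Set Implicit Arguments.
Unset Strict Implicit.
Unset Printing Implicit Defensive.

Import Order.TTheory GRing.Theory Num.Theory.
Import numFieldNormedType.Exports.

Local Open Scope classical_set_scope.
Local Open Scope complex_scope.
Local Open Scope ring_scope.

(** * Integrals and square-integrable functions on a segment *)

(** The parity of the degree never matters because each knot vector carries a piecewise constant
    space for a pair of boundary conditions and for the complementary pair: the construction starts
    from the conditions that [d] complementations turn into the wanted ones. The obstacle is the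
    kernel of d/dx: without boundary conditions constants have derivative 0, and dually a primitive
    vanishing at both ends exists only for functions of mean zero. Index 0 of every family is
    therefore reserved for a constant, 1 when no condition is imposed and 0 otherwise. Functions are
    handled as chains of primitives of real square-integrable functions, for which integration by
    parts holds without pointwise derivatives. Matching them with iterated one-sided derivatives
    requires a density for absolutely continuous functions, obtained from total variation, a
    Lebesgue-Stieltjes measure and Radon-Nikodym. For the upper bound real and imaginary parts
    separate, the basis being real; for the lower bound the competing subspaces are complex, so
    orthogonality is solved for over the complex numbers. *)

Section Integrals.
Context {R : realType}.
Implicit Types (a b c x y : R) (f g : R -> R).

Definition intble a b f := (@lebesgue_measure R).-integrable `[a, b] (EFin \o f).

Definition Int a b f : R := \int[@lebesgue_measure R]_(x in `[a, b]) f x.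

Lemma intble_sub a b c d f : a <= c -> d <= b -> intble a b f -> intble c d f.
Proof.
move=> ac db; apply: integrableS => //.
by move=> x/=; rewrite !in_itv/= => /andP[cx xd]; rewrite (le_trans ac cx) (le_trans xd db).
Qed.

Lemma Int_split c a b f : a <= c -> c <= b -> intble a b f ->
  Int a b f = Int a c f + Int c b f.
Proof.
move=> ac cb fi; rewrite /Int -(@Rintegral_itv_obnd_cbnd _ c).
  rewrite -(@Rintegral_itvB _ f (BLeft a) (BRight b) c) ?bnd_simp//.
  by rewrite addrC subrK.
apply: integrableS fi => //.
by move=> x/=; rewrite !in_itv/= => /andP[cx ->]; rewrite (le_trans ac (ltW cx)).
Qed.

Lemma eq_Int a b f g : (forall x, a <= x <= b -> f x = g x) -> Int a b f = Int a b g.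
Proof. by move=> fg; apply: eq_Rintegral => x; rewrite inE/= in_itv/= => /fg. Qed.

Lemma eq_intble a b f g : (forall x, a <= x <= b -> f x = g x) -> intble a b f -> intble a b g.
Proof.
by move=> fg; apply: eq_integrable => // x; rewrite inE/= in_itv/= => /fg /= ->.
Qed.

Lemma intbleD a b f g : intble a b f -> intble a b g -> intble a b (fun x => f x + g x).
Proof. by move=> fi gi; apply: (integrableD _ fi gi). Qed.

Lemma intbleZ a b k f : intble a b f -> intble a b (fun x => k * f x).
Proof. by move=> fi; apply: (integrableZl _ k fi). Qed.

Lemma intbleB a b f g : intble a b f -> intble a b g -> intble a b (fun x => f x - g x).
Proof. by move=> fi gi; apply: (integrableB _ fi gi). Qed.

Lemma intble_norm a b f : intble a b f -> intble a b (fun x => `|f x|).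
Proof. by move=> fi; exact: (integrable_norm fi). Qed.

Lemma intble_cst a b c : intble a b (fun=> c).
Proof.
apply: continuous_compact_integrable; first exact: segment_compact.
by apply: continuous_subspaceT => x; exact: cst_continuous.
Qed.

Lemma IntD a b f g : intble a b f -> intble a b g ->
  Int a b (fun x => f x + g x) = Int a b f + Int a b g.
Proof. by move=> fi gi; exact: RintegralD. Qed.

Lemma IntB a b f g : intble a b f -> intble a b g ->
  Int a b (fun x => f x - g x) = Int a b f - Int a b g.
Proof. by move=> fi gi; exact: RintegralB. Qed.

Lemma IntZ a b k f : intble a b f -> Int a b (fun x => k * f x) = k * Int a b f.
Proof. by move=> fi; exact: RintegralZl. Qed.

Lemma Int_ge0 a b f : (forall x, a <= x <= b -> 0 <= f x) -> 0 <= Int a b f.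
Proof. by move=> f0; apply: Rintegral_ge0 => x/=; rewrite in_itv/= => /f0. Qed.

Lemma le_Int a b f g : intble a b f -> intble a b g ->
  (forall x, a <= x <= b -> f x <= g x) -> Int a b f <= Int a b g.
Proof.
by move=> fi gi fg; apply: le_Rintegral => // x /=; rewrite in_itv/= => /fg.
Qed.

Lemma le_norm_Int a b f : intble a b f -> `|Int a b f| <= Int a b (fun x => `|f x|).
Proof. by move=> fi; exact: le_normr_Rintegral. Qed.

Lemma Int_cst a b c : a <= b -> Int a b (fun=> c) = c * (b - a).
Proof.
move=> ab; rewrite /Int Rintegral_cst//= lebesgue_measure_itv/= lte_fin.
have [//|ba|->] := ltgtP a b; last by rewrite subrr.
by move: (lt_le_trans ba ab); rewrite ltxx.
Qed.

Lemma Intxx a f : Int a a f = 0.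
Proof. by rewrite /Int set_itv1 Rintegral_set1. Qed.

Lemma Int_le_sub a b c d f : a <= c -> c <= d -> d <= b -> intble a b f ->
  (forall x, a <= x <= b -> 0 <= f x) -> Int c d f <= Int a b f.
Proof.
move=> ac cd db fi f0.
have cb := le_trans cd db; have ad := le_trans ac cd.
rewrite (Int_split ac cb)// (Int_split cd db); last exact: intble_sub fi.
rewrite -[leLHS]add0r -[in leLHS](addr0 (Int c d f)).
rewrite lerD//; last rewrite lerD//.
  by apply: Int_ge0 => x /andP[ax xc]; rewrite f0// ax (le_trans xc).
by apply: Int_ge0 => x /andP[dx xb]; rewrite f0// xb andbT (le_trans ad).
Qed.

Lemma Int_sum (I : Type) (r : seq I) a b (F : I -> R -> R) :
  (forall i, intble a b (F i)) ->
  intble a b (fun x => \sum_(i <- r) F i x) /\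
  Int a b (fun x => \sum_(i <- r) F i x) = \sum_(i <- r) Int a b (F i).
Proof.
move=> Fi; elim: r => [|i r [IH1 IH2]].
  rewrite big_nil; split.
    by apply: eq_intble (intble_cst a b 0) => x _; rewrite big_nil.
  rewrite (_ : (fun _ => _) = (fun=> 0 * 1)); last by apply/funext => x; rewrite big_nil mul0r.
  by rewrite IntZ ?mul0r//; exact: intble_cst.
rewrite big_cons -IH2 -IntD//; split.
  by apply: eq_intble (intbleD (Fi i) IH1) => x _; rewrite big_cons.
by apply: eq_Int => x _; rewrite big_cons.
Qed.

End Integrals.

Section L2real.
Context {R : realType}.
Implicit Types (a b c x y : R) (f g u v w : R -> R).

Definition L2r a b f := measurable_fun `[a, b] f /\ intble a b (fun x => f x ^+ 2).

Definition ip a b f g := Int a b (fun x => f x * g x).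

Lemma L2r_sub a b c d f : a <= c -> d <= b -> L2r a b f -> L2r c d f.
Proof.
move=> ac db [mf fi]; split; last exact: intble_sub fi.
apply: measurable_funS mf => //.
by move=> x/=; rewrite !in_itv/= => /andP[cx xd]; rewrite (le_trans ac cx) (le_trans xd db).
Qed.

Lemma eq_L2r a b f g : (forall x, a <= x <= b -> f x = g x) -> L2r a b f -> L2r a b g.
Proof.
move=> fg [mf fi]; split.
  by apply: eq_measurable_fun mf => x; rewrite inE/= in_itv/= => /fg.
by apply: eq_intble fi => x /fg ->.
Qed.

Lemma L2r_mul a b f g : L2r a b f -> L2r a b g -> intble a b (fun x => f x * g x).
Proof.
move=> [mf fi] [mg gi].
apply: (le_integrable _ _ _ (intbleD fi gi)) => //.
  by apply/measurable_EFinP; exact: measurable_funM.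
move=> x _ /=; rewrite lee_fin normrM.
rewrite [leRHS]ger0_norm ?addr_ge0 ?sqr_ge0//.
rewrite -[f x ^+ 2]real_normK ?num_real// -[g x ^+ 2]real_normK ?num_real//.
have := sqr_ge0 (`|f x| - `|g x|); have := normr_ge0 (f x); have := normr_ge0 (g x).
by nra.
Qed.

Lemma L2r_cst a b c : L2r a b (fun=> c).
Proof. by split; [exact: measurable_cst|exact: intble_cst]. Qed.

Lemma L2r_intble a b f : L2r a b f -> intble a b f.
Proof.
move=> fL; apply: eq_intble (L2r_mul fL (L2r_cst a b 1)) => x _.
by rewrite mulr1.
Qed.

Lemma L2rD a b f g : L2r a b f -> L2r a b g -> L2r a b (fun x => f x + g x).
Proof.
move=> fL gL; split; first by apply: measurable_funD; [case: fL|case: gL].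
have := intbleD (intbleD fL.2 gL.2) (intbleZ 2 (L2r_mul fL gL)).
by apply: eq_intble => x _; ring.
Qed.

Lemma L2rZ a b k f : L2r a b f -> L2r a b (fun x => k * f x).
Proof.
move=> fL; split; first by apply: measurable_funM; [exact: measurable_cst|case: fL].
by apply: eq_intble (intbleZ (k ^+ 2) fL.2) => x _; ring.
Qed.

Lemma L2rB a b f g : L2r a b f -> L2r a b g -> L2r a b (fun x => f x - g x).
Proof.
move=> fL gL; apply: eq_L2r (L2rD fL (L2rZ (-1) gL)) => x _.
by rewrite mulN1r.
Qed.

Lemma L2r_sum (I : Type) (r : seq I) a b (F : I -> R -> R) :
  (forall i, L2r a b (F i)) -> L2r a b (fun x => \sum_(i <- r) F i x).
Proof.
move=> FL; elim: r => [|i r IH].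
  by apply: eq_L2r (L2r_cst a b 0) => x _; rewrite big_nil.
by apply: eq_L2r (L2rD (FL i) IH) => x _; rewrite big_cons.
Qed.

Lemma cont_measurable a b f : {within `[a, b], continuous f} -> measurable_fun `[a, b] f.
Proof. by move=> cf; apply: subspace_continuous_measurable_fun. Qed.

Lemma cont_bounded a b f : {within `[a, b], continuous f} ->
  exists2 M : R, 0 <= M & forall x, a <= x <= b -> `|f x| <= M.
Proof.
move=> cf; have [ab|ba] := leP a b; last first.
  by exists 0 => // x /andP[ax xb]; move: (le_lt_trans (le_trans ax xb) ba); rewrite ltxx.
have [c cab fc] := EVT_max ab cf.
have cf' : {within `[a, b], continuous (\- f)}.
  by move=> x; apply: cvgN; exact: cf.
have [d dab fd] := EVT_max ab cf'.
exists (`|f c| + `|f d|); first by rewrite addr_ge0.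
move=> x xab; have xI : x \in `[a, b] by rewrite in_itv.
rewrite ler_norml; have := fc _ xI; have := fd _ xI => /=.
have := ler_norm (f c); have := ler_norm (- f d); rewrite normrN.
have := normr_ge0 (f c); have := normr_ge0 (f d); lra.
Qed.

Lemma L2r_bounded_mul a b w g : {within `[a, b], continuous w} ->
  L2r a b g -> L2r a b (fun x => w x * g x).
Proof.
move=> cw [mg gi]; have [M M0 wM] := cont_bounded cw.
have mw := cont_measurable cw.
split; first exact: measurable_funM.
apply: (le_integrable _ _ _ (intbleZ (M ^+ 2) gi)) => //.
  by apply/measurable_EFinP; apply/measurable_funX/measurable_funM.
move=> x /=; rewrite in_itv/= => /wM wxM; rewrite lee_fin.
rewrite ger0_norm ?sqr_ge0// ger0_norm -?exprMn ?sqr_ge0// !exprMn ler_wpM2r ?sqr_ge0//.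
by rewrite -[w x ^+ 2]real_normK ?num_real// ler_pXn2r// nnegrE.
Qed.

Lemma L2r_cont a b w : {within `[a, b], continuous w} -> L2r a b w.
Proof.
move=> cw; apply: eq_L2r (L2r_bounded_mul cw (L2r_cst a b 1)) => x _.
by rewrite mulr1.
Qed.

Lemma ipC a b f g : ip a b f g = ip a b g f.
Proof. by apply: eq_Int => x _; rewrite mulrC. Qed.

Lemma ipDl a b f g v : L2r a b f -> L2r a b g -> L2r a b v ->
  ip a b (fun x => f x + g x) v = ip a b f v + ip a b g v.
Proof.
move=> fL gL vL; rewrite /ip -IntD; try exact: L2r_mul.
by apply: eq_Int => x _; rewrite mulrDl.
Qed.

Lemma ipBl a b f g v : L2r a b f -> L2r a b g -> L2r a b v ->
  ip a b (fun x => f x - g x) v = ip a b f v - ip a b g v.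
Proof.
move=> fL gL vL; rewrite /ip -IntB; try exact: L2r_mul.
by apply: eq_Int => x _; rewrite mulrBl.
Qed.

Lemma ipDr a b f g v : L2r a b f -> L2r a b g -> L2r a b v ->
  ip a b v (fun x => f x + g x) = ip a b v f + ip a b v g.
Proof. by move=> fL gL vL; rewrite ipC ipDl// (ipC a b f) (ipC a b g). Qed.

Lemma ipBr a b f g v : L2r a b f -> L2r a b g -> L2r a b v ->
  ip a b v (fun x => f x - g x) = ip a b v f - ip a b v g.
Proof. by move=> fL gL vL; rewrite ipC ipBl// (ipC a b f) (ipC a b g). Qed.

Lemma ipZl a b k f v : L2r a b f -> L2r a b v ->
  ip a b (fun x => k * f x) v = k * ip a b f v.
Proof.
move=> fL vL; rewrite /ip -IntZ; try exact: L2r_mul.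
by apply: eq_Int => x _; rewrite mulrA.
Qed.

Lemma eq_ip a b f f' g g' : (forall x, a <= x <= b -> f x = f' x) ->
  (forall x, a <= x <= b -> g x = g' x) -> ip a b f g = ip a b f' g'.
Proof. by move=> ff' gg'; apply: eq_Int => x xab; rewrite ff' ?gg'. Qed.

Lemma ip_suml (I : Type) (r : seq I) a b (F : I -> R -> R) v :
  (forall i, L2r a b (F i)) -> L2r a b v ->
  ip a b (fun x => \sum_(i <- r) F i x) v = \sum_(i <- r) ip a b (F i) v.
Proof.
move=> FL vL; have [_ <-] := Int_sum r (fun i => L2r_mul (FL i) vL).
by apply: eq_Int => x _; rewrite mulr_suml.
Qed.

Lemma ip_ge0 a b f : 0 <= ip a b f f.
Proof. by apply: Int_ge0 => x _; rewrite -expr2 sqr_ge0. Qed.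

Lemma ip_CS a b f g : L2r a b f -> L2r a b g ->
  ip a b f g ^+ 2 <= ip a b f f * ip a b g g.
Proof.
move=> fL gL.
have H (s t : R) : 0 <= s ^+ 2 * ip a b f f + t ^+ 2 * ip a b g g + 2 * s * t * ip a b f g.
  have := ip_ge0 a b (fun x => s * f x + t * g x).
  rewrite (ipDl (L2rZ s fL) (L2rZ t gL)); last exact/L2rD/L2rZ/gL/L2rZ/fL.
  rewrite !(ipC _ _ (fun x => _ * _)) !(ipDl (L2rZ s fL) (L2rZ t gL)); try exact: L2rZ.
  rewrite !(ipZl s fL) ?(ipZl t gL); try exact: L2rZ.
  rewrite !(ipC _ _ _ (fun x => _ * _)) !(ipZl s fL) ?(ipZl t gL)//.
  by rewrite (ipC a b g f); congr (0 <= _); ring.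
have f0 := ip_ge0 a b f; have g0 := ip_ge0 a b g.
(* Write F, G, I for <f, f>, <g, g>, <f, g>. The first two choices give G (F G - I^2) >= 0 and F (F
   G - I^2) >= 0; the other two force I = 0 when F = G = 0. *)
have := H (ip a b g g) (- ip a b f g).
have := H (- ip a b f g) (ip a b f f).
have := H 1 1; have := H 1 (-1).
move: (ip a b f f) (ip a b g g) (ip a b f g) f0 g0 => F G I F0 G0.
have [->|Fn0] := eqVneq F 0; last first.
  move=> _ _ + _; have {}F0 : 0 < F by rewrite lt_neqAle eq_sym Fn0.
  rewrite (_ : _ + _ = F * (F * G - I ^+ 2)); last ring.
  by rewrite pmulr_rge0// subr_ge0.
have [->|Gn0] := eqVneq G 0; first by nra.
have {}G0 : 0 < G by rewrite lt_neqAle eq_sym Gn0.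
move=> _ _ _; rewrite (_ : _ + _ = G * (0 * G - I ^+ 2)); last ring.
by rewrite pmulr_rge0// subr_ge0.
Qed.

End L2real.

(** * Primitives of square-integrable functions *)

Section Primitives.
Context {R : realType}.
Implicit Types (a b c x y : R) (f g u v w : R -> R).

(** [w] lies in the Sobolev space of order 1 with weak derivative [g]; the integral form asks for no
    pointwise derivative. *)
Definition prim a b w g :=
  L2r a b g /\ forall x, a <= x <= b -> w x = w a + Int a x g.

Lemma primE a b w g x y : prim a b w g -> a <= x -> x <= y -> y <= b ->
  w y - w x = Int x y g.
Proof.
move=> [gL wE] ax xy yb.
rewrite (wE y) ?yb ?(le_trans ax)// (wE x) ?ax ?(le_trans xy)//.
rewrite (Int_split ax xy); first ring.
exact: intble_sub (L2r_intble gL).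
Qed.

Lemma prim_sub a b c d w g : a <= c -> d <= b -> prim a b w g -> prim c d w g.
Proof.
move=> ac db wg; split; first by apply: L2r_sub wg.1.
by move=> x /andP[cx xd]; rewrite -(primE wg ac cx) ?(le_trans xd)// addrC subrK.
Qed.

Lemma cont_Int a b g : a <= b -> intble a b g ->
  {within `[a, b], continuous (fun x => Int a x g)}.
Proof. by move=> ab gi; exact: parameterized_integral_continuous. Qed.

Lemma eq_within_continuous a b f g : (forall x, a <= x <= b -> f x = g x) ->
  {within `[a, b], continuous f} -> {within `[a, b], continuous g}.
Proof.
move=> fg; apply: subspace_eq_continuous => x; rewrite inE/= in_itv/=; exact: fg.
Qed.

Lemma prim_cont a b w g : prim a b w g -> {within `[a, b], continuous w}.
Proof.
move=> [gL wE]; have [ab|ba] := leP a b; last first.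
  by rewrite set_itv_ge -?leNgt ?bnd_simp//; exact: continuous_subspace0.
apply: (eq_within_continuous (f := fun x => w a + Int a x g)).
  by move=> x xab; rewrite -wE.
move=> x; apply: cvgD; first exact: cst_continuous.
exact: (cont_Int ab (L2r_intble gL)).
Qed.

Lemma prim_L2r a b w g : prim a b w g -> L2r a b w.
Proof. by move=> /prim_cont/L2r_cont. Qed.

Lemma eq_prim a b w w' g g' : (forall x, a <= x <= b -> w x = w' x) ->
  (forall x, a <= x <= b -> g x = g' x) -> prim a b w g -> prim a b w' g'.
Proof.
move=> ww gg [gL wE]; split; first exact: eq_L2r gL.
move=> x xab; rewrite -!ww//; last first.
  by rewrite lexx; case/andP: xab => /le_trans; exact.
rewrite wE//; congr (_ + _); apply: eq_Int => t /andP[at_ tx]; rewrite gg// at_.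
by case/andP: xab => _; exact: le_trans.
Qed.

Lemma prim_Int a b c g : L2r a b g -> prim a b (fun x => c + Int a x g) g.
Proof. by move=> gL; split => // x _; rewrite Intxx addr0. Qed.

Lemma prim_cst a b c : prim a b (fun=> c) (fun=> 0).
Proof.
split; first exact: L2r_cst.
by move=> x /andP[ax _]; rewrite Int_cst// mul0r addr0.
Qed.

Lemma primD a b w1 g1 w2 g2 : prim a b w1 g1 -> prim a b w2 g2 ->
  prim a b (fun x => w1 x + w2 x) (fun x => g1 x + g2 x).
Proof.
move=> [g1L w1E] [g2L w2E]; split; first exact: L2rD.
move=> x xab; case/andP: (xab) => _ xb; rewrite IntD; last 2 first.
- by apply: intble_sub (L2r_intble g1L).
- by apply: intble_sub (L2r_intble g2L).
by rewrite w1E// w2E//; ring.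
Qed.

Lemma primZ a b k w g : prim a b w g -> prim a b (fun x => k * w x) (fun x => k * g x).
Proof.
move=> [gL wE]; split; first exact: L2rZ.
move=> x xab; case/andP: (xab) => _ xb; rewrite IntZ; last first.
  by apply: intble_sub (L2r_intble gL).
by rewrite wE// mulrDr.
Qed.

Lemma primB a b w1 g1 w2 g2 : prim a b w1 g1 -> prim a b w2 g2 ->
  prim a b (fun x => w1 x - w2 x) (fun x => g1 x - g2 x).
Proof.
move=> p1 p2; apply: eq_prim (primD p1 (primZ (-1) p2)) => x _.
  by rewrite mulN1r.
by rewrite mulN1r.
Qed.

Lemma prim_sum (I : Type) (r : seq I) a b (w g : I -> R -> R) :
  (forall i, prim a b (w i) (g i)) ->
  prim a b (fun x => \sum_(i <- r) w i x) (fun x => \sum_(i <- r) g i x).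
Proof.
move=> wg; elim: r => [|i r IH].
  by apply: eq_prim (prim_cst a b 0) => x _; rewrite big_nil.
by apply: eq_prim (primD (wg i) IH) => x _; rewrite big_cons.
Qed.

(* Cut [a, b] at N points where m takes equally spaced values: the increments of
   Phi add up to at most N (M / N)^2. *)
Lemma sqr_increment_cst a b (Phi m : R -> R) : a <= b ->
  {within `[a, b], continuous m} ->
  (forall x y, a <= x <= b -> a <= y <= b -> `|Phi y - Phi x| <= (m y - m x) ^+ 2) ->
  Phi b = Phi a.
Proof.
move=> ab cm H; apply/eqP; rewrite -subr_eq0 -normr_le0; apply/ler_addgt0Pl => e e0.
rewrite addr0; have [M ME] : exists M, M = m b - m a by exists (m b - m a).
have [N N0 MN] : exists2 N : nat, (0 < N)%N & M ^+ 2 / e <= N%:R.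
  have Me0 : 0 <= M ^+ 2 / e by rewrite divr_ge0 ?sqr_ge0// ltW.
  exists (Num.truncn (M ^+ 2 / e)).+1 => //.
  by apply/ltW; rewrite truncnS_gt.
have NR : 0 < N%:R :> R by rewrite ltr0n.
have [p pE] : exists p : nat -> R, forall k, (k <= N)%N ->
    a <= p k <= b /\ m (p k) = m a + k%:R / N%:R * M.
  suff H1 k : exists z, (k <= N)%N -> a <= z <= b /\ m z = m a + k%:R / N%:R * M.
    by exists (fun k => projT1 (cid (H1 k))) => k; exact: (projT2 (cid (H1 k))).
  have [kN|kN] := leqP k N; last by exists a.
  have k1 : 0 <= (k%:R / N%:R : R) <= 1.
    apply/andP; split; first by rewrite divr_ge0 ?ler0n.
    by rewrite ler_pdivrMr// mul1r ler_nat.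
  have [z zab zE] := IVT ab cm (v := m a + k%:R / N%:R * M) ltac:(
    rewrite ge_min le_max ME; case/andP: k1; move: (k%:R / N%:R) => s s0 s1;
    apply/andP; split; apply/orP; case: (leP (m a) (m b)) => mab;
    [left|right|right|left]; nra).
  by exists z => _; rewrite zE; split => //; move: zab; rewrite in_itv.
have Hk k : (k <= N)%N -> `|Phi (p k) - Phi a| <= k%:R * (M / N%:R) ^+ 2.
  elim: k => [_|k IH kN].
    have [p0 m0] := pE 0%N (leq0n N).
    apply: (le_trans (H _ _ _ p0)); first by rewrite lexx.
    by rewrite m0 mul0r mul0r addr0 subrr expr0n mul0r.
  have [pk mk] := pE k (ltnW kN); have [pk1 mk1] := pE k.+1 kN.
  rewrite (_ : _ - _ = (Phi (p k.+1) - Phi (p k)) + (Phi (p k) - Phi a)); last ring.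
  apply: (le_trans (ler_normD _ _)).
  rewrite -natr1 mulrDl mul1r [leRHS]addrC lerD//; last exact: IH (ltnW kN).
  apply: (le_trans (H _ _ pk pk1)); rewrite mk mk1 -natr1.
  rewrite (_ : _ - _ = M / N%:R)//; field; exact: lt0r_neq0.
have [pN mN] := pE N (leqnn N).
have bab : a <= b <= b by rewrite ab lexx.
rewrite (_ : _ - _ = (Phi b - Phi (p N)) + (Phi (p N) - Phi a)); last ring.
apply: (le_trans (ler_normD _ _)).
have := H _ _ pN bab; have := Hk N (leqnn N).
rewrite mN divff ?lt0r_neq0// mul1r.
rewrite (_ : m b - _ = 0); last by rewrite ME; ring.
rewrite expr0n/= => h1 h2; apply: (le_trans (lerD h2 h1)); rewrite add0r.
rewrite (_ : _ * _ = M ^+ 2 / N%:R); last by field; exact: lt0r_neq0.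
by rewrite ler_pdivrMr// mulrC -ler_pdivrMr.
Qed.

(** Over [x, y] the product minus the integral of [G] grows by the integral of (w2 y - w2 t) g1 t +
    (w1 x - w1 t) g2 t, which is at most (m y - m x)^2 for the primitive m of |g1| + |g2|. By
    [sqr_increment_cst] the difference is constant. *)
Lemma prim_mul a b w1 g1 w2 g2 : prim a b w1 g1 -> prim a b w2 g2 ->
  prim a b (fun x => w1 x * w2 x) (fun x => g1 x * w2 x + w1 x * g2 x).
Proof.
move=> p1 p2; set G := fun x => _ + _.
have GL : L2r a b G.
  apply: L2rD; last exact: (L2r_bounded_mul (prim_cont p1) p2.1).
  by apply: eq_L2r (L2r_bounded_mul (prim_cont p2) p1.1) => x _; rewrite mulrC.
split=> // z /andP[az zb].
have {}p1 := prim_sub (lexx a) zb p1; have {}p2 := prim_sub (lexx a) zb p2.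
have {}GL : L2r a z G := L2r_sub (lexx a) zb GL.
pose m x := Int a x (fun t => `|g1 t| + `|g2 t|).
have i1 := L2r_intble p1.1; have i2 := L2r_intble p2.1.
have mi : intble a z (fun t => `|g1 t| + `|g2 t|) by apply: intbleD; exact: intble_norm.
have cm : {within `[a, z], continuous m} by exact: cont_Int.
have mE x y : a <= x -> x <= y -> y <= z ->
    m y - m x = Int x y (fun t => `|g1 t| + `|g2 t|).
  move=> ax xy yz; rewrite /m (Int_split ax xy); first by rewrite addrAC subrr add0r.
  exact: intble_sub mi.
suff : (fun x => w1 x * w2 x - Int a x G) z = (fun x => w1 x * w2 x - Int a x G) a.
  by rewrite /= Intxx subr0 => /eqP; rewrite subr_eq addrC => /eqP ->; rewrite addrC.
apply: (@sqr_increment_cst a z (fun x => w1 x * w2 x - Int a x G) m az cm) => x y /=; wlog xy : x y / x <= y.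
  move=> H xz yz; have [xy|/ltW yx] := leP x y.
    exact: (H x y xy xz yz).
  by rewrite distrC -sqrrN [- (m _ - _)]opprB; exact: (H y x yx yz xz).
move=> /andP[ax _] /andP[_ yz].
have xz := le_trans xy yz; have ay := le_trans ax xy.
have j1 : intble x y g1 by exact: intble_sub i1.
have j2 : intble x y g2 by exact: intble_sub i2.
have jG : intble x y G by apply: intble_sub (L2r_intble GL).
rewrite (Int_split ax xy); last exact: intble_sub (L2r_intble GL).
rewrite (_ : _ - _ = (w1 y - w1 x) * w2 y + w1 x * (w2 y - w2 x) - Int x y G); last ring.
rewrite (primE p1 ax xy yz) (primE p2 ax xy yz) mulrC -!IntZ// -IntD; try exact: intbleZ.
rewrite -IntB//; last by apply: intbleD; exact: intbleZ.
have jj : intble x y (fun t => w2 y * g1 t + w1 x * g2 t - G t).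
  by apply: intbleB => //; apply: intbleD; exact: intbleZ.
apply: (le_trans (le_norm_Int jj)).
have mi' : intble x y (fun t => `|g1 t| + `|g2 t|) by exact: intble_sub mi.
rewrite expr2 {2}mE// -IntZ//; apply: le_Int => //.
- exact: intble_norm.
- exact: intbleZ.
move=> t /andP[xt ty].
have at_ := le_trans ax xt; have tz := le_trans ty yz.
have D2 : `|w2 y - w2 t| <= m y - m x.
  rewrite (primE p2 at_ ty yz); apply: le_trans (le_norm_Int _) _.
    exact: intble_sub i2.
  rewrite mE//.
  apply: (@le_trans _ _ (Int t y (fun t => `|g1 t| + `|g2 t|))).
    apply: le_Int; [exact/intble_norm/(intble_sub _ _ i2)|exact: (intble_sub _ _ mi)|].
    by move=> s _; rewrite lerDr.
  by apply: Int_le_sub => // s _; rewrite addr_ge0.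
have D1 : `|w1 x - w1 t| <= m y - m x.
  rewrite distrC (primE p1 ax xt tz); apply: le_trans (le_norm_Int _) _.
    exact: intble_sub i1.
  rewrite mE//.
  apply: (@le_trans _ _ (Int x t (fun t => `|g1 t| + `|g2 t|))).
    apply: le_Int; [exact/intble_norm/(intble_sub _ _ i1)|exact: (intble_sub _ _ mi)|].
    by move=> s _; rewrite lerDl.
  by apply: Int_le_sub => // s _; rewrite addr_ge0.
rewrite /G (_ : _ - _ = (w2 y - w2 t) * g1 t + (w1 x - w1 t) * g2 t); last ring.
apply: (le_trans (ler_normD _ _)); rewrite !normrM mulrDr.
by rewrite lerD// ler_wpM2r.
Qed.

Lemma ibp a b w1 g1 w2 g2 : a <= b -> prim a b w1 g1 -> prim a b w2 g2 ->
  ip a b g1 w2 + ip a b w1 g2 = w1 b * w2 b - w1 a * w2 a.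
Proof.
move=> ab p1 p2; rewrite (primE (prim_mul p1 p2) (lexx a) ab (lexx b)) IntD//.
  exact: (L2r_mul p1.1 (prim_L2r p2)).
exact: (L2r_mul (prim_L2r p1) p2.1).
Qed.

Lemma prim_derive a b w g : (forall x, a <= x <= b -> is_derive x 1 w (g x)) ->
  {within `[a, b], continuous g} -> prim a b w g.
Proof.
move=> dw cg; split; first exact: L2r_cont.
move=> x /andP[]; rewrite le_eqVlt => /predU1P[<- _|ax xb].
  by rewrite Intxx addr0.
have aab : a <= a <= b by rewrite lexx ltW// (lt_le_trans ax).
have cw t : a <= t <= b -> {for t, continuous w}.
  move=> tab; apply/differentiable_continuous; rewrite -derivable1_diffP.
  by have [] := dw t tab.
have cgx : {within `[a, x], continuous g}.
  apply: continuous_subspaceW cg => t/=; rewrite !in_itv/= => /andP[-> tx].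
  exact: le_trans xb.
rewrite /Int /Rintegral (continuous_FTC2 (F := w) ax cgx).
- by rewrite /= addrCA subrr addr0.
- split.
  + move=> t; rewrite in_itv/= => /andP[at_ tx].
    have tab : a <= t <= b by rewrite !ltW// (lt_le_trans tx).
    by have [] := dw t tab.
  + by apply: cvg_at_right_filter; exact: cw.
  + by apply: cvg_at_left_filter; apply: cw; rewrite ltW.
- move=> t; rewrite in_itv/= => /andP[at_ tx].
  have tab : a <= t <= b by rewrite !ltW// (lt_le_trans tx).
  by rewrite derive1E; have [_ ->] := dw t tab.
Qed.

End Primitives.

(** * Wirtinger inequalities *)

Section Wirtinger.
Context {R : realType}.
Implicit Types (a b c x y lam sig : R) (f g q u v w : R -> R).

(* Integrate (g - q w)^2 >= 0. *)
Lemma riccati_le a b w g q q' lam : a <= b -> prim a b w g -> prim a b q q' ->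
  (forall x, a <= x <= b -> q' x = - lam ^+ 2 - q x ^+ 2) ->
  lam ^+ 2 * ip a b w w + q b * w b ^+ 2 - q a * w a ^+ 2 <= ip a b g g.
Proof.
move=> ab pw pq qE; have pww := prim_mul pw pw.
have := ibp ab pq pww; set G := fun x => g x * w x + w x * g x.
rewrite -!expr2 => H.
have wL := prim_L2r pw; have qL := prim_L2r pq; have wwL := prim_L2r pww.
have : 0 <= ip a b (fun x => g x - q x * w x) (fun x => g x - q x * w x) by exact: ip_ge0.
rewrite (_ : ip a b _ _ = ip a b g g - (ip a b q' (fun x => w x * w x) + ip a b q G)
    - lam ^+ 2 * ip a b w w).
  by rewrite H; lra.
have i1 := L2r_mul pq.1 wwL; have i2 := L2r_mul qL pww.1; have i3 := L2r_mul pw.1 pw.1.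
have i4 := L2r_mul wL wL.
rewrite /ip -IntD// -IntZ// -IntB//; last exact: intbleD.
rewrite -IntB//; [|by apply: intbleB => //; exact: intbleD|exact: intbleZ].
by apply: eq_Int => x /qE; rewrite /G => ->; ring.
Qed.

(** q = lam cot(lam x + beta) is the logarithmic derivative of sin(lam x + beta), hence a solution
    of the Riccati equation that [riccati_le] asks for. *)
Lemma is_derive_cot lam beta x : sin (lam * x + beta) != 0 ->
  is_derive x 1 (fun x => lam * (cos (lam * x + beta) / sin (lam * x + beta)))
    (- lam ^+ 2 - (lam * (cos (lam * x + beta) / sin (lam * x + beta))) ^+ 2).
Proof.
move=> sn0.
have dl : is_derive x 1 (fun x : R => lam * x + beta) lam.
  apply: (is_derive_eq (is_deriveD (is_deriveZ lam (is_derive_id x 1)) (is_derive_cst beta x 1))).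
  by rewrite addr0 /GRing.scale/= mulr1.
have ds : is_derive x 1 (fun x : R => sin (lam * x + beta)) (lam * cos (lam * x + beta)).
  apply: (is_derive_eq (is_derive1_comp (g := fun x : R => lam * x + beta) (is_derive_sin _) dl)).
  by rewrite ?/GRing.scale/= ?(mulrC lam).
have dc : is_derive x 1 (fun x : R => cos (lam * x + beta)) (- (lam * sin (lam * x + beta))).
  apply: (is_derive_eq (is_derive1_comp (g := fun x : R => lam * x + beta) (is_derive_cos _) dl)).
  by rewrite ?/GRing.scale/= ?(mulrC lam) ?mulNr ?mulrN.
have dv := is_deriveV sn0 ds.
apply: (is_derive_eq (is_deriveZ lam (is_deriveM dc dv))).
rewrite /GRing.scale/= -exprVn.
have h : lam * cos (lam * x + beta) ^+ 2 + lam * sin (lam * x + beta) ^+ 2 = lam.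
  by rewrite -mulrDr cos2Dsin2 mulr1.
by field.
Qed.

Lemma cot_prim a b lam beta :
  (forall x, a <= x <= b -> sin (lam * x + beta) != 0) ->
  prim a b (fun x => lam * (cos (lam * x + beta) / sin (lam * x + beta)))
    (fun x => - lam ^+ 2 - (lam * (cos (lam * x + beta) / sin (lam * x + beta))) ^+ 2).
Proof.
move=> sn0; apply: prim_derive => [x /sn0|]; first exact: is_derive_cot.
apply: continuous_in_subspaceT => x; rewrite inE/= in_itv/= => /sn0 {}sn0.
have cq : {for x, continuous (fun x => lam * (cos (lam * x + beta) / sin (lam * x + beta)))}.
  apply/differentiable_continuous; rewrite -derivable1_diffP.
  by have [] := is_derive_cot sn0.
apply: cvgB; first exact: cvg_cst.
by apply: cvgM; exact: cq.
Qed.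

Lemma wirtinger_cot a b w g lam beta : a <= b -> prim a b w g ->
  (forall x, a <= x <= b -> sin (lam * x + beta) != 0) ->
  lam ^+ 2 * ip a b w w
  + lam * (cos (lam * b + beta) / sin (lam * b + beta)) * w b ^+ 2
  - lam * (cos (lam * a + beta) / sin (lam * a + beta)) * w a ^+ 2 <= ip a b g g.
Proof. by move=> ab pw sn0; apply: (riccati_le ab pw (cot_prim sn0)). Qed.

Lemma wirtinger_left a b w g lam eps : a <= b -> prim a b w g -> w a = 0 ->
  0 < lam -> 0 < eps -> lam * (b - a) + eps < pi ->
  lam ^+ 2 * ip a b w w
  + lam * (cos (lam * (b - a) + eps) / sin (lam * (b - a) + eps)) * w b ^+ 2 <= ip a b g g.
Proof.
move=> ab pw wa l0 e0 lt_pi.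
(* This phase puts a pole of the cotangent at a - eps / lam, just outside [a, b];
   [lam * (b - a) + eps < pi] keeps the next pole beyond b. *)
have := @wirtinger_cot a b w g lam (eps - lam * a) ab pw.
rewrite wa expr0n/= mulr0 subr0.
rewrite (_ : lam * b + (eps - lam * a) = lam * (b - a) + eps); last ring.
apply => x /andP[ax xb]; apply: lt0r_neq0; apply: sin_gt0_pi.
have : lam * (x - a) <= lam * (b - a) by rewrite ler_wpM2l ?lerB// ltW.
have : 0 <= lam * (x - a) by rewrite mulr_ge0 ?subr_ge0// ltW.
move: lt_pi; rewrite !mulrBr; lra.
Qed.

Lemma wirtinger_right a b w g lam eps : a <= b -> prim a b w g -> w b = 0 ->
  0 < lam -> 0 < eps -> lam * (b - a) + eps < pi ->
  lam ^+ 2 * ip a b w w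
  + lam * (cos (lam * (b - a) + eps) / sin (lam * (b - a) + eps)) * w a ^+ 2 <= ip a b g g.
Proof.
move=> ab pw wb l0 e0 lt_pi.
(* Mirror image: the pole is at b + eps / lam, and the sine is negative on [a, b]. *)
have := @wirtinger_cot a b w g lam (- eps - lam * b) ab pw.
rewrite wb expr0n/= mulr0 addr0.
rewrite (_ : lam * a + (- eps - lam * b) = - (lam * (b - a) + eps)); last ring.
rewrite cosN sinN invrN !mulrN mulNr opprK.
apply => x /andP[ax xb]; rewrite -oppr_eq0 -sinN; apply: lt0r_neq0; apply: sin_gt0_pi.
have : lam * (b - x) <= lam * (b - a) by rewrite ler_wpM2l ?lerB// ltW.
have : 0 <= lam * (b - x) by rewrite mulr_ge0 ?subr_ge0// ltW.
move: lt_pi; rewrite !mulrBr; lra.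
Qed.

Lemma le_of_forall_lt1 (A B : R) :
  (forall t, 0 < t -> t < 1 -> t ^+ 2 * A <= B) -> 0 <= A -> A <= B.
Proof.
move=> H A0; rewrite leNgt; apply/negP => BA.
have Ap : 0 < A.
  by have := H 2^-1 ltac:(lra) ltac:(lra); nra.
(* For this d and t = 1 - d, t^2 A >= A - 2 d A = (A + B) / 2, which exceeds B. *)
have d0 : 0 < (A - B) / (4 * A) by rewrite divr_gt0 ?subr_gt0// mulr_gt0.
have B0 : 0 <= B by have := H 2^-1 ltac:(lra) ltac:(lra); nra.
have d1 : (A - B) / (4 * A) < 1 by rewrite ltr_pdivrMr ?mulr_gt0//; lra.
have dA : (A - B) / (4 * A) * A = (A - B) / 4 by field; exact: lt0r_neq0.
move: d0 d1 dA; move: (_ / (4 * A)) => d d0 d1 dA.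
have := H (1 - d) ltac:(lra) ltac:(lra).
rewrite (_ : _ * A = A - 2 * (d * A) + d ^+ 2 * A); last ring.
rewrite dA; have : 0 <= d ^+ 2 * A by rewrite mulr_ge0 ?sqr_ge0.
lra.
Qed.

(** A frequency t / sig slightly below 1 / sig leaves room for a shift of pi (1 - t) / 2. The angle
    at the end opposite to the zero is then exactly pi / 2, where the cotangent vanishes, so no
    boundary term remains; the constant follows as t tends to 1. *)
Lemma wirtinger_half a b w g sig : 0 < sig -> b - a = pi * sig / 2 -> prim a b w g ->
  w a = 0 \/ w b = 0 -> ip a b w w <= sig ^+ 2 * ip a b g g.
Proof.
move=> s0 bE pw wab; have ab : a <= b.
  by rewrite -subr_ge0 bE divr_ge0// mulr_ge0 ?pi_ge0 ?ltW.
apply: le_of_forall_lt1; last exact: ip_ge0.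
move=> t t0 t1; have p0 := pi_gt0 R.
have e0 : 0 < pi * (1 - t) / 2 by rewrite divr_gt0// mulr_gt0// subr_gt0.
have l0 : 0 < t / sig by rewrite divr_gt0.
have lE : t / sig * (b - a) + pi * (1 - t) / 2 = pi / 2.
  by rewrite bE; field; exact: lt0r_neq0.
have lp : t / sig * (b - a) + pi * (1 - t) / 2 < pi by rewrite lE; lra.
suff : (t / sig) ^+ 2 * ip a b w w <= ip a b g g.
  by rewrite expr_div_n -mulrA (mulrC (_ ^-1)) mulrA ler_pdivrMr ?exprn_gt0// (mulrC (ip a b g g)).
case: wab => w0.
  have := wirtinger_left ab pw w0 l0 e0 lp.
  by rewrite lE cos_pihalf mul0r mulr0 mul0r addr0.
have := wirtinger_right ab pw w0 l0 e0 lp.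
by rewrite lE cos_pihalf mul0r mulr0 mul0r addr0.
Qed.

Lemma ip_split c a b f g : a <= c -> c <= b -> L2r a b f -> L2r a b g ->
  ip a b f g = ip a c f g + ip c b f g.
Proof. by move=> ac cb fL gL; apply: Int_split => //; exact: L2r_mul. Qed.

(* The cotangents contributed by the two sides of a zero of w have opposite
   values at angles adding up to pi, and w(a)^2 = w(b)^2. *)
Lemma wirtinger_antiperiodic a b w g sig : 0 < sig -> b - a = pi * sig -> prim a b w g ->
  w a = - w b -> ip a b w w <= sig ^+ 2 * ip a b g g.
Proof.
move=> s0 bE pw wab; have ab : a <= b.
  by rewrite -subr_ge0 bE mulr_ge0 ?pi_ge0 ?ltW.
have [c + wc] : exists2 c, c \in `[a, b] & w c = 0.
  apply: (IVT ab (prim_cont pw)); rewrite wab ge_min le_max.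
  by have [h|h] := leP 0 (w b); apply/andP; split; apply/orP; [left|right|right|left]; lra.
rewrite in_itv/= => /andP[ac cb].
have pl := prim_sub (lexx a) cb pw; have pr := prim_sub ac (lexx b) pw.
apply: le_of_forall_lt1; last exact: ip_ge0.
move=> t t0 t1; have p0 := pi_gt0 R.
have e0 : 0 < pi * (1 - t) / 2 by rewrite divr_gt0// mulr_gt0// subr_gt0.
have l0 : 0 < t / sig by rewrite divr_gt0.
have lE : t / sig * (c - a) + pi * (1 - t) / 2 = pi - (t / sig * (b - c) + pi * (1 - t) / 2).
  have -> : b = a + pi * sig by rewrite -bE addrC subrK.
  by field; exact: lt0r_neq0.
have l1 : 0 <= t / sig * (c - a) by rewrite mulr_ge0 ?subr_ge0// ltW.
have l2 : 0 <= t / sig * (b - c) by rewrite mulr_ge0 ?subr_ge0// ltW.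
suff : (t / sig) ^+ 2 * ip a b w w <= ip a b g g.
  by rewrite expr_div_n -mulrA (mulrC (_ ^-1)) mulrA ler_pdivrMr ?exprn_gt0// (mulrC (ip a b g g)).
have := @wirtinger_left c b w g (t / sig) _ cb pr wc l0 e0 ltac:(lra).
have := @wirtinger_right a c w g (t / sig) _ ac pl wc l0 e0 ltac:(lra).
rewrite lE cosB sinB cospi sinpi !mul0r !mulN1r addr0 add0r opprK.
rewrite (ip_split ac cb (prim_L2r pw) (prim_L2r pw)) (ip_split ac cb pw.1 pw.1).
by rewrite wab sqrrN mulNr mulrN mulNr; lra.
Qed.

End Wirtinger.

(** * Orthogonal projections and the duality step *)

Section Spans.
Context {R : realType}.
Variable P : R.
Implicit Types (f g u v w : R -> R) (b : bool * bool).

Definition comb n (F : 'I_n -> R -> R) (c : 'I_n -> R) (x : R) : R :=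
  \sum_(j < n) c j * F j x.

Lemma L2r_comb n (F : 'I_n -> R -> R) c :
  (forall j, L2r 0 P (F j)) -> L2r 0 P (comb F c).
Proof. by move=> FL; apply: L2r_sum => j; exact: L2rZ. Qed.

Lemma ip_comb n (F : 'I_n -> R -> R) c g :
  (forall j, L2r 0 P (F j)) -> L2r 0 P g ->
  ip 0 P g (comb F c) = \sum_(j < n) c j * ip 0 P g (F j).
Proof.
move=> FL gL; rewrite ipC ip_suml//; last by move=> j; exact: L2rZ.
by apply: eq_bigr => j _; rewrite ipZl// ipC.
Qed.

Lemma ip_eq0 f g : L2r 0 P f -> L2r 0 P g -> ip 0 P f f = 0 -> ip 0 P g f = 0.
Proof.
move=> fL gL f0; have := ip_CS gL fL; rewrite f0 mulr0 => h.
by apply/eqP; rewrite -sqrf_eq0 eq_le h sqr_ge0.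
Qed.

(** The Gram matrix may be singular, but the normal equations are solvable: a vector in its cokernel
    gives a combination of zero norm, which is orthogonal to [g]. *)
Lemma orthogonal_projection n (F : 'I_n -> R -> R) g :
  (forall j, L2r 0 P (F j)) -> L2r 0 P g ->
  exists c, forall j, ip 0 P (fun x => g x - comb F c x) (F j) = 0.
Proof.
move=> FL gL.
pose G : 'M[R]_n := \matrix_(i, j) ip 0 P (F i) (F j).
pose b : 'rV[R]_n := \row_j ip 0 P g (F j).
have /submxP[D bD] : (b <= G)%MS.
  rewrite submxE; apply/eqP/rowP => k; rewrite !mxE.
  set y := fun j : 'I_n => cokermx G j k.
  have G0 i : \sum_j G i j * y j = 0.
    by have := mulmx_coker G; move/matrixP => /(_ i k); rewrite !mxE.
  have yL := L2r_comb y FL.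
  have yy0 : ip 0 P (comb F y) (comb F y) = 0.
    rewrite ip_comb// big1// => j _; rewrite ipC ip_comb//.
    rewrite (_ : \sum_i _ = \sum_i G j i * y i); first by rewrite G0 mulr0.
    by apply: eq_bigr => i _; rewrite mxE mulrC.
  rewrite -[RHS](ip_eq0 yL gL yy0) ip_comb//.
  by apply: eq_bigr => j _; rewrite mxE mulrC.
exists (fun i => D 0 i) => j.
rewrite ipBl//; last exact: L2r_comb.
rewrite ipC (ipC _ _ (comb _ _)) ip_comb// ipC.
have := congr1 (fun A : 'rV_n => A 0 j) bD; rewrite !mxE => ->.
by apply/eqP; rewrite subr_eq0; apply/eqP; apply: eq_bigr => i _; rewrite mxE ipC.
Qed.

Lemma ip_orth_comb n (F : 'I_n -> R -> R) c f v :
  (forall j, L2r 0 P (F j)) -> L2r 0 P f ->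
  (forall j, ip 0 P f (F j) = 0) -> (forall x, 0 <= x <= P -> v x = comb F c x) ->
  ip 0 P f v = 0.
Proof.
move=> FL fL f0 vE.
rewrite (eq_ip (f' := f) (g' := comb F c))// ip_comb// big1// => j _.
by rewrite f0 mulr0.
Qed.

Lemma ip_pythagoras f g : L2r 0 P f -> L2r 0 P g -> ip 0 P f g = 0 ->
  ip 0 P (fun x => f x - g x) (fun x => f x - g x) = ip 0 P f f + ip 0 P g g.
Proof.
move=> fL gL fg; have fgL := L2rB fL gL.
by rewrite ipBl// !(ipC _ _ _ (fun x => _ - _)) !ipBl// (ipC _ _ g f) fg; ring.
Qed.

Lemma projection_best n (F : 'I_n -> R -> R) g c v c' :
  (forall j, L2r 0 P (F j)) -> L2r 0 P g ->
  (forall j, ip 0 P (fun x => g x - comb F c x) (F j) = 0) ->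
  (forall x, 0 <= x <= P -> v x = comb F c' x) ->
  ip 0 P (fun x => g x - comb F c x) (fun x => g x - comb F c x)
  <= ip 0 P (fun x => g x - v x) (fun x => g x - v x).
Proof.
move=> FL gL orth vE.
have cL := L2r_comb c FL; have c'L := L2r_comb c' FL.
have fL := L2rB gL cL; have hL := L2rB c'L cL.
have o : ip 0 P (fun x => g x - comb F c x) (fun x => comb F c' x - comb F c x) = 0.
  rewrite ipC ipBl// !(ipC _ _ (comb _ _)).
  by rewrite !(ip_orth_comb FL fL orth (v := comb F _) (fun x _ => erefl)) subrr.
have := ip_pythagoras fL hL o.
rewrite (eq_ip (f' := fun x => g x - v x) (g' := fun x => g x - v x)).
- by move=> ->; rewrite lerDl ip_ge0.
- by move=> x /vE ->; ring.
- by move=> x /vE ->; ring.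
Qed.

End Spans.

(* Boundary conditions (l, r): l (resp. r) tells whether vanishing is required
   at 0 (resp. at P); the adjoint of d/dx with conditions b is -d/dx with the
   complementary conditions dualb b. *)
Section Duality.
Context {R : realType}.
Variables (P : R) (P0 : 0 < P).
Implicit Types (f g u v w : R -> R) (b : bool * bool).

Definition bc b w := (b.1 -> w 0 = 0) /\ (b.2 -> w P = 0).

Definition dualb b : bool * bool := (~~ b.1, ~~ b.2).

Lemma dualbK b : dualb (dualb b) = b.
Proof. by case: b => [] [] []. Qed.

Lemma iter_dualb_odd b k : iter k dualb b = if odd k then dualb b else b.
Proof. by elim: k => //= k ->; case: (odd k); rewrite ?dualbK. Qed.

Definition freeb b : bool := ~~ b.1 && ~~ b.2.

Lemma bcB b v w : bc b v -> bc b w -> bc b (fun x => v x - w x).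
Proof.
by move=> [v1 v2] [w1 w2]; split=> h; rewrite ?v1 ?w1 ?v2 ?w2 ?subr0.
Qed.

Lemma ibp_bc b w g z h : prim 0 P w g -> prim 0 P z h -> bc b w -> bc (dualb b) z ->
  ip 0 P w h = - ip 0 P g z.
Proof.
move=> pw pz [w0 wP] [z0 zP]; apply/eqP; rewrite -addr_eq0 addrC (ibp (ltW P0) pw pz).
have -> : w P * z P = 0.
  by move: wP zP => /=; case: b.2 => /= wP zP; [rewrite wP// mul0r|rewrite zP// mulr0].
have -> : w 0 * z 0 = 0.
  by move: w0 z0 => /=; case: b.1 => /= w0 z0; [rewrite w0// mul0r|rewrite z0// mulr0].
by rewrite subrr.
Qed.

Lemma ip1 f : ip 0 P f (fun=> 1) = Int 0 P f.
Proof. by apply: eq_Int => x _; rewrite mulr1. Qed.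

(** The constant of integration meets one endpoint condition; two of them require [g] to have mean
    zero. With none, the constant is spent on giving [w] mean zero, which a second integration under
    the complementary conditions needs. *)
Lemma prim_bc_exists b g : L2r 0 P g -> (freeb (dualb b) -> ip 0 P g (fun=> 1) = 0) ->
  exists w, [/\ prim 0 P w g, bc b w & freeb b -> ip 0 P w (fun=> 1) = 0].
Proof.
rewrite ip1 => gL; pose W x := Int 0 x g.
have PP := ltW P0.
case: b => [] [] [] /= g0.
- exists (fun x => 0 + W x); split=> //; first exact: prim_Int.
  by split=> /= _; rewrite add0r /W ?Intxx ?g0.
- exists (fun x => 0 + W x); split=> //; first exact: prim_Int.
  by split=> //= _; rewrite add0r /W ?Intxx.
- exists (fun x => - W P + W x); split=> //; first exact: prim_Int.
  by split=> //= _; rewrite addNr.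
- exists (fun x => - (Int 0 P W / P) + W x); split=> //; first exact: prim_Int.
  move=> _; have pW : prim 0 P W g.
    by apply: eq_prim (prim_Int 0 gL) => // x _; rewrite add0r.
  rewrite ip1 IntD ?Int_cst//; [|exact: intble_cst|exact/L2r_intble/(prim_L2r pW)].
  by field; exact: lt0r_neq0.
Qed.

(* The dual form of: dist(u, span F) <= sig |u'| for all u with conditions b. *)
Definition annihilator_bound (sig : R) b n (F : 'I_n -> R -> R) :=
  forall g, L2r 0 P g -> (forall j, ip 0 P g (F j) = 0) ->
  exists w, [/\ prim 0 P w g, bc (dualb b) w & ip 0 P w w <= sig ^+ 2 * ip 0 P g g].

(** Index 0 holds the kernel of d/dx when no condition is imposed and the zero function otherwise,
    so that all families obtained by lifting share one index type. *)
Definition family b n (F : 'I_n.+1 -> R -> R) :=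
  F ord0 = (fun=> (freeb b)%:R) /\ forall j, L2r 0 P (F j).

(* The correction terms make lift_family satisfy the conditions dualb b. *)
Definition lift_family b n (F : 'I_n.+1 -> R -> R) (j : 'I_n.+1) : R -> R :=
  if j == ord0 then fun=> (freeb (dualb b))%:R else fun x =>
    - (if b == (true, false) then Int 0 P (F j) else 0) +
    Int 0 x (fun t => F j t - (if freeb b then Int 0 P (F j) / P else 0)).

Lemma prim_lift_family b n (F : 'I_n.+1 -> R -> R) j : family b F -> j != ord0 ->
  prim 0 P (lift_family b F j)
    (fun t => F j t - (if freeb b then Int 0 P (F j) / P else 0)).
Proof.
move=> [_ FL] /negPf j0; rewrite /lift_family j0.
by apply: prim_Int; apply: L2rB => //; exact: L2r_cst.
Qed.

Lemma bc_lift_family b n (F : 'I_n.+1 -> R -> R) j : family b F -> j != ord0 ->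
  bc (dualb b) (lift_family b F j).
Proof.
move=> [_ FL] /negPf j0; rewrite /lift_family j0 /=.
have Fi := L2r_intble (FL j); have PP := ltW P0.
case: b => -[] [] /=; split => //= _.
- rewrite IntB ?Int_cst//; last exact: intble_cst.
  by rewrite mul0r subr0 addNr.
- by rewrite Intxx addr0 oppr0.
- by rewrite Intxx addr0 oppr0.
- rewrite IntB ?Int_cst//; last exact: intble_cst.
  by field; exact: lt0r_neq0.
Qed.

Lemma lift_family_family b n (F : 'I_n.+1 -> R -> R) :
  family b F -> family (dualb b) (lift_family b F).
Proof.
move=> FF; split; first by rewrite /lift_family eqxx.
move=> j; have [->|j0] := eqVneq j ord0.
  by rewrite /lift_family eqxx; exact: L2r_cst.
exact: prim_L2r (prim_lift_family FF j0).
Qed.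

(** Subtracting the combination [S] of lifted functions with the same coefficients leaves a function
    of constant derivative [k]. If [b] is free, the two endpoint conditions of [dualb b] annihilate
    this affine function. Otherwise [k = 0], and the remaining constant is absorbed by index 0 or
    vanishes by an endpoint condition. *)
Lemma lift_family_span b n (F : 'I_n.+1 -> R -> R) c v q : family b F ->
  prim 0 P v q -> bc (dualb b) v -> (forall x, 0 <= x <= P -> q x = comb F c x) ->
  exists c', forall x, 0 <= x <= P -> v x = comb (lift_family b F) c' x.
Proof.
move=> FF pv bv qE; have PP := ltW P0.
have n0 (j : 'I_n) : lift ord0 j != ord0 by rewrite eq_sym neq_lift.
pose S x := \sum_(j < n) c (lift ord0 j) * lift_family b F (lift ord0 j) x.
pose m j := if freeb b then Int 0 P (F j) / P else 0.
have pS : prim 0 P S (fun x => \sum_(j < n) c (lift ord0 j) * (F (lift ord0 j) x - m (lift ord0 j))).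
  by apply: prim_sum => j; apply: primZ; exact: prim_lift_family.
have bS : bc (dualb b) S.
  split=> h; apply: big1 => j _; have [b1 b2] := bc_lift_family FF (n0 j).
    by rewrite b1 ?mulr0.
  by rewrite b2 ?mulr0.
pose k := c ord0 * (freeb b)%:R + \sum_(j < n) c (lift ord0 j) * m (lift ord0 j).
have pz : prim 0 P (fun x => v x - S x) (fun=> k).
  apply: eq_prim (primB pv pS) => // x xP; rewrite qE// /comb big_ord_recl FF.1 /k -addrA.
  congr (_ + _); rewrite -sumrB; apply: eq_bigr => j _; ring.
have [z0 zP] := bcB bv bS.
have zE x : 0 <= x <= P -> v x - S x = v 0 - S 0 + k * x.
  move=> xP; rewrite pz.2//; case/andP: xP => x0 _.
  by rewrite Int_cst// subr0.
suff [a aE] : exists a, forall x, 0 <= x <= P -> v x - S x = a * (freeb (dualb b))%:R.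
  exists (fun j => if j == ord0 then a else c j) => x xP.
  rewrite /comb big_ord_recl eqxx /lift_family eqxx -(aE x xP).
  rewrite -[LHS](subrK (S x)); congr (_ + _); rewrite /S; apply: eq_bigr.
have P_in : 0 <= P <= P by rewrite PP lexx.
have k0 : ~~ freeb b -> k = 0.
  move=> fb; rewrite /k (negPf fb) mulr0 add0r big1// => j _.
  by rewrite /m (negPf fb) mulr0.
have zP' := zE P P_in.
exists (v 0 - S 0) => x xP; rewrite zE//.
move: (zE P P_in) z0 zP k0; clearbody k S; clear -P0.
move: (v 0 - S 0) (v P - S P) => A B; clear -P0; case: b => -[] [] /= -> A0 B0 k0.
- by rewrite k0// mul0r addr0 mulr1.
- by move: (B0 isT); rewrite k0// !mul0r !addr0 mulr0.
- by rewrite k0// A0// !mul0r addr0.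
- move: (B0 isT); rewrite A0// add0r => /eqP; rewrite mulf_eq0 (gt_eqF P0) orbF => /eqP ->.
  by rewrite !mul0r addr0.
Qed.

End Duality.

(** * Propagation of the approximation bounds by integration *)

Section Chain.
Context {R : realType}.
Variables (P : R) (P0 : 0 < P) (sig : R).
Implicit Types (f g u v w : R -> R) (b : bool * bool).

Lemma le_of_sqr_le (A B : R) : 0 <= A -> 0 <= B -> A ^+ 2 <= B * A -> A <= B.
Proof.
rewrite le_eqVlt => /predU1P[<- //|A0] B0; rewrite expr2.
by rewrite ler_pM2r.
Qed.

(* With z' = w, q the projection of w on span F, and zt the primitive of w - q
   given by the bound for F, z - zt lies in the lifted span, so that
   |w|^2 = - <g, z> = - <g, zt> <= sig |g| |w - q|. *)
Lemma lift_annihilator_bound b n (F : 'I_n.+1 -> R -> R) : family P b F ->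
  annihilator_bound P sig b F -> annihilator_bound P sig (dualb b) (lift_family P b F).
Proof.
move=> FF AF g gL gF'; have FL := FF.2.
have g1 : freeb (dualb b) -> ip 0 P g (fun=> 1) = 0.
  by move=> fb; have := gF' ord0; rewrite /lift_family eqxx fb.
have [w [pw bw w1]] := prim_bc_exists P0 gL g1.
have wL := prim_L2r pw.
have [z [pz bz _]] := @prim_bc_exists _ _ P0 (dualb b) w wL ltac:(rewrite dualbK; exact: w1).
have [c eF] := orthogonal_projection FL wL.
set e := fun x => _ in eF.
have eL : L2r 0 P e by apply: L2rB => //; exact: L2r_comb.
have [zt [pzt bzt ztle]] := AF e eL eF.
have pv : prim 0 P (fun x => z x - zt x) (comb F c).
  by apply: eq_prim (primB pz pzt) => // x _; rewrite /e; ring.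
have [c' vE] := lift_family_span P0 FF pv (bcB bz bzt) (fun x _ => erefl).
exists w; split=> //; first by rewrite dualbK.
have ee : ip 0 P e e <= ip 0 P w w.
  rewrite -[leRHS](eq_ip (f := fun x => w x - 0) (g := fun x => w x - 0));
    [|by move=> x _; rewrite subr0..].
  apply: (projection_best (v := fun=> 0) (c' := fun=> 0) FL wL eF) => x _.
  by rewrite /comb big1// => j _; rewrite mul0r.
have gv := ip_orth_comb (lift_family_family FF).2 gL gF' vE.
have ztL := prim_L2r pzt.
have gz : ip 0 P w w = - ip 0 P g zt.
  rewrite (ibp_bc P0 pw pz bw bz); congr (- _).
  move: gv; rewrite ipC ipBl//; last exact: prim_L2r pz.
  by move=> /eqP; rewrite subr_eq0 => /eqP; rewrite !(ipC _ _ _ g).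
apply: le_of_sqr_le; [exact: ip_ge0|by rewrite mulr_ge0 ?sqr_ge0 ?ip_ge0|].
rewrite {1}gz sqrrN; apply: (le_trans (ip_CS gL ztL)).
rewrite -mulrA mulrCA ler_wpM2l ?ip_ge0//.
by apply: (le_trans ztle); rewrite ler_wpM2l ?sqr_ge0.
Qed.

Definition dist_le n (F : 'I_n -> R -> R) u (B : R) :=
  exists c, ip 0 P (fun x => u x - comb F c x) (fun x => u x - comb F c x) <= B.

(** The residual f of the projection has a primitive w with the complementary conditions, so |f|^2 =
    <u, f> = - <g, w> <= sig |g| |f|. *)
Lemma dist_le_prim_base b n (F : 'I_n.+1 -> R -> R) u g : family P b F ->
  annihilator_bound P sig b F -> prim 0 P u g -> bc P b u ->
  dist_le F u (sig ^+ 2 * ip 0 P g g).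
Proof.
move=> [F0 FL] AF pu bu; have uL := prim_L2r pu.
have [c fF] := orthogonal_projection FL uL; exists c; set f := fun x => _ in fF *.
have fL : L2r 0 P f by apply: L2rB => //; exact: L2r_comb.
have [w [pw bw wle]] := AF f fL fF; have wL := prim_L2r pw.
have ff : ip 0 P f f = - ip 0 P g w.
  rewrite -(ibp_bc P0 pu pw bu bw) {1}/f ipBl//; last exact: L2r_comb.
  by rewrite (ipC _ _ (comb _ _)) (ip_orth_comb FL fL fF (fun x _ => erefl (comb F c x))) subr0 ipC.
apply: le_of_sqr_le; [exact: ip_ge0|by rewrite mulr_ge0 ?sqr_ge0 ?ip_ge0|].
rewrite {1}ff sqrrN; apply: (le_trans (ip_CS pu.1 wL)).
by rewrite -mulrA mulrCA ler_wpM2l ?ip_ge0.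
Qed.

(** If w is the primitive that [AF] gives for the residual e of g, then u - w has its derivative in
    the span of [F] and satisfies [dualb b], so it lies in the lifted span; the error is at most |w|
    <= sig |e|. *)
Lemma dist_le_prim_lift b n (F : 'I_n.+1 -> R -> R) u g B : family P b F ->
  annihilator_bound P sig b F -> prim 0 P u g -> bc P (dualb b) u ->
  dist_le F g B -> dist_le (lift_family P b F) u (sig ^+ 2 * B).
Proof.
move=> FF AF pu bu [c' gle]; have FL := FF.2; have gL := pu.1.
have [c eF] := orthogonal_projection FL gL; set e := fun x => _ in eF.
have eL : L2r 0 P e by apply: L2rB => //; exact: L2r_comb.
have [w [pw bw wle]] := AF e eL eF.
have pv : prim 0 P (fun x => u x - w x) (comb F c).
  by apply: eq_prim (primB pu pw) => // x _; rewrite /e; ring.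
have [c1 vE] := lift_family_span P0 FF pv (bcB bu bw) (fun x _ => erefl).
exists c1; rewrite (eq_ip (f' := w) (g' := w)); [|by move=> x /vE <-; ring..].
apply: (le_trans wle); rewrite ler_wpM2l ?sqr_ge0//.
by apply: le_trans gle; apply: (projection_best (c' := c') FL gL eF).
Qed.

(** [u] lists a function followed by its derivatives. All orders up to [m] are covered at once,
    since one space of degree d has to serve every r <= d + 1. *)
Definition approx b n (F : 'I_n -> R -> R) (m : nat) :=
  forall r, (r <= m)%N -> forall u : nat -> R -> R, L2r 0 P (u r) ->
    (forall k, (k < r)%N -> prim 0 P (u k) (u k.+1) /\ bc P (iter k dualb b) (u k)) ->
    dist_le F (u 0%N) ((sig ^+ 2) ^+ r * ip 0 P (u r) (u r)).

Lemma dist_le0 n (F : 'I_n -> R -> R) u : dist_le F u (ip 0 P u u).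
Proof.
exists (fun=> 0); rewrite (eq_ip (f' := u) (g' := u))// => x _;
by rewrite /comb big1 ?subr0// => j _; rewrite mul0r.
Qed.

Lemma approx_base b n (F : 'I_n.+1 -> R -> R) : family P b F ->
  annihilator_bound P sig b F -> approx b F 1.
Proof.
move=> FF AF [|[|//]] _ u uL ch.
  by rewrite expr0 mul1r; exact: dist_le0.
have [pu bu] := ch 0%N isT.
by rewrite expr1; exact: (dist_le_prim_base FF AF).
Qed.

Lemma approx_lift b n (F : 'I_n.+1 -> R -> R) m : family P b F ->
  annihilator_bound P sig b F -> approx b F m ->
  approx (dualb b) (lift_family P b F) m.+1.
Proof.
move=> FF AF ap [|r] rm u uL ch.
  by rewrite expr0 mul1r; exact: dist_le0.
have [pu bu] := ch 0%N isT.
rewrite exprS -mulrA; apply: (dist_le_prim_lift FF AF pu bu).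
apply: (ap r rm (fun k => u k.+1) uL) => k kr.
have [p1 b1] := ch k.+1 kr; split=> //.
by move: b1; rewrite iterSr dualbK.
Qed.

End Chain.

(** * Splines as iterated primitives of step functions *)

Section Splines.
Context {R : realType}.
Variables (P : R) (P0 : 0 < P) (tau : seq R).
Implicit Types (f g : R -> R).

Definition step_fun f := forall j, (j <= size tau)%N ->
  exists c, forall x, nth P (0 :: tau) j < x < nth P tau j -> f x = c.

(** Each integration raises both the degree and the smoothness by one; the polynomial pieces are
    recovered in [rspline_poly]. *)
Fixpoint rspline (d : nat) f : Prop :=
  if d is d'.+1 then exists2 g, rspline d' g & prim 0 P f g else step_fun f.

Lemma step_fun_cst c : step_fun (fun=> c).
Proof. by move=> j _; exists c. Qed.

Lemma rspline_cst d c : rspline d (fun=> c).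
Proof.
elim: d c => [|d IH] c /=; first exact: step_fun_cst.
by exists (fun=> 0) => //; exact: prim_cst.
Qed.

Lemma rsplineD d f g : rspline d f -> rspline d g -> rspline d (fun x => f x + g x).
Proof.
elim: d f g => [|d IH] f g /=.
  move=> fs gs j jt; have [c fc] := fs j jt; have [c' gc] := gs j jt.
  by exists (c + c') => x xj; rewrite fc// gc.
move=> [f' f's pf] [g' g's pg]; exists (fun x => f' x + g' x); first exact: IH.
exact: primD.
Qed.

Lemma rsplineZ d k f : rspline d f -> rspline d (fun x => k * f x).
Proof.
elim: d f => [|d IH] f /=.
  move=> fs j jt; have [c fc] := fs j jt.
  by exists (k * c) => x xj; rewrite fc.
move=> [f' f's pf]; exists (fun x => k * f' x); first exact: IH.
exact: primZ.
Qed.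

Lemma rspline_comb d n (F : 'I_n -> R -> R) c : (forall j, rspline d (F j)) ->
  rspline d (comb F c).
Proof.
rewrite /comb => Fs.
suff H (r : seq 'I_n) : rspline d (fun x => \sum_(j <- r) c j * F j x) by exact: H.
elim: r => [|j r IH].
  rewrite (_ : (fun _ => _) = (fun=> 0)); first exact: rspline_cst.
  by apply/funext => x; rewrite big_nil.
rewrite (_ : (fun _ => _) = (fun x => c j * F j x + \sum_(j <- r) c j * F j x)).
  exact/rsplineD/IH/rsplineZ.
by apply/funext => x; rewrite big_cons.
Qed.

Lemma rspline_lift_family b d n (F : 'I_n.+1 -> R -> R) : family P b F ->
  (forall j, rspline d (F j)) -> forall j, rspline d.+1 (lift_family P b F j).
Proof.
move=> FF Fs j; have [->|j0] := eqVneq j ord0.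
  by rewrite /lift_family eqxx; exact: rspline_cst.
exists (fun t => F j t - (if freeb b then Int 0 P (F j) / P else 0)); last exact: prim_lift_family.
exact: (rsplineD (Fs j) (rspline_cst _ _)).
Qed.

(** A base family for [b] ends up adapted to [iter d dualb b]. The induction also carries the
    annihilator bound, which every lifting consumes. *)
Lemma spline_chain sig b n (F : 'I_n.+1 -> R -> R) d : family P b F ->
  annihilator_bound P sig b F -> (forall j, step_fun (F j)) ->
  exists G : 'I_n.+1 -> R -> R, [/\ family P (iter d dualb b) G,
    approx P sig (iter d dualb b) G d.+1 & forall j, rspline d (G j)].
Proof.
move=> FF AF Fs.
suff [G [H1 _ H2 H3]] : exists G : 'I_n.+1 -> R -> R, [/\ family P (iter d dualb b) G,
    annihilator_bound P sig (iter d dualb b) G,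
    approx P sig (iter d dualb b) G d.+1 & forall j, rspline d (G j)] by exists G.
elim: d => [|d [G [GF GA Ga Gs]]].
  by exists F; split=> //; exact: approx_base.
exists (lift_family P (iter d dualb b) G); split.
- exact: lift_family_family.
- exact: lift_annihilator_bound.
- exact: approx_lift.
- exact: rspline_lift_family.
Qed.

End Splines.

(** * Piecewise constant base spaces *)

Section Mesh.
Context {R : realType}.
Implicit Types (P sig : R) (f g w : R -> R).

(** The flag [s] shifts the equally spaced points by half a cell. With [sig] equal to 1 / (n + 1) or
    1 / (2 n + 1), these are the two kinds of knots, together with the endpoints that the points may
    hit. *)
Definition node sig (s : bool) (k : nat) : R := (k%:R + s%:R / 2) * (pi * sig).

Lemma node_succ sig s k : node sig s k.+1 = node sig s k + pi * sig.
Proof. by rewrite /node -natr1; ring. Qed.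

Lemma le_node sig s k l : 0 < sig -> (k <= l)%N -> node sig s k <= node sig s l.
Proof.
move=> s0 kl; rewrite /node ler_wpM2r ?lerD2r ?ler_nat//.
by rewrite mulr_ge0 ?pi_ge0 ?ltW.
Qed.

Lemma node_ge0 sig s k : 0 < sig -> 0 <= node sig s k.
Proof.
move=> s0; rewrite /node mulr_ge0 ?addr_ge0 ?divr_ge0 ?ler0n//.
by rewrite mulr_ge0 ?pi_ge0 ?ltW.
Qed.

(** [s] and [e] tell whether half a cell is left over at the start and at the end. Full cells obey
    [wirtinger_antiperiodic] and half cells [wirtinger_half], with the same constant, so the
    inequalities add up. *)
Lemma mesh_wirtinger P sig (s e : bool) N w g : 0 < sig ->
  P = node sig s N + e%:R * (pi * sig / 2) -> prim 0 P w g ->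
  (forall k, (k < N)%N -> w (node sig s k) = - w (node sig s k.+1)) ->
  (s -> w 0 = 0 \/ w (node sig s 0) = 0) ->
  (e -> w (node sig s N) = 0 \/ w P = 0) ->
  ip 0 P w w <= sig ^+ 2 * ip 0 P g g.
Proof.
move=> s0 PE pw anti left right; set p := node sig s in PE anti left right *.
have ps0 : 0 <= pi * sig by rewrite mulr_ge0 ?pi_ge0 ?ltW.
have wL := prim_L2r pw; have gL := pw.1.
have pN : p N <= P by rewrite PE lerDl mulr_ge0 ?ler0n ?divr_ge0.
have pP k : (k <= N)%N -> p k <= P by move=> kN; apply: le_trans pN; exact: le_node.
have p0 k : 0 <= p k by exact: node_ge0.
have L2s x y f : 0 <= x -> y <= P -> L2r 0 P f -> L2r x y f by move=> *; exact: (@L2r_sub _ 0 P).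
have H k : (k <= N)%N -> ip 0 (p k) w w <= sig ^+ 2 * ip 0 (p k) g g.
  elim: k => [_|k IH kN].
    case: (boolP s) => sE; last first.
      by rewrite /p /node (negPf sE) mul0r addr0 mul0r /ip !Intxx mulr0.
    apply: wirtinger_half => //; last exact: left.
      by rewrite /p /node sE /= mulr1n; field.
    by apply: prim_sub pw => //; exact: pP.
  have kk : p k <= p k.+1 by exact: le_node.
  have kP := pP _ kN.
  rewrite (@ip_split _ (p k) 0 (p k.+1) w w) ?(@ip_split _ (p k) 0 (p k.+1) g g)//; try exact: L2s.
  rewrite mulrDr; apply: lerD; first by apply: IH; exact: ltnW.
  apply: wirtinger_antiperiodic => //; last exact: anti.
    by rewrite /p node_succ addrC addKr.
  exact: prim_sub pw.
rewrite (@ip_split _ (p N) 0 P w w)// (@ip_split _ (p N) 0 P g g)//.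
rewrite mulrDr; apply: lerD; first exact: H.
case: (boolP e) => eE.
  apply: wirtinger_half => //; last exact: right.
    by rewrite PE eE mul1r addrC addKr.
  exact: prim_sub pw.
by rewrite PE (negPf eE) mul0r addr0 /ip !Intxx mulr0.
Qed.

Lemma anti_zero (v : nat -> R) N i : (forall k, (k < N)%N -> v k = - v k.+1) ->
  (i <= N)%N -> v i = 0 -> forall k, (k <= N)%N -> v k = 0.
Proof.
move=> anti iN vi.
have v0 : v 0%N = 0.
  elim: i iN vi => // i IH iN vi; apply: IH; first exact: ltnW.
  by rewrite anti// vi oppr0.
elim=> // k IH kN; apply/eqP; rewrite -oppr_eq0 -anti//.
by rewrite IH// ltnW.
Qed.

(** Pairing a function with [cut t] evaluates its primitive from 0 at t, which turns pointwise
    conditions on primitives into orthogonality relations. *)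
Definition cut (t x : R) : R := (x <= t)%R%:R.

Lemma L2r_cut P t : L2r 0 P (cut t).
Proof.
have mc : measurable_fun `[0, P] (cut t).
  rewrite (_ : cut t = \1_(`]-oo, t]%classic)); first exact: measurable_indic.
  apply/funext => x; rewrite /cut indicE; congr ((nat_of_bool _)%:R).
  by apply/idP/idP; rewrite inE/= in_itv.
split=> //; apply: (le_integrable _ _ _ (intble_cst 0 P 1)) => //.
  by apply/measurable_EFinP; exact: measurable_funX.
by move=> x _ /=; rewrite lee_fin /cut; case: (x <= t); rewrite ?expr1n ?expr0n/= ?normr1 ?normr0.
Qed.

Lemma ip_cut P t g : L2r 0 P g -> 0 <= t <= P -> ip 0 P g (cut t) = Int 0 t g.
Proof.
move=> gL /andP[t0 tP]; have cL := L2r_cut P t.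
have gi := L2r_mul gL cL.
rewrite /ip (Int_split t0 tP gi) -[RHS]addr0; congr (_ + _).
  by apply: eq_Int => x /andP[_ xt]; rewrite /cut xt mulr1.
rewrite /Int -Rintegral_itv_obnd_cbnd; last first.
  apply: integrableS gi => // x/=; rewrite !in_itv/= => /andP[tx ->].
  by rewrite (le_trans t0 (ltW tx)).
rewrite (@eq_Rintegral _ _ _ _ _ (fun=> 0)).
  by rewrite Rintegral_cst// mul0r.
by move=> x; rewrite inE/= in_itv/= /cut => /andP[tx _]; rewrite leNgt tx mulr0.
Qed.

Lemma step_fun_cut P tau t :
  (forall j, (j <= size tau)%N -> t <= nth P (0 :: tau) j \/ nth P tau j <= t) ->
  step_fun P tau (cut t).
Proof.
move=> H j jt; have [tj|jt'] := H j jt.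
  by exists 0 => x /andP[jx _]; rewrite /cut leNgt (le_lt_trans tj jx).
by exists 1 => x /andP[_ xj]; rewrite /cut (ltW (lt_le_trans xj jt')).
Qed.

End Mesh.

Section BaseFamily.
Context {R : realType}.
Variables (P sig : R) (s0 : 0 < sig).
Implicit Types (f g w : R -> R).

(** Orthogonality of g to a function of positive index says that its primitives satisfy w x_(k+o) +
    w x_(k+o+1) = w y0 + w y1, with x the nodes. The reference points [y0] and [y1] fix the constant
    of integration by making this common value 0; the offset [o] skips a cell that serves as the
    reference. *)
Definition base_family (b : bool * bool) (o : nat) (s : bool) (y0 y1 : R) n
    (j : 'I_n.+1) : R -> R :=
  if unlift ord0 j is Some k then fun x =>
    cut (node sig s (k + o)) x + cut (node sig s (k + o).+1) x - (cut y0 x + cut y1 x)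
  else fun=> (freeb b)%:R.

Lemma base_family_family b o s y0 y1 n : family P b (@base_family b o s y0 y1 n).
Proof.
split; first by rewrite /base_family unlift_none.
move=> j; rewrite /base_family; case: unliftP => [k|] _; last exact: L2r_cst.
by apply: L2rB; apply: L2rD; exact: L2r_cut.
Qed.

(* The primitive w of g is normalized by w y0 + w y1 = 0; orthogonality of g to
   the family makes w alternate at the remaining nodes. *)
Lemma base_annihilator_bound b o (s e : bool) y0 y1 n N :
  P = node sig s N + e%:R * (pi * sig / 2) -> (n + o <= N)%N ->
  0 <= y0 <= P -> 0 <= y1 <= P ->
  (forall w, w y0 + w y1 = 0 -> (freeb b -> w 0 = w P) ->
    (forall k, (k < n)%N -> w (node sig s (k + o)) = - w (node sig s (k + o).+1)) ->
    [/\ bc P (dualb b) w,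
        forall k, (k < N)%N -> w (node sig s k) = - w (node sig s k.+1),
        s -> w 0 = 0 \/ w (node sig s 0) = 0
      & e -> w (node sig s N) = 0 \/ w P = 0]) ->
  annihilator_bound P sig b (@base_family b o s y0 y1 n).
Proof.
move=> PE nN y0P y1P H g gL gF.
have node_in k : (k <= N)%N -> 0 <= node sig s k <= P.
  move=> kN; rewrite node_ge0//= (le_trans (le_node s s0 kN))// PE lerDl.
  by rewrite mulr_ge0 ?ler0n// divr_ge0// mulr_ge0 ?pi_ge0 ?ltW.
pose w x := - ((Int 0 y0 g + Int 0 y1 g) / 2) + Int 0 x g.
have pw : prim 0 P w g by exact: prim_Int.
have [||k kn|bw h1 h2 h3] := H w.
- by rewrite /w; field.
- move=> fb; rewrite /w Intxx.
  have := gF ord0; rewrite /base_family unlift_none fb.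
  by rewrite ip1 => ->.
- have := gF (lift ord0 (Ordinal kn)); rewrite /base_family liftK /=.
  have k1 : (k + o <= N)%N by rewrite (leq_trans _ nN)// leq_add2r ltnW.
  have k2 : ((k + o).+1 <= N)%N by rewrite (leq_trans _ nN)// -addSn leq_add2r.
  have cL t := @L2r_cut _ P t.
  rewrite ipC ipBl ?ipDl//; try exact: L2rD.
  rewrite !(ipC _ _ _ g) !ip_cut ?node_in// /w; lra.
- exists w; split=> //.
  exact: (mesh_wirtinger s0 PE pw h1 h2 h3).
Qed.

(** All jumps are at nodes, or outside ]0, P[ where they are invisible. The list starts at [~~ s]
    because the unshifted node 0 is the endpoint 0 and not a knot; [m + ~~ s] is then the first
    index after the list. *)
Lemma base_family_step b o s y0 y1 n N m : (n + o <= N)%N ->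
  let tau := [seq node sig s k | k <- iota (~~ s) m] in
  (forall k, (k < m + ~~ s)%N -> node sig s k <= P) ->
  (forall k, (m + ~~ s <= k <= N)%N -> P <= node sig s k) ->
  (forall y, y \in [:: y0; y1] -> [\/ y <= 0, P <= y | exists2 k, (k <= N)%N & y = node sig s k]) ->
  forall j, step_fun P tau (@base_family b o s y0 y1 n j).
Proof.
move=> nN tau leP geP yP.
have lastP j : (j <= size tau)%N -> nth P tau j <= P.
  rewrite size_map size_iota => jm; have [jm'|jm'] := ltnP j m.
    by rewrite (nth_map 0%N) ?size_iota// nth_iota// leP// addnC ltn_add2r.
  by rewrite nth_default// size_map size_iota.
have firstP j : (j <= size tau)%N -> 0 <= nth P (0 :: tau) j.
  case: j => //= j; rewrite size_map size_iota => jm.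
  by rewrite (nth_map 0%N) ?size_iota// nth_iota// node_ge0.
have nodeP k : (k <= N)%N -> step_fun P tau (cut (node sig s k)).
  move=> kN; apply: step_fun_cut => j jm; have := jm; rewrite size_map size_iota => jm'.
  have [kj|jk] := ltnP k (j + ~~ s); [left|right].
    case: j jm jm' kj => [|j] jm jm' kj /=.
      by case: s tau {leP geP yP lastP firstP jm} kj => //=; case: k kN => // _ _ _; rewrite /node !add0r mul0r mul0r.
    rewrite (nth_map 0%N) ?size_iota// nth_iota//; apply: le_node => //.
    by rewrite addnC -ltnS -addSn.
  have [jm2|jm2] := ltnP j m.
    by rewrite (nth_map 0%N) ?size_iota// nth_iota// le_node// addnC.
  rewrite nth_default ?size_map ?size_iota//; apply: geP; rewrite kN andbT.
  by rewrite (leq_trans _ jk)// leq_add2r.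
have yS y : y \in [:: y0; y1] -> step_fun P tau (cut y).
  move=> /yP[yl|yr|[k kN ->]]; last exact: nodeP.
    by apply: step_fun_cut => j jm; left; apply: le_trans yl _; exact: firstP.
  by apply: step_fun_cut => j jm; right; apply: le_trans yr; exact: lastP.
move=> j; rewrite /base_family; case: unliftP => [k|] _; last exact: step_fun_cst.
have k2 : ((k + o).+1 <= N)%N by rewrite (leq_trans _ nN)// -addSn leq_add2r.
have s1 := rsplineD (d := 0) (nodeP _ (ltnW k2)) (nodeP _ k2).
have s2 := rsplineD (d := 0) (yS y0 ltac:(by rewrite inE eqxx)) (yS y1 ltac:(by rewrite !inE eqxx orbT)).
have := rsplineD s1 (rsplineZ (-1) s2); rewrite /rspline.
by under [in X in step_fun _ _ X]eq_fun do rewrite mulN1r.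
Qed.

End BaseFamily.

(** * Base spaces for all boundary conditions and both knot vectors *)

Section Bases.
Context {R : realType}.

Lemma node0 (sig : R) : node sig false 0 = 0.
Proof. by rewrite /node mul0r addr0 mul0r. Qed.

Lemma base_pi n (b : bool * bool) (s : bool) : b.1 = b.2 ->
  let sig := n.+1%:R^-1 : R in
  exists F : 'I_n.+1 -> R -> R, [/\ family pi b F, annihilator_bound pi sig b F
    & forall j, step_fun pi [seq node sig s k | k <- iota (~~ s) (n + s)] (F j)].
Proof.
move=> bE sig; have s0 : 0 < sig by rewrite invr_gt0 ltr0n.
have P0 := pi_gt0 R.
have ps0 : 0 < pi * sig by rewrite mulr_gt0.
pose N := (n + ~~ s)%N.
have nR : n.+1%:R != 0 :> R by rewrite pnatr_eq0.
have PE : pi = node sig s N + s%:R * (pi * sig / 2).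
  rewrite /N /node /sig; case: (s) => /=; rewrite ?addn0 ?addn1 -natr1 in nR *; field; exact: nR.
have node_le k : (k <= N)%N -> 0 <= node sig s k <= pi.
  move=> kN; rewrite node_ge0//= [leRHS]PE (le_trans (le_node s s0 kN))// lerDl.
  by rewrite mulr_ge0 ?ler0n// divr_ge0// ltW.
have P_in : 0 <= (pi : R) <= pi by rewrite lexx andbT ltW.
have z_in : 0 <= (0 : R) <= pi by rewrite lexx ltW.
have Ns : (n + s + ~~ s)%N = n.+1 by case: (s); rewrite /= ?addn1 ?addn0 ?addn1.
have st (o : nat) (y0 y1 : R) : (n + o <= N)%N ->
    (forall y, y \in [:: y0; y1] -> [\/ y <= 0, pi <= y | exists2 k, (k <= N)%N & y = node sig s k]) ->
    forall j, step_fun pi [seq node sig s k | k <- iota (~~ s) (n + s)] (@base_family R sig b o s y0 y1 n j).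
  move=> oN yP; apply: (@base_family_step R pi sig s0 b o s y0 y1 n N (n + s) oN _ _ yP).
    move=> k; rewrite Ns ltnS => kn.
    by case/andP: (node_le k (leq_trans kn (leq_addr _ _))).
  move=> k; rewrite Ns => /andP[nk kN].
  have -> : k = N by apply/eqP; rewrite eqn_leq kN (leq_trans _ nk)// /N -addn1 leq_add2l; case: (s).
  have sF : s = false.
    by apply/negbTE/negP => sT; move: (leq_trans nk kN); rewrite /N sT addn0 ltnn.
  by rewrite [leLHS]PE sF mul0r addr0.
case: b bE st => -[] [] //= _ st.
- have [sE|sE] := orP (orbN s).
  (* Shifted nodes: the reference makes w vanish at the first node, hence by alternation at the last
     one, as the two half cells require. *)
  + pose y0 := node sig s 0.
    exists (@base_family R sig (true, true) 0 s y0 y0 n).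
    split; [exact: base_family_family| |apply: st]; last 2 first.
    * by rewrite /N sE !addn0.
    * by move=> y; rewrite !inE orbb => /eqP ->; apply: Or33; exists 0%N.
    apply: (base_annihilator_bound s0 PE); [by rewrite /N sE !addn0|exact: node_le..|].
    move=> w wy _ anti.
    have w0 : w (node sig s 0) = 0 by move: wy; rewrite -/y0; lra.
    have anti' k : (k < N)%N -> w (node sig s k) = - w (node sig s k.+1).
      move=> kN; have kn : (k < n)%N by move: kN; rewrite /N sE addn0.
      by have := anti k kn; rewrite addn0.
    split=> //; [by right|left].
    exact: (@anti_zero _ (fun k => w (node sig s k)) N 0%N anti' (leq0n N) w0 N (leqnn N)).
  (* Unshifted nodes: there are n + 1 cells for n functions, so the first cell is the reference pair
     and [o = 1]. *)
  + have sF := negbTE sE.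
    exists (@base_family R sig (true, true) 1 s (node sig s 0) (node sig s 1) n).
    have N1 : (1 <= N)%N by rewrite /N sF addn1.
    split; [exact: base_family_family| |apply: st]; last 2 first.
    * by rewrite /N sF.
    * move=> y; rewrite !inE => /orP[] /eqP ->; apply: Or33; first by exists 0%N.
      by exists 1%N.
    apply: (base_annihilator_bound s0 PE); [by rewrite /N sF|exact: node_le..|].
    move=> w wy _ anti; split=> //; try by move=> sT; rewrite sT in sF.
    move=> [_|k kN]; first by move: wy; lra.
    have kn : (k < n)%N by move: kN; rewrite /N sF addn1 ltnS.
    by have := anti k kn; rewrite addn1.
(* Here w must vanish at both ends: the reference gives w 0 = 0, and orthogonality to the constant
   gives w pi = w 0. *)
- exists (@base_family R sig (false, false) 0 s 0 0 n).
  have nN : (n + 0 <= N)%N by rewrite addn0 leq_addr.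
  split; [exact: base_family_family| |apply: st => //]; last first.
    by move=> y; rewrite !inE orbb => /eqP ->; apply: Or31.
  apply: (base_annihilator_bound s0 PE) => //.
  move=> w wy /(_ isT) wP anti.
  have w0 : w 0 = 0 by move: wy; lra.
  have wpi : w pi = 0 by rewrite -wP.
  split=> //; [|by left|by right].
  (* Only unshifted nodes have a cell of index n, to which no function is attached; w vanishes at
     node n by alternation from node 0, and at node n + 1, which is pi. *)
  move=> k kN; have [kn|nk] := ltnP k n; first by have := anti k kn; rewrite addn0.
  have sF : s = false.
    by apply/negbTE/negP => sT; move: kN; rewrite /N sT addn0 ltnNge nk.
  have -> : k = n by apply/eqP; rewrite eqn_leq nk andbT -ltnS; move: kN; rewrite /N sF addn1.
  have -> : node sig s n.+1 = pi.
    have NE : N = n.+1 by rewrite /N sF addn1.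
    by rewrite [RHS]PE NE [in RHS]sF mul0r addr0 sF.
  rewrite wpi oppr0.
  apply: (@anti_zero _ (fun k => w (node sig s k)) n 0) => //.
    by move=> l /anti; rewrite addn0.
  by rewrite sF node0.
Qed.

Lemma base_pihalf n (b : bool * bool) (s : bool) : b.1 = ~~ b.2 ->
  let sig := (2 * n + 1)%:R^-1 : R in
  exists F : 'I_n.+1 -> R -> R, [/\ family (pi / 2) b F, annihilator_bound (pi / 2) sig b F
    & forall j, step_fun (pi / 2) [seq node sig s k | k <- iota (~~ s) n] (F j)].
Proof.
move=> bE sig; have s0 : 0 < sig by rewrite invr_gt0 ltr0n addn1.
have P0 : (0 : R) < pi / 2 by rewrite divr_gt0 ?pi_gt0.
have ps0 : 0 < pi * sig by rewrite mulr_gt0 ?pi_gt0.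
have nR : (2 * n + 1)%:R != 0 :> R by rewrite pnatr_eq0 addn1.
have PE : pi / 2 = node sig s n + (~~ s)%:R * (pi * sig / 2).
  rewrite /node /sig; case: (s) => /=; rewrite natrD natrM in nR *; field; exact: nR.
have node_le k : (k <= n)%N -> 0 <= node sig s k <= pi / 2.
  move=> kN; rewrite node_ge0//= [leRHS]PE (le_trans (le_node s s0 kN))// lerDl.
  by rewrite mulr_ge0 ?ler0n// divr_ge0// ltW.
have P_in : 0 <= (pi / 2 : R) <= pi / 2 by rewrite lexx andbT ltW.
have z_in : 0 <= (0 : R) <= pi / 2 by rewrite lexx ltW.
have n0 : (n + 0 <= n)%N by rewrite addn0.
have st (y : R) : y <= 0 \/ pi / 2 <= y ->
    forall j, step_fun (pi / 2) [seq node sig s k | k <- iota (~~ s) n] (@base_family R sig b 0 s y y n j).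
  move=> yP; apply: (@base_family_step R (pi / 2) sig s0 b 0 s y y n n n n0 _ _ _).
  - move=> k kn; have kn' : (k <= n)%N.
      by rewrite -ltnS (leq_trans kn)// -addn1 leq_add2l; case: (s).
    by case/andP: (node_le k kn').
  - move=> k /andP[nk kn].
    have sT : s = true.
      by apply: contraT => sF; move: (leq_trans nk kn); rewrite sF addn1 ltnn.
    have -> : k = n by apply/eqP; rewrite eqn_leq kn (leq_trans _ nk)// leq_addr.
    by rewrite [leLHS]PE sT mul0r addr0.
  - by move=> z; rewrite !inE orbb => /eqP ->; case: yP => ?; [apply: Or31|apply: Or32].
case: b bE st => -[] [] //= _ st.
(* Here w must vanish at pi / 2, taken as reference. For shifted nodes this is node n, and the zero
   travels back to node 0, where the initial half cell ends. *)
- exists (@base_family R sig (true, false) 0 s (pi / 2) (pi / 2) n).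
  split; [exact: base_family_family| |by apply: st; right].
  apply: (base_annihilator_bound s0 PE n0) => //.
  move=> w wy _ anti; have wP : w (pi / 2) = 0 by move: wy; lra.
  have anti' k : (k < n)%N -> w (node sig s k) = - w (node sig s k.+1).
    by move=> /anti; rewrite addn0.
  split=> //; last by right.
  move=> sT; right; apply: (@anti_zero _ (fun k => w (node sig s k)) n n) => //.
  have -> // : node sig s n = pi / 2 by rewrite [RHS]PE sT mul0r addr0.
(* Here w must vanish at 0. For unshifted nodes this is node 0, and the zero travels to node n,
   where the final half cell begins. *)
- exists (@base_family R sig (false, true) 0 s 0 0 n).
  split; [exact: base_family_family| |by apply: st; left].
  apply: (base_annihilator_bound s0 PE n0) => //.
  move=> w wy _ anti; have w0 : w 0 = 0 by move: wy; lra.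
  have anti' k : (k < n)%N -> w (node sig s k) = - w (node sig s k.+1).
    by move=> /anti; rewrite addn0.
  split=> //; first by left.
  move=> sF; left; apply: (@anti_zero _ (fun k => w (node sig s k)) n 0) => //.
  by rewrite (negbTE sF) node0.
Qed.

Lemma dualb_iterK d b : iter d dualb (iter d dualb b) = b.
Proof. by elim: d b => // d IH b; rewrite iterSr iterS dualbK IH. Qed.

Lemma iter_dualb_pi d b : b.1 = b.2 -> (iter d dualb b).1 = (iter d dualb b).2.
Proof. by move=> bE; elim: d => //= d ->. Qed.

Lemma iter_dualb_pihalf d b : b.1 = ~~ b.2 -> (iter d dualb b).1 = ~~ (iter d dualb b).2.
Proof. by move=> bE; elim: d => //= d ->. Qed.

Lemma splines_pi n d (b : bool * bool) (s : bool) : b.1 = b.2 ->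
  let sig := n.+1%:R^-1 : R in
  exists G : 'I_n.+1 -> R -> R, [/\ family pi b G, approx pi sig b G d.+1
    & forall j, rspline pi [seq node sig s k | k <- iota (~~ s) (n + s)] d (G j)].
Proof.
move=> bE sig; have [F [FF FA Fs]] := base_pi n s (iter_dualb_pi d bE).
by have := spline_chain (pi_gt0 R) d FF FA Fs; rewrite dualb_iterK.
Qed.

Lemma splines_pihalf n d (b : bool * bool) (s : bool) : b.1 = ~~ b.2 ->
  let sig := (2 * n + 1)%:R^-1 : R in
  exists G : 'I_n.+1 -> R -> R, [/\ family (pi / 2) b G, approx (pi / 2) sig b G d.+1
    & forall j, rspline (pi / 2) [seq node sig s k | k <- iota (~~ s) n] d (G j)].
Proof.
move=> bE sig; have [F [FF FA Fs]] := base_pihalf n s (iter_dualb_pihalf d bE).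
have P0 : (0 : R) < pi / 2 by rewrite divr_gt0 ?pi_gt0.
by have := spline_chain P0 d FF FA Fs; rewrite dualb_iterK.
Qed.

End Bases.

(** * Trigonometric functions *)

Section Eigen.
Context {R : realType}.
Variables (P : R) (b : bool * bool) (lam : nat -> R) (phi psi : nat -> R -> R).

(** [phi j] and [psi j] are the singular functions of d/dx under the conditions [b], for the
    singular value [lam j]. The identity phi^2 + psi^2 = 1 controls the norm of [phi j]; the last
    clause serves the frequency 0, where [phi j] is constant. *)
Definition eigen_system := [/\ 0 < P,
  forall j k : nat, (j < k)%N -> lam j < lam k, forall j, 0 <= lam j,
  forall j, prim 0 P (phi j) (fun x => lam j * psi j x) /\
            prim 0 P (psi j) (fun x => - lam j * phi j x) &
  forall j, [/\ bc P b (phi j), bc P (dualb b) (psi j),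
    forall x, phi j x ^+ 2 + psi j x ^+ 2 = 1 & lam j = 0 -> forall x, psi j x = 0]].

Hypothesis E : eigen_system.

Let P0 : 0 < P. Proof. by case: E. Qed.
Let pphi j : prim 0 P (phi j) (fun x => lam j * psi j x).
Proof. by case: E => _ _ _ /(_ j)[]. Qed.
Let ppsi j : prim 0 P (psi j) (fun x => - lam j * phi j x).
Proof. by case: E => _ _ _ /(_ j)[]. Qed.
Let bphi j : bc P b (phi j).
Proof. by case: E => _ _ _ _ /(_ j)[]. Qed.
Let bpsi j : bc P (dualb b) (psi j).
Proof. by case: E => _ _ _ _ /(_ j)[]. Qed.
Let lam0 j : 0 <= lam j.
Proof. by case: E => _ _ /(_ j). Qed.

Let phiL j : L2r 0 P (phi j). Proof. exact: prim_L2r (pphi j). Qed.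
Let psiL j : L2r 0 P (psi j). Proof. exact: prim_L2r (ppsi j). Qed.

Lemma eigen_adjoint j l : lam l * ip 0 P (phi j) (phi l) = lam j * ip 0 P (psi j) (psi l).
Proof.
have := ibp_bc P0 (pphi j) (ppsi l) (bphi j) (bpsi l).
rewrite ipZl// ipC ipZl// mulNr => /oppr_inj <-.
by rewrite (ipC _ _ (phi l)).
Qed.

(** Using [eigen_adjoint] in both orders gives lam_l^2 <phi_j, phi_l> = lam_j^2 <phi_j, phi_l>, and
    the squares of distinct frequencies differ; likewise for psi. *)
Lemma eigen_orthogonal j l : j != l ->
  ip 0 P (phi j) (phi l) = 0 /\ ip 0 P (psi j) (psi l) = 0.
Proof.
move=> jl; have h1 := eigen_adjoint j l; have h2 := eigen_adjoint l j.
rewrite (ipC _ _ (phi l)) (ipC _ _ (psi l)) in h2.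
have l2 : lam l ^+ 2 - lam j ^+ 2 != 0.
  rewrite subr_sqr mulf_neq0//.
    rewrite subr_eq0; have [_ mono _ _ _] := E.
    by move: jl; rewrite neq_ltn => /orP[] /mono h; rewrite ?(gt_eqF h) ?(lt_eqF h).
  apply: lt0r_neq0; have [_ mono _ _ _] := E.
  move: jl; rewrite neq_ltn => /orP[] /mono h.
    by rewrite ltr_wpDr// (le_lt_trans (lam0 j)).
  by rewrite ltr_wpDl// (le_lt_trans (lam0 l)).
split; apply: (mulfI l2); rewrite mulr0.
  transitivity (lam l * (lam l * ip 0 P (phi j) (phi l)) - lam j * (lam j * ip 0 P (phi j) (phi l))); first ring.
  by rewrite h1 h2; ring.
transitivity (lam l * (lam l * ip 0 P (psi j) (psi l)) - lam j * (lam j * ip 0 P (psi j) (psi l))); first ring.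
by rewrite -h1 -h2; ring.
Qed.

(** The squared norms of [phi j] and [psi j] add up to P; they are equal if lam_j is nonzero, and
    otherwise [psi j] is 0. *)
Lemma eigen_norm_gt0 j : 0 < ip 0 P (phi j) (phi j).
Proof.
have S : ip 0 P (phi j) (phi j) + ip 0 P (psi j) (psi j) = P.
  rewrite /ip -IntD; try exact: L2r_mul.
  rewrite (@eq_Int _ _ _ _ (fun=> 1)); first by rewrite Int_cst ?mul1r ?subr0 ?ltW.
  by move=> x _; rewrite -!expr2; case: E => _ _ _ _ /(_ j)[_ _ + _]; exact.
have [l0|ln0] := eqVneq (lam j) 0.
  move: S; rewrite [X in _ + X](_ : _ = 0) ?addr0 => [->//|].
  rewrite /ip (@eq_Int _ _ _ _ (fun=> 0)); first by rewrite Int_cst ?mul0r ?ltW.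
  by move=> x _; case: E => _ _ _ _ /(_ j)[_ _ _ ->]; rewrite ?mul0r.
have := mulfI ln0 (eigen_adjoint j j) => e; move: S; rewrite -e.
have := P0; lra.
Qed.

(** The k-th derivative of [phi j], obtained from phi' = lam psi and psi' = - lam phi. *)
Definition eigen_deriv (k j : nat) (x : R) : R :=
  (-1) ^+ k./2 * lam j ^+ k * (if odd k then psi j x else phi j x).

Lemma prim_eigen_deriv k j : prim 0 P (eigen_deriv k j) (eigen_deriv k.+1 j).
Proof.
rewrite /eigen_deriv /= uphalf_half; case: (odd k) => /=; rewrite ?add1n ?add0n.
  apply: eq_prim (primZ ((-1) ^+ k./2 * lam j ^+ k) (ppsi j)) => x _ //.
  by rewrite !exprS; ring.
apply: eq_prim (primZ ((-1) ^+ k./2 * lam j ^+ k) (pphi j)) => x _ //.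
by rewrite !exprS; ring.
Qed.

Lemma bc_eigen_deriv k j : bc P (iter k dualb b) (eigen_deriv k j).
Proof.
rewrite iter_dualb_odd /eigen_deriv; have [h1 h2] := bphi j; have [h3 h4] := bpsi j.
by case: (odd k); split=> h; rewrite ?h1 ?h2 ?h3 ?h4 ?mulr0.
Qed.

Definition eigen_comb M (c : 'I_M -> R) (k : nat) : R -> R :=
  comb (fun j : 'I_M => eigen_deriv k j) c.

Lemma prim_eigen_comb M (c : 'I_M -> R) k : prim 0 P (eigen_comb c k) (eigen_comb c k.+1).
Proof. by apply: prim_sum => j; apply: primZ; exact: prim_eigen_deriv. Qed.

Lemma bc_eigen_comb M (c : 'I_M -> R) k : bc P (iter k dualb b) (eigen_comb c k).
Proof.
by split=> h; apply: big1 => j _; have [h1 h2] := bc_eigen_deriv k j;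
  rewrite ?h1 ?h2 ?mulr0.
Qed.

Lemma L2r_eigen_comb M (c : 'I_M -> R) k : L2r 0 P (eigen_comb c k).
Proof. exact: prim_L2r (prim_eigen_comb c k). Qed.

Lemma ip_eigen_comb M (c : 'I_M -> R) k :
  ip 0 P (eigen_comb c k) (eigen_comb c k) =
  \sum_(j < M) (c j) ^+ 2 * (lam j ^+ 2) ^+ k * ip 0 P (phi j) (phi j).
Proof.
have dL j : L2r 0 P (eigen_deriv k j) := prim_L2r (prim_eigen_deriv k j).
rewrite {1}/eigen_comb ipC ip_comb//; last exact: L2r_eigen_comb.
apply: eq_bigr => j _; rewrite ipC ip_comb// (bigD1 j)//= big1 ?addr0; last first.
  move=> l lj; have jl : (j : nat) != l by rewrite eq_sym.
  have [h1 h2] := eigen_orthogonal jl.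
  suff -> : ip 0 P (eigen_deriv k j) (eigen_deriv k l) = 0 by rewrite mulr0.
  rewrite /eigen_deriv; case: (odd k); rewrite ipZl//; try exact: L2rZ;
  by rewrite ipC ipZl// ipC ?h1 ?h2 !mulr0.
have sgn1 : ((-1) ^+ k./2 * (-1) ^+ k./2 : R) = 1 by rewrite -exprD addnn -signr_odd odd_double.
have -> : ip 0 P (eigen_deriv k j) (eigen_deriv k j) =
    (lam j ^+ 2) ^+ k * (if odd k then ip 0 P (psi j) (psi j) else ip 0 P (phi j) (phi j)).
  rewrite /eigen_deriv -exprM mulnC exprM expr2; case: (odd k); rewrite ipZl//; try exact: L2rZ;
  rewrite ipC ipZl// !mulrA; congr (_ * _).
    transitivity (((-1) ^+ k./2 * (-1) ^+ k./2) * (lam j ^+ k * lam j ^+ k)); first ring.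
    by rewrite sgn1 mul1r.
  transitivity (((-1) ^+ k./2 * (-1) ^+ k./2) * (lam j ^+ k * lam j ^+ k)); first ring.
  by rewrite sgn1 mul1r.
(* For odd k a factor lam_j is available to trade the norm of [psi j] for that of [phi j], even when
   lam_j = 0. *)
case: (boolP (odd k)) => ok; last by ring.
case: k ok {dL sgn1} => // k _; have := eigen_adjoint j j => h.
rewrite !exprS expr0 mulr1.
transitivity (c j * (c j * (lam j * (lam j * lam j) ^+ k * (lam j * ip 0 P (psi j) (psi j))))); first ring.
by rewrite -h; ring.
Qed.

Lemma ip_eigen_comb_le M (c : 'I_M -> R) k (L : R) :
  (forall j : 'I_M, lam j <= L) ->
  ip 0 P (eigen_comb c k) (eigen_comb c k) <= (L ^+ 2) ^+ k * ip 0 P (eigen_comb c 0) (eigen_comb c 0).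
Proof.
move=> lL; rewrite !ip_eigen_comb mulr_sumr; apply: ler_sum => j _.
rewrite expr0 mulr1 mulrA ler_wpM2r ?ip_ge0// mulrC ler_wpM2r ?sqr_ge0//.
by rewrite lerXn2r ?nnegrE ?sqr_ge0// lerXn2r ?nnegrE// (le_trans (lam0 j)).
Qed.

Lemma ip_eigen_comb_gt0 M (c : 'I_M -> R) j : c j != 0 ->
  0 < ip 0 P (eigen_comb c 0) (eigen_comb c 0).
Proof.
move=> cj; rewrite ip_eigen_comb (bigD1 j)//= ltr_pwDl//.
  by rewrite expr0 mulr1 mulr_gt0 ?eigen_norm_gt0// lt_neqAle sqr_ge0 eq_sym sqrf_eq0 cj.
by apply: sumr_ge0 => l _; rewrite expr0 mulr1 mulr_ge0 ?sqr_ge0 ?ip_ge0.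
Qed.

(* If the family were dependent, some combination of M eigenfunctions would be
   orthogonal to it, contradicting the approximation bound. *)
Lemma approx_independent sig r M (f : 'I_M -> R -> R) (L : R) : (0 < r)%N ->
  0 < sig -> sig * L < 1 -> 0 <= L -> (forall j : 'I_M, lam j <= L) ->
  (forall j, L2r 0 P (f j)) ->
  (forall c : 'I_M -> R, dist_le P f (eigen_comb c 0)
     ((sig ^+ 2) ^+ r * ip 0 P (eigen_comb c r) (eigen_comb c r))) ->
  forall a : 'I_M -> R, ip 0 P (comb f a) (comb f a) = 0 -> forall j, a j = 0.
Proof.
move=> r0 s0 sL L0 lL fL D a a0 j0.
have phL (l : 'I_M) : L2r 0 P (eigen_deriv 0 l) := prim_L2r (prim_eigen_deriv 0 l).
pose B : 'M[R]_M := \matrix_(l, j) ip 0 P (eigen_deriv 0 l) (f j).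
pose av : 'cV[R]_M := \col_j a j.
have Ba : B *m av = 0.
  apply/colP => l; rewrite !mxE.
  rewrite -[RHS](ip_eq0 (L2r_comb a fL) (phL l) a0) ip_comb//.
  by apply: eq_bigr => j _; rewrite !mxE mulrC.
apply/eqP; apply: contraT => aj0.
have rB : ~~ row_free B.
  apply/negP => /row_freeP[B' BB'].
  move: aj0; have : av = 0 by rewrite -[av]mul1mx -(mulmx1C BB') -mulmxA Ba mulmx0.
  by move=> /colP/(_ j0); rewrite !mxE => ->; rewrite eqxx.
have : kermx B != 0 by rewrite kermx_eq0.
case/rowV0Pn => v /sub_kermxP vB v0.
have [l vl] : exists l, v 0 l != 0.
  apply/existsP; apply: contraT; rewrite negb_exists => /forallP h.
  by move: v0; rewrite (_ : v = 0) ?eqxx//; apply/rowP => l; rewrite mxE; apply/eqP; have := h l; rewrite negbK.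
pose c l := v 0 l.
have uL := L2r_eigen_comb c 0.
have orth j : ip 0 P (eigen_comb c 0) (f j) = 0.
  rewrite ipC ip_comb//.
  transitivity ((v *m B) 0 j); last by rewrite vB mxE.
  by rewrite mxE; apply: eq_bigr => i _; rewrite mxE ipC.
have [a' le1] := D c.
have cL := L2r_comb a' fL.
rewrite ip_pythagoras// in le1; last by rewrite ip_comb// big1// => j _; rewrite orth mulr0.
have le2 := ip_eigen_comb_le c r lL.
have gt0 := ip_eigen_comb_gt0 vl.
have q1 : (sig ^+ 2) ^+ r * (L ^+ 2) ^+ r < 1.
  by rewrite -exprMn -exprMn expr_lt1 ?sqr_ge0// expr_lt1// mulr_ge0// ltW.
have := ip_ge0 0 P (comb f a').
have q0 : 0 <= (sig ^+ 2) ^+ r by rewrite exprn_ge0 ?sqr_ge0.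
have := ler_wpM2l q0 le2; rewrite mulrA.
move: (_ * _ ^+ r) q1 gt0 le1; rewrite -/(eigen_comb c 0).
move: (ip _ _ (eigen_comb c 0) _) => A q q1 A0 le1 h1 h2.
have : q * A < A by rewrite gtr_pMl.
lra.
Qed.

End Eigen.

(** * Sines and cosines as eigensystems *)

Section Trig.
Context {R : realType}.

Lemma sin_natpi k : sin (k%:R * pi) = 0 :> R.
Proof.
elim: k => [|k IH]; first by rewrite mul0r sin0.
by rewrite -natr1 mulrDl mul1r sinDpi IH oppr0.
Qed.

Lemma is_derive_sinM (l x : R) : is_derive x 1 (fun x => sin (l * x)) (l * cos (l * x)).
Proof.
have dl : is_derive x 1 (fun x : R => l * x) l.
  by apply: (is_derive_eq (is_deriveZ l (is_derive_id x 1))); rewrite /GRing.scale/= mulr1.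
apply: (is_derive_eq (is_derive1_comp (g := fun x : R => l * x) (is_derive_sin _) dl)).
by rewrite mulrC.
Qed.

Lemma is_derive_cosM (l x : R) : is_derive x 1 (fun x => cos (l * x)) (- l * sin (l * x)).
Proof.
have dl : is_derive x 1 (fun x : R => l * x) l.
  by apply: (is_derive_eq (is_deriveZ l (is_derive_id x 1))); rewrite /GRing.scale/= mulr1.
apply: (is_derive_eq (is_derive1_comp (g := fun x : R => l * x) (is_derive_cos _) dl)).
by rewrite !mulNr mulrC.
Qed.

Lemma prim_sinM P (l : R) : prim 0 P (fun x => sin (l * x)) (fun x => l * cos (l * x)).
Proof.
apply: prim_derive => [x _|]; first exact: is_derive_sinM.
apply: continuous_subspaceT => x; apply: cvgM; first exact: cvg_cst.
apply/differentiable_continuous; rewrite -derivable1_diffP.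
by have [] := is_derive_cosM l x.
Qed.

Lemma prim_cosM P (l : R) : prim 0 P (fun x => cos (l * x)) (fun x => - l * sin (l * x)).
Proof.
apply: prim_derive => [x _|]; first exact: is_derive_cosM.
apply: continuous_subspaceT => x; apply: cvgM; first exact: cvg_cst.
apply/differentiable_continuous; rewrite -derivable1_diffP.
by have [] := is_derive_sinM l x.
Qed.

Lemma eigen_system_sin : @eigen_system R pi (true, true) (fun j => j.+1%:R)
  (fun j x => sin (j.+1%:R * x)) (fun j x => cos (j.+1%:R * x)).
Proof.
split; first exact: pi_gt0.
- by move=> j k jk; rewrite ltr_nat.
- by move=> j; rewrite ler0n.
- by move=> j; split; [exact: prim_sinM|exact: prim_cosM].
- move=> j; split=> //.
  + by split=> _; rewrite ?mulr0 ?sin0 ?sin_natpi.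
  + by move=> x; rewrite addrC cos2Dsin2.
  + by move=> /eqP; rewrite pnatr_eq0.
Qed.

Lemma eigen_system_cos : @eigen_system R pi (false, false) (fun j => j%:R)
  (fun j x => cos (j%:R * x)) (fun j x => - sin (j%:R * x)).
Proof.
split; first exact: pi_gt0.
- by move=> j k jk; rewrite ltr_nat.
- by move=> j; rewrite ler0n.
- move=> j; split.
    by apply: eq_prim (prim_cosM pi j%:R) => x _; rewrite ?mulrN ?mulNr.
  by apply: eq_prim (primZ (-1) (prim_sinM pi j%:R)) => x _; rewrite ?mulN1r ?mulNr.
- move=> j; split=> //.
  + by split=> _; rewrite ?mulr0 ?sin0 ?sin_natpi oppr0.
  + by move=> x; rewrite sqrrN cos2Dsin2.
  + by move=> -> x; rewrite mul0r sin0 oppr0.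
Qed.

Lemma eigen_system_sin_odd : @eigen_system R (pi / 2) (true, false) (fun j => (2 * j + 1)%:R)
  (fun j x => sin ((2 * j + 1)%:R * x)) (fun j x => cos ((2 * j + 1)%:R * x)).
Proof.
split; first by rewrite divr_gt0 ?pi_gt0.
- by move=> j k jk; rewrite ltr_nat ltn_add2r ltn_pmul2l.
- by move=> j; rewrite ler0n.
- by move=> j; split; [exact: prim_sinM|exact: prim_cosM].
- move=> j; split=> //.
  + by split=> //= _; rewrite mulr0 sin0.
  + split=> //= _; rewrite (_ : _ * _ = j%:R * pi + pi / 2).
      by rewrite cosDpihalf sin_natpi oppr0.
    by rewrite natrD natrM; field.
  + by move=> x; rewrite addrC cos2Dsin2.
  + by move=> /eqP; rewrite pnatr_eq0 addn1.
Qed.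

End Trig.

(** * Absolutely continuous functions are primitives of their derivatives *)

Section AbsoluteContinuity.
Context {R : realType}.
Implicit Types (a b x y e : R) (f g : R -> R) (l : seq (R * bool)).

Definition acr a b f : Prop := forall e : R, 0 < e -> exists2 d : R, 0 < d &
  forall (m : nat) (s t : 'I_m -> R),
    (forall k, [/\ a <= s k, s k <= t k & t k <= b]) ->
    trivIset [set: 'I_m] (fun k => `]s k, t k[%classic) ->
    \sum_(k < m) (t k - s k) < d -> \sum_(k < m) `|f (t k) - f (s k)| < e.

(* A list (x_1, j_1), ..., (x_m, j_m) together with a starting point x_0 encodes
   a subdivision x_0 <= ... <= x_m in which the cells ]x_k, x_(k+1)] with
   j_(k+1) = true are selected. *)
Fixpoint fvar f x l : R :=
  if l is (y, j) :: l' then (if j then `|f y - f x| else 0) + fvar f y l' else 0.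

Fixpoint chain b x l : Prop :=
  if l is (y, j) :: l' then x <= y /\ chain b y l' else x <= b.

Lemma chain_le b x l : chain b x l -> x <= b.
Proof. by elim: l x => //= -[y j] l IH x [xy /IH]; exact: le_trans. Qed.

Lemma fvar_cat f x l l' : fvar f x (l ++ l') = fvar f x l + fvar f (last x (map fst l)) l'.
Proof. by elim: l x => [|[y j] l IH] x /=; rewrite ?add0r// IH addrA. Qed.

Lemma chain_fvar_ind b x l : chain b x l ->
  let m := size l in exists s t : 'I_m -> R, [/\
    forall k, [/\ x <= s k, s k <= t k & t k <= b],
    forall i j : 'I_m, (i < j)%N -> t i <= s j &
    forall f, fvar f x l = \sum_(k < m) `|f (t k) - f (s k)|].
Proof.
elim: l x => [|[y j] l IH] x /=.
  by move=> _; exists (fun=> 0), (fun=> 0); split=> [[]//|[]//|f]; rewrite big_ord0.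
move=> [xy /[dup] /chain_le yb /IH[s [t [h1 h2 h3]]]].
(* An unselected cell becomes the degenerate interval [y, y], which contributes nothing to the
   sum. *)
exists (fun k => if unlift ord0 k is Some k' then s k' else if j then x else y).
exists (fun k => if unlift ord0 k is Some k' then t k' else y); split.
- move=> k; case: unliftP => [k' _|_]; last by split => //; case: j.
  by have [ys st tb] := h1 k'; split=> //; exact: le_trans ys.
- move=> i k; case: (unliftP ord0 i) => [i' ->|->]; case: (unliftP ord0 k) => [k' ->|->]//.
    by rewrite /= /bump /= !add1n ltnS; exact: h2.
  by move=> _; have [] := h1 k'.
- move=> f; rewrite big_ord_recl unlift_none h3; congr (_ + _).
    by case: j => //; rewrite subrr normr0.
  by apply: eq_bigr => k _; rewrite liftK.
Qed.

Lemma acr_fvar a b f e : acr a b f -> 0 < e -> exists2 d : R, 0 < d &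
  forall x l, a <= x -> chain b x l -> fvar idfun x l < d -> fvar f x l < e.
Proof.
move=> ac e0; have [d d0 H] := ac e e0; exists d => // x l ax.
move=> /chain_fvar_ind[s [t [h1 h2 h3]]]; rewrite !h3 => sd.
apply: H => [k||].
- by have [xs st tb] := h1 k; split=> //; exact: le_trans xs.
- move=> i k _ _ [z [/=]]; rewrite !in_itv/= => /andP[si ti] /andP[sk tk].
  have [ik|ki|] := ltngtP i k; last exact: val_inj.
    by have := lt_trans (lt_le_trans ti (h2 i k ik)) sk; rewrite ltxx.
  by have := lt_trans (lt_le_trans tk (h2 k i ki)) si; rewrite ltxx.
- apply: le_lt_trans sd; apply: ler_sum => k _; exact: ler_norm.
Qed.

Definition flag (s : seq R) : seq (R * bool) := [seq (y, true) | y <- s].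

Lemma variation_fvar x y f s : itv_partition x y s -> variation x y f s = fvar f x (flag s).
Proof.
move=> /variation_zip ->; elim: s x => [|z s IH] x /=; first by rewrite big_nil.
by rewrite big_cons IH.
Qed.

Lemma last_flag x s : last x (map fst (flag s)) = last x s.
Proof. by rewrite -map_comp (eq_map (g := id))// map_id. Qed.

Lemma chain_flag_cat b x y s l : itv_partition x y s -> chain b y l -> chain b x (flag s ++ l).
Proof.
elim: s x => [|z s IH] x /=; first by move=> /itv_partition_nil ->.
move=> xyz cl; have := itv_partition_cons xyz.
by case: xyz => /= /andP[/ltW xz _] _ /IH h; split => //; exact: h.
Qed.

Lemma fvar_id_flag x y s : itv_partition x y s -> fvar idfun x (flag s) = y - x.
Proof.
elim: s x => [|z s IH] x /=; first by move=> /itv_partition_nil ->; rewrite subrr.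
move=> xyz; have := itv_partition_cons xyz => /IH ->.
case: xyz => /= /andP[/ltW xz _] _; rewrite ger0_norm ?subr_ge0//; ring.
Qed.

(** An interval shorter than the d attached to e = 1 has variation at most 1, and finitely many such
    intervals cover [a, b]. *)
Lemma acr_bounded_variation a b f : a < b -> acr a b f -> bounded_variation a b f.
Proof.
move=> ab ac; have [d d0 H] := acr_fvar ac ltr01.
have small x y : a <= x -> x <= y -> y <= b -> y - x < d ->
    (total_variation x y f <= 1%:E)%E.
  move=> ax xy yb xyd; apply: ub_ereal_sup => _ [_ [s ps <-] <-].
  rewrite lee_fin (variation_fvar f ps) ltW//.
  rewrite -[flag s]cats0; apply: H => //.
    by apply: chain_flag_cat ps _.
  by rewrite cats0 (fvar_id_flag ps).
have [N N0 NE] : exists2 N : nat, (0 < N)%N & (b - a) / N%:R < d.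
  exists (Num.truncn ((b - a) / d)).+1 => //.
  by rewrite ltr_pdivrMr ?ltr0n// mulrC -ltr_pdivrMr// truncnS_gt.
have NR : 0 < N%:R :> R by rewrite ltr0n.
pose p k := a + k%:R * ((b - a) / N%:R).
have st0 : 0 <= (b - a) / N%:R by rewrite divr_ge0 ?subr_ge0// ltW.
have pS k : p k.+1 - p k = (b - a) / N%:R by rewrite /p -natr1; ring.
have pk k : p k <= p k.+1 by rewrite -subr_ge0 pS.
have pa k : a <= p k by rewrite lerDl mulr_ge0.
have pN : p N = b by rewrite /p; field; exact: lt0r_neq0.
have pb k : (k <= N)%N -> p k <= b.
  by move=> kN; rewrite -pN lerD2l ler_wpM2r// ler_nat.
have TVk k : (k <= N)%N -> (total_variation a (p k) f <= k%:R%:E)%E.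
  elim: k => [_|k IH kN]; first by rewrite /p mul0r addr0 total_variationxx.
  rewrite (total_variationD f (pa k) (pk k)) -natr1 EFinD leeD//.
    by apply: IH; exact: ltnW.
  by apply: small => //; [exact: pb|rewrite pS].
apply/(bounded_variationP f (ltW ab)).
rewrite ge0_fin_numE ?total_variation_ge0 ?ltW//.
by rewrite -pN (le_lt_trans (TVk N (leqnn N)))// ltry.
Qed.

Definition tvf a f x : R := fine (total_variation a x f).

Section TotalVariation.
Variables (a b : R) (f : R -> R).
Hypotheses (ab : a < b) (ac : acr a b f).

Let bv := acr_bounded_variation ab ac.

Lemma tv_fin x y : a <= x -> x <= y -> y <= b -> total_variation x y f \is a fin_num.
Proof.
move=> ax xy yb; apply/bounded_variationP => //.
apply: (bounded_variationl xy yb); apply: (bounded_variationr ax _ bv).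
exact: le_trans yb.
Qed.

Lemma tvfB x y : a <= x -> x <= y -> y <= b ->
  tvf a f y - tvf a f x = fine (total_variation x y f).
Proof.
move=> ax xy yb; rewrite /tvf (total_variationD f ax xy) fineD ?tv_fin//.
  by rewrite addrAC subrr add0r.
exact: le_trans yb.
Qed.

Lemma tvf_ge x y : a <= x -> x <= y -> y <= b -> `|f y - f x| <= tvf a f y - tvf a f x.
Proof.
move=> ax xy yb; rewrite tvfB// -lee_fin fineK ?tv_fin//.
exact: total_variation_ge.
Qed.

(** Each selected cell is split by a partition that nearly realizes its variation, with errors e /
    2, e / 4, and so on; the total selected length does not change. *)
Lemma tvf_refine x l : a <= x -> chain b x l -> forall e, 0 < e ->
  exists l', [/\ chain b x l', fvar idfun x l' = fvar idfun x l
               & fvar (tvf a f) x l <= fvar f x l' + e].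
Proof.
elim: l x => [|[y j] l IH] x ax /=.
  by move=> xb e e0; exists [::]; split=> //=; rewrite add0r ltW.
move=> [xy cl] e e0; have yb := chain_le cl.
have e2 : 0 < e / 2 by rewrite divr_gt0.
have [l' [cl' idl' fl']] := IH y (le_trans ax xy) cl (e / 2) e2.
case: j; last first.
  by exists ((y, false) :: l'); split=> //=; rewrite ?idl' ?add0r// (le_trans fl')// lerD2l; lra.
move: xy; rewrite le_eqVlt => /predU1P[xy|xy].
  exists l'; rewrite xy !subrr normr0 !add0r; split=> //.
  by rewrite (le_trans fl')// lerD2l; lra.
have tvn := tvfB ax (ltW xy) yb.
have fin := tv_fin ax (ltW xy) yb.
have [_ [_ [s ps <-] <-] hs] : exists2 v, [set x0%:E | x0 in variations x y f] v &
    (total_variation x y f - (e / 2)%:E < v)%E.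
  by apply: ub_ereal_sup_adherent => //; rewrite -[ereal_sup _]/(total_variation x y f).
exists (flag s ++ l'); split.
- exact: chain_flag_cat ps cl'.
- rewrite fvar_cat last_flag (fvar_id_flag ps).
  by case: ps => _ /eqP ->; rewrite idl' ger0_norm// subr_ge0 ltW.
- rewrite fvar_cat last_flag -(variation_fvar f ps).
  case: (ps) => _ /eqP ->.
  rewrite ger0_norm; last by rewrite tvn fine_ge0// total_variation_ge0// ltW.
  rewrite tvn; move: hs; rewrite -[X in (X - _)%E](fineK fin) -EFinB lte_fin; lra.
Qed.

End TotalVariation.

Definition ac_chain a b f := forall e : R, 0 < e -> exists2 d : R, 0 < d &
  forall x l, a <= x -> chain b x l -> fvar idfun x l < d -> fvar f x l <= e.

Lemma acr_tvf a b f : a < b -> acr a b f -> ac_chain a b (tvf a f).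
Proof.
move=> ab ac e e0; have e2 : 0 < e / 2 by rewrite divr_gt0.
have [d d0 H] := acr_fvar ac e2; exists d => // x l ax cl lx.
have [l' [cl' idl' fl']] := tvf_refine ab ac ax cl e2.
have := H x l' ax cl'; rewrite idl' => /(_ lx); lra.
Qed.

Lemma fvarB f g x l : fvar (fun z => f z - g z) x l <= fvar f x l + fvar g x l.
Proof.
elim: l x => [|[y j] l IH] x /=; first by rewrite addr0.
have := IH y; case: j; last by rewrite !add0r.
have : `|f y - g y - (f x - g x)| <= `|f y - f x| + `|g y - g x|.
  rewrite (_ : _ - _ = (f y - f x) - (g y - g x)); last ring.
  exact: ler_normB.
lra.
Qed.

(** Together with [acr_tvf], this makes f a difference of two nondecreasing functions to which
    [ac_density] applies. *)
Lemma acr_tvfB a b f : a < b -> acr a b f -> ac_chain a b (fun x => tvf a f x - f x).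
Proof.
move=> ab ac e e0; have e2 : 0 < e / 2 by rewrite divr_gt0.
have [d d0 H] := acr_fvar ac e2; have [d' d'0 H'] := acr_tvf ab ac e2.
exists (Num.min d d'); first by rewrite lt_min d0.
move=> x l ax cl; rewrite lt_min => /andP[h h'].
have := H x l ax cl h; have := H' x l ax cl h'; have := fvarB (tvf a f) f x l.
lra.
Qed.

End AbsoluteContinuity.

(** * Densities of nondecreasing absolutely continuous functions *)

Section Density.
Context {R : realType}.
Implicit Types (a b x y : R) (f g W : R -> R) (l : seq (R * bool)) (U : set R).
Notation mu := (@lebesgue_measure R).

Fixpoint cells x l : set R :=
  if l is (y, j) :: l' then (if j then `]x, y]%classic else set0) `|` cells y l' else set0.

Lemma cells_sub b x l : chain b x l -> cells x l `<=` `]x, b]%classic.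
Proof.
elim: l x => [|[y j] l IH] x /=; first by move=> _ z.
move=> [xy cl] z [|/(IH _ cl)/=]; last first.
  by rewrite !in_itv/= => /andP[yz ->]; rewrite (le_lt_trans xy).
case: j => //=; rewrite !in_itv/= => /andP[-> zy]/=.
exact: le_trans (chain_le cl).
Qed.

Lemma measurable_cells x l : measurable (cells x l).
Proof.
elim: l x => [|[y j] l IH] x //=; apply: measurableU => //.
by case: j.
Qed.

Lemma measure_cells a b W (m : {measure set (measurableTypeR R) -> \bar R}) x l :
  (forall x y, a <= x -> x <= y -> y <= b -> W x <= W y /\ m `]x, y]%classic = (W y - W x)%:E) ->
  a <= x -> chain b x l -> m (cells x l) = (fvar W x l)%:E.
Proof.
move=> mW; elim: l x => [|[y j] l IH] x ax /=; first by rewrite measure0.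
move=> [xy cl]; have yb := chain_le cl; have ay := le_trans ax xy.
rewrite measureU/=; [|by case: j|exact: measurable_cells|].
- rewrite (IH _ ay cl) EFinD; congr (_ + _)%E.
  have [Wxy mxy] := mW x y ax xy yb.
  by case: j; [rewrite mxy ger0_norm// subr_ge0|rewrite measure0].
- apply/seteqP; split => // z [+ /(cells_sub cl)/=]; case: j => //=.
  rewrite !in_itv/= => /andP[_ zy] /andP[yz _].
  by move: (lt_le_trans yz zy); rewrite ltxx.
Qed.

Fixpoint grid U x (st : R) (n : nat) : seq (R * bool) :=
  if n is n'.+1 then (x + st, `[< `]x, (x + st)]%classic `<=` U >]) :: grid U (x + st) st n'
  else [::].

Lemma chain_grid U x st n : 0 <= st -> chain (x + n%:R * st) x (grid U x st n).
Proof.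
move=> st0; elim: n x => [|n IH] x /=; first by rewrite mul0r addr0.
split; first by rewrite lerDl.
rewrite (_ : x + _ = x + st + n%:R * st); first exact: IH.
by rewrite -natr1; ring.
Qed.

Lemma cells_grid_sub U x st n : cells x (grid U x st n) `<=` U.
Proof.
elim: n x => [|n IH] x //= z [|/IH//].
by case: asboolP => // + zx; apply.
Qed.

Lemma cells_grid_mem U x st n z : 0 <= st -> x < z -> z <= x + n%:R * st ->
  (forall t, `|t - z| <= st -> U t) -> cells x (grid U x st n) z.
Proof.
move=> st0; elim: n x => [|n IH] x xz zn Uz /=.
  by move: (lt_le_trans xz zn); rewrite mul0r addr0 ltxx.
have [zs|sz] := leP z (x + st).
  left; case: asboolP => [_/=|]; first by rewrite in_itv/= xz.
  move=> []; move=> t /=; rewrite in_itv/= => /andP[xt ts]; apply: Uz.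
  by rewrite ler_norml; apply/andP; split; lra.
right; apply: IH => //; apply: le_trans zn _.
by rewrite -natr1; lra.
Qed.

(* Cover A by an open set U of small Lebesgue measure; the cells of the uniform
   n-th subdivision that are included in U eventually contain each point of U,
   and m is small on their union by absolute continuity. *)
Lemma ac_null a b W (m : {measure set (measurableTypeR R) -> \bar R}) : a < b ->
  (forall x y, a <= x -> x <= y -> y <= b -> W x <= W y /\ m `]x, y]%classic = (W y - W x)%:E) ->
  ac_chain a b W ->
  forall A : set (measurableTypeR R), measurable A -> mu A = 0%E ->
    m (A `&` `]a, b]%classic) = 0%E.
Proof.
move=> ab mW ac A mA A0; apply/eqP; rewrite eq_le measure_ge0 andbT.
apply/lee_addgt0Pr => e e0; rewrite add0e.
have [d d0 H] := ac e e0.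
have [U [oU AU UA]] := @lebesgue_regularity_outer R A d mA ltac:(rewrite [X in (X < _)%E]A0; exact: ltry) d0.
have mU : measurable U by exact: open_measurable.
have Ud : (mu U < d%:E)%E.
  rewrite (_ : mu U = mu (U `\` A))//.
  rewrite -[in LHS](setDKU AU) measureU//; first by rewrite [X in (_ + X)%E]A0 adde0.
  - exact: measurableD.
  - by rewrite setIC setDIK.
pose st n := (b - a) / n.+1%:R : R.
have st0 n : 0 <= st n by rewrite divr_ge0// subr_ge0 ltW.
have bE n : a + n.+1%:R * st n = b.
  by rewrite /st mulrC divfK ?pnatr_eq0// addrCA subrr addr0.
pose C n := cells a (grid U a (st n) n.+1).
have ch n : chain b a (grid U a (st n) n.+1).
  by rewrite -[X in chain X](bE n); exact: chain_grid.
have mC n : measurable (C n) by exact: measurable_cells.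
have Ce n : (m (C n) <= e%:E)%E.
  rewrite (measure_cells mW)// lee_fin; apply: H => //.
  rewrite -lte_fin -(@measure_cells a b idfun mu)//; last first.
    move=> x y _ xy _; split => //; have := @lebesgue_measure_itv R `]x, y]; rewrite /= lte_fin => ->.
    have [//|//|->] := ltgtP x y; last by rewrite subrr.
    by move=> yx; move: (lt_le_trans yx xy); rewrite ltxx.
  apply: le_lt_trans Ud; apply: le_measure; rewrite ?inE//.
    exact: measurable_cells.
  exact: cells_grid_sub.
pose D K := \bigcap_(n in [set n | (K <= n)%N]) C n.
have mD K : measurable (D K).
  by apply: bigcap_measurable => //; exists K => /=.
have De K : (m (D K) <= e%:E)%E.
  apply: le_trans (Ce K); apply: le_measure; rewrite ?inE; [exact: mD|exact: mC|].
  by move=> z Dz; exact: (Dz K (leqnn K)).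
have sub : U `&` `]a, b]%classic `<=` \bigcup_K D K.
  move=> z [Uz /=]; rewrite in_itv/= => /andP[az zb].
  have [r /= r0 rU] := open_subball oU Uz.
  pose K := Num.truncn (2 * (b - a) / r); exists K => // n /= Kn.
  apply: cells_grid_mem => //; first by rewrite bE.
  move=> t tz; apply: (rU (r / 2)) => /=.
  - by rewrite sub0r normrN gtr0_norm ?divr_gt0//; lra.
  - by rewrite divr_gt0.
  rewrite -ball_normE /= distrC; apply: le_lt_trans tz _.
  rewrite /st ltr_pdivrMr ?ltr0n// -ltr_pdivrMl ?divr_gt0//.
  have -> : (r / 2)^-1 * (b - a) = 2 * (b - a) / r by field; exact: lt0r_neq0.
  by rewrite (lt_le_trans (truncnS_gt _))// ler_nat ltnS.
have cv : m (D K) @[K --> \oo] --> m (\bigcup_K D K).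
  apply: nondecreasing_cvg_mu => //; first exact: bigcupT_measurable.
  move=> k k' kk'; apply/subsetPset => z Dz n /= k'n; apply: Dz => /=.
  exact: leq_trans k'n.
apply: (@le_trans _ _ (m (\bigcup_K D K))).
  apply: le_measure; rewrite ?inE//; first exact: measurableI.
    exact: bigcupT_measurable.
  by apply: subset_trans sub; exact: setSI.
rewrite -(cvg_lim _ cv)//; apply: lime_le; first by apply/cvg_ex; eexists; exact: cv.
by apply: nearW.
Qed.

(** The Lebesgue-Stieltjes measure of W, restricted to ]a, b], is dominated by Lebesgue measure by
    [ac_null]; its Radon-Nikodym derivative is the density. *)
Lemma ac_density a b W : a < b ->
  (forall x y, a <= x -> x <= y -> y <= b -> W x <= W y) -> ac_chain a b W ->
  exists2 g, intble a b g & forall x, a <= x <= b -> W x = W a + Int a x g.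
Proof.
move=> ab ndW ac.
(* Clamping the argument to [a, b] extends W to the line as a cumulative function, constant on
   either side of the segment. *)
pose cl x := Num.max a (Num.min x b).
have clP x : [\/ x <= a /\ cl x = a, a <= x <= b /\ cl x = x | b <= x /\ cl x = b].
  rewrite /cl; have [xb|/ltW bx] := leP x b; last first.
    by apply: Or33; split=> //; apply/max_idPr/ltW.
  have [ax|/ltW xa] := leP a x; last by apply: Or31.
  by apply: Or32; rewrite ?ax ?xb.
have cl_in x : a <= cl x <= b.
  by have [[_ ->]|[h ->]|[_ ->]] := clP x; rewrite ?lexx ?(ltW ab).
have cl_lip x y : x <= y -> 0 <= cl y - cl x <= y - x.
  by case: (clP x) => -[hx ->]; case: (clP y) => -[hy ->] xy; lra.
have cl_nd x y : x <= y -> cl x <= cl y.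
  by move=> /cl_lip/andP[+ _]; rewrite subr_ge0.
have clE x : a <= x <= b -> cl x = x.
  by move=> /andP[ax xb]; rewrite /cl (min_idPl xb) (max_idPr ax).
have nd : nondecreasing_fun (W \o cl).
  move=> x y xy; apply: ndW; [by case/andP: (cl_in x)|exact: cl_nd|by case/andP: (cl_in y)].
have rc : right_continuous (W \o cl).
  move=> x; apply/cvgrPdist_le => e e0; have [d d0 H] := ac e e0.
  near=> y.
  have xy : x <= y by near: y; exact: nbhs_right_ge.
  have [clxy clyx] := andP (cl_lip _ _ xy).
  have := H (cl x) [:: (cl y, true)] ltac:(by case/andP: (cl_in x)).
  rewrite /= !addr0 => h; rewrite /= distrC; apply: h; first by split; [exact: cl_nd|case/andP: (cl_in y)].
  rewrite ger0_norm//; apply: le_lt_trans clyx _.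
  by rewrite ltrBlDr addrC; near: y; apply: nbhs_right_lt; rewrite ltrDl.
pose Wc : cumulative R R := HB.pack (W \o cl) (isCumulative.Build R _ R (W \o cl) nd rc).
pose m := lebesgue_stieltjes_measure Wc.
have mE x y : x <= y -> m `]x, y]%classic = (W (cl y) - W (cl x))%:E.
  move=> xy; rewrite /m /lebesgue_stieltjes_measure /measure_extension.
  rewrite measurable_mu_extE/=; last exact: is_ocitv.
  by rewrite wlength_itv_bnd// EFinB.
have mW x y : a <= x -> x <= y -> y <= b -> W x <= W y /\ m `]x, y]%classic = (W y - W x)%:E.
  move=> ax xy yb; split; first exact: ndW.
  by rewrite mE// !clE// ?ax ?yb ?(le_trans ax)// (le_trans xy).
have mab : (m `]a, b]%classic < +oo)%E by rewrite mE ?ltry// ltW.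
pose nu : {finite_measure set (measurableTypeR R) -> \bar R} :=
  @mfrestr _ (measurableTypeR R) R `]a, b]%classic m (measurable_itv `]a, b]) mab.
have dom : nu `<< mu.
  apply/null_content_dominatesP => A mA A0.
  exact: (ac_null ab mW ac mA A0).
have [G [G0 Gfin Gi Gnu]] := @radon_nikodym_sigma_finite _ _ _ mu nu dom.
exists (fine \o G).
  apply: (@integrableS _ _ _ mu setT) => //.
  apply: eq_integrable Gi => // x _ /=; rewrite fineK//.
move=> x /andP[ax xb]; apply/eqP; rewrite addrC -subr_eq; apply/eqP.
have := Gnu `]a, x]%classic (measurable_itv _).
have -> : nu `]a, x]%classic = (W x - W a)%:E.
  rewrite /nu /= /mfrestr /mrestr setIidl; first exact: (mW a x (lexx a) ax xb).2.
  by move=> z /=; rewrite !in_itv/= => /andP[->] /le_trans; exact.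
rewrite /Int -Rintegral_itv_obnd_cbnd; last first.
  apply: (@integrableS _ _ _ mu setT) => //.
  by apply: eq_integrable Gi => // z _ /=; rewrite fineK.
rewrite /Rintegral => e; rewrite -[LHS]/(fine (W x - W a)%:E) e.
by congr fine; apply: eq_integral => z _ /=; rewrite fineK.
Unshelve. all: by end_near. Qed.

End Density.

(** * One-sided difference quotients and primitives *)

Section WithinDerivatives.
Context {R : realType}.
Implicit Types (a b x y l : R) (f g w : R -> R) (u : R -> R[i]^o).
Notation mu := (@lebesgue_measure R).

Definition has_wderiv a b f x l :=
  (f y - f x) / (y - x) @[y --> within `[a, b] x^'] --> l.

Lemma has_wderivP a b f x l : has_wderiv a b f x l <->
  forall e, 0 < e -> exists2 d, 0 < d &
    forall y, a <= y <= b -> y != x -> `|y - x| < d ->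
      `|l - (f y - f x) / (y - x)| <= e.
Proof.
split.
  move=> /cvgrPdist_le H e e0; have := H e e0.
  rewrite /within /= /dnbhs /within/= => /nbhs_ballP[d d0 D].
  exists d => // y yab yx yd; apply: D; [|exact: yx|by rewrite /= in_itv].
  by rewrite -ball_normE/= distrC.
move=> H; apply/cvgrPdist_le => e e0; have [d d0 D] := H e e0.
rewrite /within /= /dnbhs /within/=; apply/nbhs_ballP; exists d => //= y.
by rewrite -ball_normE/= distrC => yd yx; rewrite in_itv/= => yab; exact: D.
Qed.

Lemma has_wderiv_sub a b f x l : a < b -> has_wderiv a b f x l ->
  forall e, 0 < e -> exists2 d, 0 < d &
  forall y, a <= y <= b -> `|y - x| < d -> `|f y - f x| <= e.
Proof.
move=> ab /has_wderivP/(_ 1 ltr01)[d d0 D] e e0.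
have M0 : 0 < `|l| + 1 by rewrite ltr_wpDl.
exists (Num.min d (e / (`|l| + 1))); first by rewrite lt_min d0 divr_gt0.
move=> y yab; rewrite lt_min => /andP[yd ye].
have [->|yx] := eqVneq y x; first by rewrite subrr normr0 ltW.
have yx0 : y - x != 0 by rewrite subr_eq0.
have := D y yab yx yd; move: ye; rewrite ltr_pdivlMr// => ye h.
rewrite -[f y - f x](divfK yx0) normrM.
have : `|(f y - f x) / (y - x)| <= `|l| + 1.
  move: h; move: (_ / _) => q h; rewrite (_ : q = l - (l - q)); last ring.
  by rewrite (le_trans (ler_normB _ _))// lerD2l.
move=> /(ler_wpM2r (normr_ge0 (y - x))) h2; apply: (le_trans h2).
by rewrite mulrC ltW.
Qed.

Lemma has_wderiv_cont a b f g : a < b ->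
  (forall x, a <= x <= b -> has_wderiv a b f x (g x)) -> {within `[a, b], continuous f}.
Proof.
move=> ab H; apply/subspace_continuousP => x /=; rewrite in_itv/= => xab.
apply/cvgrPdist_le => e e0; have [d d0 D] := has_wderiv_sub ab (H x xab) e0.
rewrite /within/=; apply/nbhs_ballP; exists d => //= y.
by rewrite -ball_normE/= distrC => yd; rewrite in_itv/= distrC => yab; exact: D.
Qed.

Lemma has_wderiv_interior a b f x l : a < x -> x < b -> has_wderiv a b f x l ->
  is_derive x 1 f l.
Proof.
move=> ax xb /has_wderivP H.
have cv : h^-1 *: ((f \o shift x) (h *: (1 : R)) - f x) @[h --> 0^'] --> l.
  apply/cvgrPdist_le => e e0; have [d d0 D] := H e e0.
  rewrite /dnbhs /within/=; apply/nbhs_ballP.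
  exists (Num.min d (Num.min (x - a) (b - x))).
    by rewrite /= !lt_min d0 !subr_gt0 ax xb.
  move=> h; rewrite -ball_normE/= sub0r normrN !lt_min => /and3P[hd ha hb] h0.
  rewrite /= /shift/= /GRing.scale/= mulr1 mulrC.
  have := D (h + x); rewrite addrK; apply => //.
    by move: ha hb; rewrite !ltr_norml => /andP[h1 h2] /andP[h3 h4]; apply/andP; split; lra.
  by rewrite -subr_eq0 addrK.
by apply: DeriveDef; [apply/cvg_ex; exists l|apply/cvg_lim].
Qed.

Lemma has_wderiv_prim a b f g : a < b ->
  (forall x, a <= x <= b -> has_wderiv a b f x (g x)) -> {within `[a, b], continuous g} ->
  prim a b f g.
Proof.
move=> ab H cg; split; first exact: L2r_cont.
move=> x /andP[]; rewrite le_eqVlt => /predU1P[<- _|ax xb].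
  by rewrite Intxx addr0.
have cf := has_wderiv_cont ab H.
have cgx : {within `[a, x], continuous g}.
  apply: continuous_subspaceW cg => t/=; rewrite !in_itv/= => /andP[-> tx].
  exact: le_trans xb.
have cfx : {within `[a, x], continuous f}.
  apply: continuous_subspaceW cf => t/=; rewrite !in_itv/= => /andP[-> tx].
  exact: le_trans xb.
have [h1 h2 h3] := (continuous_within_itvP _ ax).1 cfx.
have D t : a < t -> t < x -> is_derive t 1 f (g t).
  move=> at_ tx; have tb := lt_le_trans tx xb.
  have tab : a <= t <= b by rewrite !ltW.
  exact: (has_wderiv_interior at_ tb (H t tab)).
rewrite /Int /Rintegral (continuous_FTC2 (F := f) ax cgx).
- by rewrite /= addrCA subrr addr0.
- by split=> // t; rewrite in_itv/= => /andP[at_ tx]; have [] := D t at_ tx.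
- move=> t; rewrite in_itv/= => /andP[at_ tx].
  by rewrite derive1E; have [_ ->] := D t at_ tx.
Qed.

(** g x (y - x) - (w y - w x) is the integral of g x - g between x and y, which is small by
    continuity of [g]; with y confined to [a, b], the endpoints are covered by the same estimate. *)
Lemma prim_has_wderiv a b w g : prim a b w g -> {within `[a, b], continuous g} ->
  forall x, a <= x <= b -> has_wderiv a b w x (g x).
Proof.
move=> pw /subspace_continuousP cg x xab; apply/has_wderivP => e e0.
have := cg x ltac:(by rewrite /= in_itv).
move=> /cvgrPdist_le/(_ e e0); rewrite /within/= => /nbhs_ballP[d d0 D].
exists d => // y yab yx yd.
have yx0 : 0 < `|y - x| by rewrite normr_gt0 subr_eq0.
have key s t : a <= s -> s <= t -> t <= b ->
    (forall z, s <= z <= t -> `|g x - g z| <= e) -> `|g x * (t - s) - (w t - w s)| <= e * (t - s).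
  move=> as_ st tb gz; rewrite (primE pw as_ st tb).
  have gi : intble s t g by apply: intble_sub (L2r_intble pw.1).
  rewrite -(Int_cst (g x) st) -IntB//; last exact: intble_cst.
  have ci : intble s t (fun z => g x - g z) by apply: intbleB => //; exact: intble_cst.
  apply: (le_trans (le_norm_Int ci)); rewrite -(Int_cst e st); apply: le_Int => //.
  - exact: intble_norm.
  - exact: intble_cst.
have Dz z : a <= z <= b -> `|z - x| < d -> `|g x - g z| <= e.
  by move=> zab zd; apply: D => //=; rewrite ?in_itv// -ball_normE/= distrC.
case/andP: xab => ax xb; case/andP: yab => ay yb.
have -> : g x - (w y - w x) / (y - x) = (g x * (y - x) - (w y - w x)) / (y - x).
  by field; rewrite subr_eq0.
rewrite normrM normfV ler_pdivrMr//.
have [xy|yx'] := leP x y.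
  rewrite (ger0_norm (x := y - x)) ?subr_ge0//; apply: key => // z /andP[xz zy].
  apply: Dz; first by rewrite (le_trans ax)//= (le_trans zy).
  apply: le_lt_trans yd; rewrite !ger0_norm ?subr_ge0//; first exact: lerB.
have {}yx' := ltW yx'.
rewrite (ler0_norm (x := y - x)) ?subr_le0// (opprB y x).
have -> : `|g x * (y - x) - (w y - w x)| = `|g x * (x - y) - (w x - w y)|.
  by rewrite -normrN; congr (`|_|); ring.
apply: key => // z /andP[yz zx].
apply: Dz; first by rewrite (le_trans ay)//= (le_trans zx).
by apply: le_lt_trans yd; rewrite !ler0_norm ?subr_le0// !opprB lerB.
Qed.

(** The total variation of f and the total variation minus f both have densities, and g is the
    difference of these. The last claim is Lebesgue differentiation. *)
Lemma acr_prim a b f : a < b -> acr a b f -> exists g, [/\ intble a b g,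
  forall x, a <= x <= b -> f x = f a + Int a x g &
  {ae mu, forall x, a < x < b -> has_wderiv a b f x (g x)}].
Proof.
move=> ab ac.
have [g1 g1i g1E] : exists2 g, intble a b g &
    forall x, a <= x <= b -> tvf a f x = tvf a f a + Int a x g.
  apply: ac_density => //; last exact: acr_tvf.
  move=> x y ax xy yb; rewrite -subr_ge0; apply: le_trans (tvf_ge ab ac ax xy yb).
  exact: normr_ge0.
have [g2 g2i g2E] : exists2 g, intble a b g &
    forall x, a <= x <= b -> tvf a f x - f x = tvf a f a - f a + Int a x g.
  apply: (ac_density (W := fun x => tvf a f x - f x)) => //; last exact: acr_tvfB.
  move=> x y ax xy yb; have := tvf_ge ab ac ax xy yb.
  by have := ler_norm (f y - f x); lra.
pose g x := g1 x - g2 x.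
have gi : intble a b g by exact: intbleB.
have fE x : a <= x <= b -> f x = f a + Int a x g.
  move=> xab; have := g1E x xab; have := g2E x xab.
  case/andP: xab => ax xb; rewrite /g IntB; last 2 first.
  - exact: intble_sub g1i.
  - exact: intble_sub g2i.
  lra.
exists g; split => //.
(* Extension by 0 gives a function integrable on the whole line, to which Lebesgue differentiation
   applies. *)
pose gt := g \_ `[a, b].
have gti : mu.-integrable setT (EFin \o gt).
  rewrite /gt -restrict_EFin; apply/(integrable_restrict _ _ _ _).1 => //.
  by rewrite setTI.
have loc : locally_integrable setT gt by exact: integrable_locally.
have gty y : mu.-integrable [set` Interval (BLeft a) (BRight y)] (EFin \o gt).
  by apply: (integrableS _ _ _ gti).
have := FTC1 gty loc.
apply: filterS; first exact: (ae_filter_ringOfSetsType mu).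
move=> x H /andP[ax xb].
have ax' : (a%:E < x%:E)%E by rewrite lte_fin.
have [] := H ax'.
set F := fun y => _; move=> dF F'.
have FE y : a <= y <= b -> F y = f y - f a.
  move=> yab; rewrite (fE y yab) addrC addKr.
  apply: eq_Int => t /andP[at_ ty]; rewrite /gt patchE mem_set//= in_itv/= at_.
  by case/andP: yab => _; exact: le_trans.
have gtx : gt x = g x by rewrite /gt patchE mem_set//= in_itv/= !ltW.
have Fd : h^-1 *: ((F \o shift x) (h *: (1 : R)) - F x) @[h --> 0^'] --> g x.
  by move: F'; rewrite gtx derive1E => <-; exact: dF.
apply/has_wderivP => e e0; move/cvgrPdist_le: Fd => /(_ e e0).
rewrite /dnbhs /within/= => /nbhs_ballP[d d0 D]; exists d => // y yab yx yd.
have := D (y - x); rewrite /= -ball_normE/= sub0r normrN => /(_ yd).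
rewrite subr_eq0 => /(_ yx); rewrite /shift/= /GRing.scale/= mulr1 subrK.
rewrite !FE//; last by rewrite !ltW.
by rewrite opprB addrA subrK mulrC.
Qed.

Lemma normc_le_ReIm (z : R[i]) : Normc.normc z <= `|complex.Re z| + `|complex.Im z|.
Proof.
case: z => p q /=; rewrite -[leRHS]ger0_norm ?addr_ge0// -sqrtr_sqr ler_wsqrtr//.
rewrite -[p ^+ 2]real_normK ?num_real// -[q ^+ 2]real_normK ?num_real//.
have := normr_ge0 p; have := normr_ge0 q; nra.
Qed.

Lemma Re_le_normc (z : R[i]) : `|complex.Re z| <= Normc.normc z.
Proof. by case: z => p q /=; rewrite -sqrtr_sqr ler_wsqrtr// lerDl sqr_ge0. Qed.

Lemma Im_le_normc (z : R[i]) : `|complex.Im z| <= Normc.normc z.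
Proof. by case: z => p q /=; rewrite -sqrtr_sqr ler_wsqrtr// lerDr sqr_ge0. Qed.

Lemma cvg_complexP (T : Type) (F : set_system T) (FF : Filter F) (f : T -> R[i]^o) (l : R[i]) :
  f @ F --> (l : R[i]^o) <->
  ((fun t => complex.Re (f t)) @ F --> complex.Re l /\
   (fun t => complex.Im (f t)) @ F --> complex.Im l).
Proof.
split.
  move=> /cvgrPdist_le H; split; apply/cvgrPdist_le => e e0;
  have := H e%:C; rewrite ltcR => /(_ e0); apply: filterS => t;
  rewrite /Num.norm/= lecR => h; apply: le_trans h.
    by have := Re_le_normc (l - f t); case: (l) => ? ?; case: (f t).
  by have := Im_le_normc (l - f t); case: (l) => ? ?; case: (f t).
move=> [/cvgrPdist_le H1 /cvgrPdist_le H2]; apply/cvgrPdist_le => e e0.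
have [e' ee e'0] : exists2 e' : R, e = e'%:C & 0 < e'.
  by move: e0; case: e => p q; rewrite ltcE/= => /andP[/eqP -> p0]; exists p.
have e2 : 0 < e' / 2 by rewrite divr_gt0.
apply: filterS2 (H1 _ e2) (H2 _ e2) => t h1 h2.
rewrite ee /Num.norm/= lecR; apply: (le_trans (normc_le_ReIm _)).
move: h1 h2; case: (l) => p q; case: (f t) => p' q' /=; lra.
Qed.

Definition Rf u x : R := complex.Re (u x).
Definition If u x : R := complex.Im (u x).

Lemma diff_quotE u x y : diff_quot u x y =
  ((Rf u y - Rf u x) / (y - x)) +i* ((If u y - If u x) / (y - x)).
Proof.
rewrite /diff_quot /Rf /If; case: (u y) => p q; case: (u x) => p' q'.
rewrite -[(y - x)%:C^-1]/(_ +i* _) expr0n/= addr0.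
apply/eqP; rewrite eq_complex /=; apply/andP; split; apply/eqP.
(* At y = x both sides are 0, because the inverse of 0 is 0. *)
all: have [->|h] := eqVneq (y - x) 0; first by rewrite ?expr0n/= ?invr0 ?mul0r ?mulr0 ?oppr0 ?mulr0 ?addr0 ?subr0.
all: by rewrite ?oppr0; field.
Qed.

Lemma diff_quot_cvgP a b u x (l : R[i]) :
  diff_quot u x y @[y --> within `[a, b] x^'] --> (l : R[i]^o) <->
  has_wderiv a b (Rf u) x (complex.Re l) /\ has_wderiv a b (If u) x (complex.Im l).
Proof.
have -> : has_wderiv a b (Rf u) x (complex.Re l) =
    (complex.Re (diff_quot u x y) @[y --> within `[a, b] x^'] --> complex.Re l).
  by rewrite /has_wderiv; under [in RHS]eq_fun do rewrite diff_quotE.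
have -> : has_wderiv a b (If u) x (complex.Im l) =
    (complex.Im (diff_quot u x y) @[y --> within `[a, b] x^'] --> complex.Im l).
  by rewrite /has_wderiv; under [in RHS]eq_fun do rewrite diff_quotE.
exact: cvg_complexP.
Qed.

Lemma within_proper a b x : a < b -> a <= x <= b -> ProperFilter (within `[a, b] x^').
Proof.
move=> ab /andP[ax xb]; apply: Build_ProperFilter_ex => A.
rewrite /within/= /dnbhs /within/= => /nbhs_ballP[d d0 D].
have [xb'|bx] := ltP x b.
  pose y := x + Num.min (d / 2) (b - x).
  have m0 : 0 < Num.min (d / 2) (b - x) by rewrite lt_min divr_gt0// subr_gt0.
  exists y; apply: D => /=.
  - rewrite -ball_normE/= /y opprD addNKr normrN gtr0_norm//.
    by rewrite gt_min ltr_pdivrMr// ltr_pMr// ltr1n.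
  - by rewrite /y -subr_eq0 addrC addKr gt_eqF.
  - rewrite in_itv/= /y; apply/andP; split; first by rewrite (le_trans ax)// lerDl ltW.
    by rewrite -lerBrDl ge_min lexx orbT.
have xE : x = b by apply/eqP; rewrite eq_le xb.
pose y := x - Num.min (d / 2) (x - a).
have m0 : 0 < Num.min (d / 2) (x - a) by rewrite lt_min divr_gt0// subr_gt0 xE.
exists y; apply: D => /=.
- rewrite -ball_normE/= /y opprB addrCA subrr addr0 gtr0_norm//.
  by rewrite gt_min ltr_pdivrMr// ltr_pMr// ltr1n.
- by rewrite /y -subr_eq0 addrC addKr oppr_eq0 gt_eqF.
- rewrite in_itv/= /y; apply/andP; split; last by rewrite (le_trans _ xb)// gerBl ltW.
  by rewrite lerBrDl -lerBrDr ge_min lexx orbT.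
Qed.

Lemma derive_withinE a b u x (l : R[i]) : a < b -> a <= x <= b ->
  has_wderiv a b (Rf u) x (complex.Re l) -> has_wderiv a b (If u) x (complex.Im l) ->
  derivable_within a b u x /\ derive_within a b u x = l.
Proof.
move=> ab xab h1 h2.
have cv : diff_quot u x y @[y --> within `[a, b] x^'] --> (l : R[i]^o) by apply/diff_quot_cvgP.
split; first by apply/cvg_ex; exists l.
have := within_proper ab xab => ?.
by apply: cvg_lim => //; exact: norm_hausdorff.
Qed.

Lemma derivable_withinP a b u x : derivable_within a b u x ->
  has_wderiv a b (Rf u) x (Rf (derive_within a b u) x) /\
  has_wderiv a b (If u) x (If (derive_within a b u) x).
Proof. by move=> du; apply/diff_quot_cvgP. Qed.

Lemma eq_derive_within a b u v : {in `[a, b], u =1 v} ->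
  {in `[a, b], derive_within a b u =1 derive_within a b v} /\
  forall x, a <= x <= b -> derivable_within a b u x -> derivable_within a b v x.
Proof.
move=> uv.
have E x : a <= x <= b ->
    diff_quot u x y @[y --> within `[a, b] x^'] = diff_quot v x y @[y --> within `[a, b] x^'].
  move=> xab; rewrite eqEsubset; split => A H;
  apply: (@filterS _ (x^') _ _ _ _ H) => y /= + yab => /(_ yab);
  by rewrite /diff_quot !uv// in_itv.
split=> [x|x xab]; last by rewrite /derivable_within (E x xab).
by rewrite in_itv/= => xab; rewrite /derive_within (E x xab).
Qed.

End WithinDerivatives.

(** * Complex-valued functions and widths *)

Section Complexification.
Context {R : realType}.
Variables (P : R) (P0 : 0 < P).
Implicit Types (f g p q w : R -> R) (u v : R -> R[i]^o).
Notation mu := (@lebesgue_measure R).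

Lemma normc_sqr (z : R[i]) : Normc.normc z ^+ 2 = complex.Re z ^+ 2 + complex.Im z ^+ 2.
Proof. by case: z => x y /=; rewrite sqr_sqrtr ?addr_ge0 ?sqr_ge0. Qed.

Lemma L2P u : L2 0 P u <-> L2r 0 P (Rf u) /\ L2r 0 P (If u).
Proof.
split=> [[mR mI ui]|[[mR Ri] [mI Ii]]].
  split; split=> //; apply: (le_integrable _ _ _ ui) => //.
  - by apply/measurable_EFinP; exact: measurable_funX.
  - move=> x _ /=; rewrite lee_fin !ger0_norm ?sqr_ge0// normc_sqr.
    by rewrite lerDl sqr_ge0.
  - by apply/measurable_EFinP; exact: measurable_funX.
  - move=> x _ /=; rewrite lee_fin !ger0_norm ?sqr_ge0// normc_sqr.
    by rewrite lerDr sqr_ge0.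
split=> //; apply: eq_intble (intbleD Ri Ii) => x _.
by rewrite normc_sqr.
Qed.

Lemma L2norm_ge0 u : 0 <= L2norm 0 P u.
Proof. exact: sqrtr_ge0. Qed.

Lemma L2norm_sqr u : L2 0 P u ->
  L2norm 0 P u ^+ 2 = ip 0 P (Rf u) (Rf u) + ip 0 P (If u) (If u).
Proof.
move=> /L2P[uR uI]; rewrite /L2norm sqr_sqrtr; last first.
  by apply: Rintegral_ge0 => x _; rewrite sqr_ge0.
rewrite /ip -IntD; [|exact: L2r_mul..].
by apply: eq_Int => x _; rewrite normc_sqr !expr2.
Qed.

Lemma ae_neq (c : R) : {ae mu, forall x : R, x != c}.
Proof.
exists [set c]; split=> //; first exact: lebesgue_measure_set1.
by move=> x /= /negP; rewrite negbK => /eqP.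
Qed.

Lemma acr_Rf u : absolutely_continuous 0 P u -> acr 0 P (Rf u).
Proof.
move=> ac e e0; have [d d0 H] := ac e e0; exists d => // m s t h1 h2 h3.
apply: le_lt_trans (H m s t h1 h2 h3); apply: ler_sum => k _.
apply: le_trans (Re_le_normc _); rewrite /Rf.
by case: (u (t k)) => ? ?; case: (u (s k)).
Qed.

Lemma acr_If u : absolutely_continuous 0 P u -> acr 0 P (If u).
Proof.
move=> ac e e0; have [d d0 H] := ac e e0; exists d => // m s t h1 h2 h3.
apply: le_lt_trans (H m s t h1 h2 h3); apply: ler_sum => k _.
apply: le_trans (Im_le_normc _); rewrite /If.
by case: (u (t k)) => ? ?; case: (u (s k)).
Qed.

(** This lets the default values of [derive_within] on a null set be ignored; the endpoints are
    discarded as null sets too. *)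
Lemma prim_ae w g h : (forall x, 0 <= x <= P -> w x = w 0 + Int 0 x g) ->
  intble 0 P g -> L2r 0 P h -> {ae mu, forall x, 0 < x < P -> h x = g x} -> prim 0 P w h.
Proof.
move=> wE gi hL gh; split=> // x xP; rewrite wE//; congr (_ + _).
have gi' : intble 0 x g by case/andP: xP => _ xP; apply: intble_sub gi.
have hi' : intble 0 x h by case/andP: xP => _ xP; apply: intble_sub (L2r_intble hL).
rewrite /Int /Rintegral; congr fine; apply: ae_eq_integral => //.
- exact: (measurable_int mu gi').
- exact: (measurable_int mu hi').
apply: (@filterS3 _ _ (ae_filter_ringOfSetsType mu) _ _ _ _ _ gh (ae_neq 0) (ae_neq P)).
move=> t ht t0 tP /=; rewrite in_itv/= => /andP[t0' tx]; congr EFin; apply/esym/ht.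
rewrite !lt_neqAle eq_sym t0 t0' tP (le_trans tx)//.
by case/andP: xP.
Qed.

(** At almost every interior point both parts of the difference quotient converge to densities, so
    [derive_within] agrees there with a pair of integrable functions; the square integrability
    required by [prim] comes from the hypothesis. *)
Lemma absolutely_continuous_prim v : absolutely_continuous 0 P v ->
  L2 0 P (derive_within 0 P v) ->
  prim 0 P (Rf v) (Rf (derive_within 0 P v)) /\ prim 0 P (If v) (If (derive_within 0 P v)).
Proof.
move=> ac /L2P[LR LI].
have [g1 [g1i g1E g1d]] := acr_prim P0 (acr_Rf ac).
have [g2 [g2i g2E g2d]] := acr_prim P0 (acr_If ac).
have key : {ae mu, forall x, 0 < x < P -> derive_within 0 P v x = g1 x +i* g2 x}.
  apply: (@filterS2 _ _ (ae_filter_ringOfSetsType mu) _ _ _ _ g1d g2d).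
  move=> x h1 h2 x01; have x01' : 0 <= x <= P by case/andP: x01 => ? ?; rewrite !ltW.
  by have [_ ->] := derive_withinE (l := g1 x +i* g2 x) P0 x01' (h1 x01) (h2 x01).
split.
  apply: (prim_ae g1E g1i LR).
  apply: (@filterS _ _ (ae_filter_ringOfSetsType mu) _ _ _ key).
  by move=> x h /h; rewrite /Rf => ->.
apply: (prim_ae g2E g2i LI).
apply: (@filterS _ _ (ae_filter_ringOfSetsType mu) _ _ _ key).
by move=> x h /h; rewrite /If => ->.
Qed.

Lemma acr_cont f : acr 0 P f -> {within `[0, P], continuous f}.
Proof.
move=> /(acr_prim P0)[g [gi fE _]].
apply: (eq_within_continuous (f := fun x => f 0 + Int 0 x g)).
  by move=> x xab; rewrite -fE.
move=> x; apply: cvgD; first exact: cst_continuous.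
exact: (cont_Int (ltW P0) gi).
Qed.

(** Below order r - 1 the next derivative is continuous and the classical fundamental theorem
    applies; at order r - 1 absolute continuity takes over. *)
Lemma sobolev_chain r u : (0 < r)%N -> sobolev 0 P r u ->
  forall k, (k < r)%N ->
  prim 0 P (Rf (deriven 0 P u k)) (Rf (deriven 0 P u k.+1)) /\
  prim 0 P (If (deriven 0 P u k)) (If (deriven 0 P u k.+1)).
Proof.
case: r => // r _ [/= uL dn ac rL].
have wd k x : (k < r)%N -> 0 <= x <= P ->
    has_wderiv 0 P (Rf (deriven 0 P u k)) x (Rf (deriven 0 P u k.+1) x) /\
    has_wderiv 0 P (If (deriven 0 P u k)) x (If (deriven 0 P u k.+1) x).
  by move=> kr xP; apply: derivable_withinP; exact: dn.
have cont k : (k <= r)%N -> {within `[0, P], continuous (Rf (deriven 0 P u k))} /\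
    {within `[0, P], continuous (If (deriven 0 P u k))}.
  rewrite leq_eqVlt => /predU1P[->|kr].
    by split; apply: acr_cont; [exact: acr_Rf|exact: acr_If].
  by split; apply: has_wderiv_cont P0 _ => x xP; have [] := wd k x kr xP; eauto.
move=> k; rewrite ltnS leq_eqVlt => /predU1P[->|kr].
  exact: absolutely_continuous_prim.
have [c1 c2] := cont k.+1 kr.
by split; apply: has_wderiv_prim => // x xP; have [] := wd k x kr xP.
Qed.

Definition cplx p q : R -> R[i]^o := fun x => p x +i* q x.

(** A converse to [sobolev_chain]: a chain of primitives with continuous members computes the
    iterated one-sided derivatives. Agreement is claimed on the segment only, which is all that
    these derivatives see. *)
Lemma deriven_chain u (p q : nat -> R -> R) m :
  (forall x, 0 <= x <= P -> u x = cplx (p 0%N) (q 0%N) x) ->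
  (forall k, (k < m)%N -> prim 0 P (p k) (p k.+1) /\ prim 0 P (q k) (q k.+1)) ->
  (forall k, (k <= m)%N -> {within `[0, P], continuous (p k)} /\ {within `[0, P], continuous (q k)}) ->
  (forall k, (k <= m)%N -> forall x, 0 <= x <= P -> deriven 0 P u k x = cplx (p k) (q k) x)
  /\ n_derivable 0 P m u.
Proof.
move=> u0 pq cpq.
have st k : (k < m)%N -> (forall x, 0 <= x <= P -> deriven 0 P u k x = cplx (p k) (q k) x) ->
    forall x, 0 <= x <= P -> derivable_within 0 P (deriven 0 P u k) x /\
      deriven 0 P u k.+1 x = cplx (p k.+1) (q k.+1) x.
  move=> km uk x xP; have [pp pq'] := pq k km; have [cp cq] := cpq k.+1 km.
  have [h1 h2] := derive_withinE (u := cplx (p k) (q k)) (l := cplx (p k.+1) (q k.+1) x) P0 xP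
    (prim_has_wderiv pp cp xP) (prim_has_wderiv pq' cq xP).
  have uk' : {in `[0, P], cplx (p k) (q k) =1 deriven 0 P u k}.
    by move=> y; rewrite in_itv/= => /uk.
  have [h3 h4] := eq_derive_within uk'; split; first exact: h4.
  by rewrite -h2 /= h3// in_itv.
have main k : (k <= m)%N -> forall x, 0 <= x <= P -> deriven 0 P u k x = cplx (p k) (q k) x.
  elim: k => [_ x /u0//|k IH km x xP].
  by have [] := st k km (IH (ltnW km)) x xP.
split=> // k km x xP; have [] := st k km (main k (ltnW km)) x xP.
by [].
Qed.

Lemma within_cplx p q : {within `[0, P], continuous p} -> {within `[0, P], continuous q} ->
  forall v, (forall x, 0 <= x <= P -> v x = cplx p q x) -> {within `[0, P], continuous v}.
Proof.
move=> cp cq v vE.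
have /subspace_continuousP cR : {within `[0, P], continuous (Rf v)}.
  by apply: (eq_within_continuous (f := p)) => // x xP; rewrite /Rf vE.
have /subspace_continuousP cI : {within `[0, P], continuous (If v)}.
  by apply: (eq_within_continuous (f := q)) => // x xP; rewrite /If vE.
apply/subspace_continuousP => x xP; apply/cvg_complexP.
by split; [exact: cR|exact: cI].
Qed.

Lemma poly_antiderivative d (q : {poly R}) : (size q <= d)%N ->
  exists2 Q : {poly R}, (size Q <= d.+1)%N & Q^`() = q.
Proof.
move=> qd; exists (\poly_(i < d.+1) (q`_i.-1 / i%:R)); first exact: size_poly.
apply/polyP => i; rewrite coef_deriv coef_poly ltnS.
case: ifP => [_|/negbT]; last by rewrite -leqNgt => di; rewrite mul0rn nth_default// (leq_trans qd).
by rewrite /= -(mulr_natr (_ / _)) divfK// pnatr_eq0.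
Qed.

Lemma prim_poly f g (a b : R) (q : {poly R}) d : 0 <= a -> b <= P -> prim 0 P f g ->
  (size q <= d)%N -> (forall x, a < x < b -> g x = q.[x]) ->
  exists2 Q : {poly R}, (size Q <= d.+1)%N & forall x, a < x < b -> f x = Q.[x].
Proof.
move=> a0 bP pf qd gq; have [Q Qd Qq] := poly_antiderivative qd.
have [ab|ba] := ltP a b; last first.
  by exists 0 => [|x /andP[ax xb]]; [rewrite size_poly0|move: (le_lt_trans ba (lt_trans ax xb)); rewrite ltxx].
have key x y : a < x -> x <= y -> y < b -> f y - f x = Q.[y] - Q.[x].
  move=> ax xy yb; have x0 := le_trans a0 (ltW ax); have yP := le_trans (ltW yb) bP.
  rewrite (primE pf x0 xy yP).
  have pQ : prim x y (fun x => Q.[x]) (fun x => q.[x]).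
    apply: prim_derive => [t _|]; first by rewrite -Qq; exact: is_derive_poly.
    by apply: continuous_subspaceT; exact: continuous_horner.
  rewrite (primE pQ (lexx x) xy (lexx y)); apply: eq_Int => t /andP[xt ty].
  by apply: gq; rewrite (lt_le_trans ax)//= (le_lt_trans ty).
(* The constant is fixed at an interior point, because [q] describes [g] on the open interval
   only. *)
pose c := (a + b) / 2; have ac : a < c by rewrite /c; lra.
have cb : c < b by rewrite /c; lra.
exists (Q + (f c - Q.[c])%:P).
  rewrite (leq_trans (size_polyD _ _))// geq_max Qd (leq_trans (size_polyC_leq1 _))//.
move=> x /andP[ax xb]; rewrite hornerD hornerC.
have [cx|/ltW xc] := leP c x; first by have := key c x ac cx xb; lra.
by have := key x c ax xc cb; lra.
Qed.

Lemma rspline_poly tau d f : (forall x, x \in tau -> 0 <= x <= P) -> rspline P tau d f ->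
  forall j, (j <= size tau)%N -> exists2 q : {poly R}, (size q <= d.+1)%N &
    forall x, nth P (0 :: tau) j < x < nth P tau j -> f x = q.[x].
Proof.
move=> tauP; elim: d f => [|d IH] f /=.
  move=> fs j jt; have [c fc] := fs j jt; exists c%:P; first exact: size_polyC_leq1.
  by move=> x /fc ->; rewrite hornerC.
move=> [g gs pf] j jt; have [q qd gq] := IH g gs j jt.
apply: prim_poly pf qd gq.
  case: j jt => //= j jt.
  by case/andP: (tauP (nth P tau j) (mem_nth P jt)).
have [jt'|jt'] := ltnP j (size tau); last by rewrite nth_default.
by case/andP: (tauP (nth P tau j) (mem_nth P jt')).
Qed.

Lemma rspline_chain tau d f : rspline P tau d f -> exists p : nat -> R -> R,
  p 0%N = f /\ forall k, (k < d)%N -> prim 0 P (p k) (p k.+1).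
Proof.
elim: d f => [|d IH] f /=; first by move=> _; exists (fun=> f).
move=> [g gs pf]; have [p [p0 pS]] := IH g gs.
exists (fun k => if k is k'.+1 then p k' else f); split=> // -[|k] kd; last exact: pS.
by rewrite p0.
Qed.

Lemma map_poly_complexE (q : {poly R}) x : (map_poly (real_complex R) q).[x%:C] = q.[x]%:C.
Proof. by rewrite horner_map. Qed.

Lemma splines_cplx tau d f g : (forall x, x \in tau -> 0 <= x <= P) ->
  rspline P tau d f -> rspline P tau d g -> splines 0 P d tau (cplx f g).
Proof.
move=> tauP fs gs; split.
  move=> j jt; have [qf qfd qfE] := rspline_poly tauP fs jt.
  have [qg qgd qgE] := rspline_poly tauP gs jt.
  exists (map_poly (real_complex R) qf + 'i%C *: map_poly (real_complex R) qg).
    rewrite (leq_trans (size_polyD _ _))// geq_max size_map_poly qfd.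
    by rewrite (leq_trans (size_scale_leq _ _))// size_map_poly.
  move=> x xj; rewrite hornerD hornerZ !map_poly_complexE /cplx qfE// qgE//.
  by apply/eqP; rewrite eq_complex /=; apply/andP; split; apply/eqP; ring.
(* The members of the chains are continuous up to order d - 1, whereas those of order d may be step
   functions. *)
move=> d0; have [p [p0 pS]] := rspline_chain fs; have [q [q0 qS]] := rspline_chain gs.
have d1 k : (k <= d.-1)%N -> (k < d)%N by rewrite -ltnS prednK.
have cont k : (k <= d.-1)%N ->
    {within `[0, P], continuous (p k)} /\ {within `[0, P], continuous (q k)}.
  by move=> /d1 kd; split; [exact: prim_cont (pS k kd)|exact: prim_cont (qS k kd)].
have [h1 h2] := @deriven_chain (cplx f g) p q d.-1
  ltac:(by rewrite p0 q0) (fun k kd => conj (pS k (d1 k (ltnW kd))) (qS k (d1 k (ltnW kd)))) cont.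
split=> //; have [c1 c2] := cont _ (leqnn _).
by apply: (within_cplx c1 c2); exact: h1.
Qed.

Lemma prim_Lipschitz w g : prim 0 P w g -> {within `[0, P], continuous g} ->
  exists2 K, 0 < K & forall x y, 0 <= x -> x <= y -> y <= P -> `|w y - w x| <= K * (y - x).
Proof.
move=> pw cg; have [M M0 gM] := cont_bounded cg.
exists (M + 1); first by rewrite ltr_wpDl.
move=> x y x0 xy yP; rewrite (primE pw x0 xy yP).
have gi : intble x y g by apply: intble_sub (L2r_intble pw.1).
apply: (le_trans (le_norm_Int gi)); rewrite -Int_cst//; apply: le_Int.
- exact: intble_norm.
- exact: intble_cst.
- move=> t /andP[xt ty]; apply: (@le_trans _ _ M); last by rewrite lerDl.
  by apply: gM; rewrite (le_trans x0)//= (le_trans ty).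
Qed.

Lemma absolutely_continuous_cplx v p p' q q' : prim 0 P p p' -> prim 0 P q q' ->
  {within `[0, P], continuous p'} -> {within `[0, P], continuous q'} ->
  (forall x, 0 <= x <= P -> v x = cplx p q x) -> absolutely_continuous 0 P v.
Proof.
move=> pp pq cp cq vE e e0.
have [K K0 HK] := prim_Lipschitz pp cp; have [L L0 HL] := prim_Lipschitz pq cq.
exists (e / (K + L)); first by rewrite divr_gt0 ?addr_gt0.
move=> m s t st _; rewrite ltr_pdivlMr ?addr_gt0// => h; apply: le_lt_trans h.
rewrite mulrC mulr_sumr; apply: ler_sum => k _.
have [s0 stk tP] := st k.
rewrite !vE ?s0 ?(le_trans stk)// ?tP ?(le_trans s0)//.
apply: (le_trans (normc_le_ReIm _)); rewrite mulrDl lerD//=.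
  exact: HK.
exact: HL.
Qed.

(** Brings combinations of eigenfunctions, given with all their derivatives, into the Sobolev class;
    continuity of the derivatives makes each of them Lipschitz, hence absolutely continuous. *)
Lemma sobolev_cplx r (p q : nat -> R -> R) : (0 < r)%N ->
  (forall k, prim 0 P (p k) (p k.+1)) -> (forall k, prim 0 P (q k) (q k.+1)) ->
  let u := cplx (p 0%N) (q 0%N) in
  sobolev 0 P r u /\ forall k x, 0 <= x <= P -> deriven 0 P u k x = cplx (p k) (q k) x.
Proof.
move=> r0 pp pq u.
have cont k : {within `[0, P], continuous (p k)} /\ {within `[0, P], continuous (q k)}.
  by split; [exact: prim_cont (pp k)|exact: prim_cont (pq k)].
have D k x : 0 <= x <= P -> deriven 0 P u k x = cplx (p k) (q k) x.
  have [+ _] := @deriven_chain u p q k (fun _ _ => erefl) (fun k _ => conj (pp k) (pq k)) (fun k _ => cont k).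
  by apply.
have LD k : L2 0 P (deriven 0 P u k).
  apply/L2P; split.
    by apply: eq_L2r (prim_L2r (pp k)) => x xP; rewrite /Rf D.
  by apply: eq_L2r (prim_L2r (pq k)) => x xP; rewrite /If D.
split; last exact: D.
split=> //; first exact: (LD 0%N).
- have [_] := @deriven_chain u p q r.-1 (fun _ _ => erefl) (fun k _ => conj (pp k) (pq k)) (fun k _ => cont k).
  by [].
- by apply: (absolutely_continuous_cplx (pp r.-1) (pq r.-1)); [case: (cont r.-1.+1)..|exact: D].
Qed.

End Complexification.

(** * Upper and lower bounds for the widths *)

Section Widths.
Context {R : realType}.
Variables (P : R) (P0 : 0 < P).
Implicit Types (f g p q w : R -> R) (u v y : R -> R[i]^o).

Lemma complex_addE (z z' : R[i]) :
  complex.Re (z + z') = complex.Re z + complex.Re z' /\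
  complex.Im (z + z') = complex.Im z + complex.Im z'.
Proof. by case: z z' => ? ? [? ?]. Qed.

Lemma complex_mulE (z z' : R[i]) :
  complex.Re (z * z') = complex.Re z * complex.Re z' - complex.Im z * complex.Im z' /\
  complex.Im (z * z') = complex.Re z * complex.Im z' + complex.Im z * complex.Re z'.
Proof. by case: z z' => ? ? [? ?]. Qed.

Lemma complex_sumE (I : Type) (r : seq I) (F : I -> R[i]) :
  complex.Re (\sum_(i <- r) F i) = \sum_(i <- r) complex.Re (F i) /\
  complex.Im (\sum_(i <- r) F i) = \sum_(i <- r) complex.Im (F i).
Proof.
elim: r => [|i r [IH1 IH2]]; first by rewrite !big_nil.
by rewrite !big_cons (complex_addE _ _).1 (complex_addE _ _).2 IH1 IH2.
Qed.

Lemma lin_combE k (e : 'I_k -> R -> R[i]^o) (c : 'I_k -> R[i]) x :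
  (\sum_(j < k) c j *: e j) x = \sum_(j < k) c j * (e j x : R[i]).
Proof. by rewrite fct_sumE; apply: eq_bigr. Qed.

Lemma Rf_lin_comb k (e : 'I_k -> R -> R[i]^o) (c : 'I_k -> R[i]) :
  Rf (\sum_(j < k) c j *: e j) =
  fun x => comb (fun j => Rf (e j)) (fun j => complex.Re (c j)) x -
           comb (fun j => If (e j)) (fun j => complex.Im (c j)) x.
Proof.
apply/funext => x; rewrite /Rf lin_combE (complex_sumE _ _).1 /comb -sumrB.
by apply: eq_bigr => j _; rewrite (complex_mulE _ _).1.
Qed.

Lemma If_lin_comb k (e : 'I_k -> R -> R[i]^o) (c : 'I_k -> R[i]) :
  If (\sum_(j < k) c j *: e j) =
  fun x => comb (fun j => If (e j)) (fun j => complex.Re (c j)) x +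
           comb (fun j => Rf (e j)) (fun j => complex.Im (c j)) x.
Proof.
apply/funext => x; rewrite /If lin_combE (complex_sumE _ _).2 /comb -big_split.
by apply: eq_bigr => j _; rewrite (complex_mulE _ _).2.
Qed.

Lemma RfB u v : Rf (u - v) = fun x => Rf u x - Rf v x.
Proof.
apply/funext => x; rewrite /Rf -[(u - v) x]/((u x : R[i]) - v x).
by case: (u x) => ? ?; case: (v x).
Qed.

Lemma IfB u v : If (u - v) = fun x => If u x - If v x.
Proof.
apply/funext => x; rewrite /If -[(u - v) x]/((u x : R[i]) - v x).
by case: (u x) => ? ?; case: (v x).
Qed.

Definition emb f : R -> R[i]^o := cplx f (fun=> 0).

Lemma lin_comb_emb n (f : 'I_n -> R -> R) (c : 'I_n -> R[i]) :
  \sum_(j < n) c j *: emb (f j) =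
  cplx (comb f (fun j => complex.Re (c j))) (comb f (fun j => complex.Im (c j))).
Proof.
apply/funext => x; apply/eqP; rewrite eq_complex; apply/andP; split; apply/eqP.
  have := congr1 (fun F => F x) (Rf_lin_comb (fun j => emb (f j)) c).
  rewrite /Rf => -> /=; rewrite [X in _ - X]big1 ?subr0// => j _.
  by rewrite /If /= mulr0.
have := congr1 (fun F => F x) (If_lin_comb (fun j => emb (f j)) c).
rewrite /If => -> /=; rewrite [X in X + _]big1 ?add0r// => j _.
by rewrite /= mulr0.
Qed.

Variables (b : bool * bool) (sig : R) (r : nat).
Hypotheses (s0 : 0 < sig) (r0 : (0 < r)%N).

Definition smooth_class : set (R -> R[i]^o) := [set u | [/\ sobolev 0 P r u,
  forall k, (k < r)%N -> bc P (iter k dualb b) (Rf (deriven 0 P u k)) /\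
                         bc P (iter k dualb b) (If (deriven 0 P u k)) &
  L2norm 0 P (deriven 0 P u r) <= 1]].

Definition real_approx n (f : 'I_n -> R -> R) :=
  forall u : nat -> R -> R, L2r 0 P (u r) ->
    (forall k, (k < r)%N -> prim 0 P (u k) (u k.+1) /\ bc P (iter k dualb b) (u k)) ->
    dist_le P f (u 0%N) ((sig ^+ 2) ^+ r * ip 0 P (u r) (u r)).

Definition emb_span n (f : 'I_n -> R -> R) : set (R -> R[i]^o) :=
  range (fun c : 'I_n -> R[i] => \sum_(j < n) c j *: emb (f j)).

(** Over a real basis the coefficients c + i c' approximate the real and the imaginary part
    separately, and the two squared errors add up to at most sig^(2 r) |u^(r)|^2. *)
Lemma deviation_le n (f : 'I_n -> R -> R) : (forall j, L2r 0 P (f j)) -> real_approx f ->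
  (deviation (L2norm 0 P) smooth_class (emb_span f) <= (sig ^+ r)%:E)%E.
Proof.
move=> fL ap; apply: ub_ereal_sup => _ [u [su bu nu] <-].
have chain := sobolev_chain P0 r0 su.
have [uL _ _ urL] := su.
have [pL qL] := (L2P P u).1 uL; have [prL qrL] := (L2P P _).1 urL.
have [c pc] := ap (fun k => Rf (deriven 0 P u k)) prL
  (fun k kr => conj (chain k kr).1 (bu k kr).1).
have [c' qc] := ap (fun k => If (deriven 0 P u k)) qrL
  (fun k kr => conj (chain k kr).2 (bu k kr).2).
pose s := \sum_(j < n) (c j +i* c' j) *: emb (f j).
apply: (@le_trans _ _ (L2norm 0 P (u - s))%:E).
  by apply: ereal_inf_lbound; exists s => //; exists (fun j => c j +i* c' j).
have sE : s = cplx (comb f c) (comb f c') by rewrite /s lin_comb_emb.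
have dL : L2 0 P (u - s).
  apply/L2P; rewrite RfB IfB sE; split; apply: L2rB => //; exact: L2r_comb.
rewrite lee_fin -(@ler_pXn2r _ 2)// ?nnegrE ?L2norm_ge0 ?exprn_ge0 ?(ltW s0)//.
have -> : (sig ^+ r) ^+ 2 = (sig ^+ 2) ^+ r by rewrite -!exprM mulnC.
rewrite L2norm_sqr// RfB IfB sE.
apply: (le_trans (lerD pc qc)); rewrite -mulrDr; apply: ler_piMr.
  by rewrite exprn_ge0 ?sqr_ge0.
by rewrite -(L2norm_sqr urL) expr_le1 ?L2norm_ge0.
Qed.

Variables (lam : nat -> R) (phi psi : nat -> R -> R).
Hypothesis E : eigen_system P b lam phi psi.

(** A complex combination of zero norm has real and imaginary parts of zero norm, and
    [approx_independent] applies to the coefficients of each. *)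
Lemma emb_subspace n (f : 'I_n -> R -> R) (L : R) : (forall j, L2r 0 P (f j)) ->
  real_approx f -> 0 <= L -> sig * L < 1 -> (forall j : 'I_n, lam j <= L) ->
  subspace_of_dim (L2 0 P) (L2norm 0 P) n (emb_span f).
Proof.
move=> fL ap L0 sL lL; exists (fun j => emb (f j)); split=> //.
  by move=> j; apply/L2P; split; [exact: fL|exact: L2r_cst].
move=> c; rewrite lin_comb_emb; set a := fun j => complex.Re _; set a' := fun j => complex.Im _.
move=> N0; have LL : L2 0 P (cplx (comb f a) (comb f a')).
  by apply/L2P; split; exact: L2r_comb.
have := L2norm_sqr LL; rewrite N0 expr0n/= => /esym/eqP.
rewrite paddr_eq0 ?ip_ge0// => /andP[/eqP h1 /eqP h2].
have D (c0 : 'I_n -> R) : dist_le P f (eigen_comb lam phi psi c0 0)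
    ((sig ^+ 2) ^+ r * ip 0 P (eigen_comb lam phi psi c0 r) (eigen_comb lam phi psi c0 r)).
  apply: (ap (eigen_comb lam phi psi c0)); first exact: (L2r_eigen_comb E).
  by move=> k _; split; [exact: (prim_eigen_comb E)|exact: (bc_eigen_comb E)].
move=> j; apply/eqP; rewrite eq_complex; apply/andP; split; apply/eqP.
  exact: (approx_independent E r0 s0 sL L0 lL fL D h1).
exact: (approx_independent E r0 s0 sL L0 lL fL D h2).
Qed.

(** A complex combination of n + 1 eigenfunctions is Hermitian-orthogonal to the competing space, so
    its distance to that space is its norm. Scaled to norm sig^r, it belongs to the class because
    lam_n = 1 / sig. *)
Lemma width_ge n : sig * lam n = 1 ->
  ((sig ^+ r)%:E <= kolmogorov_width (L2 0 P) (L2norm 0 P) n smooth_class)%E.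
Proof.
move=> slam; apply: le_ereal_inf_tmp => _ [_ [k kn [e [eL _ ->]]] <-].
have lamP (j : 'I_n.+1) : lam j <= lam n.
  have := ltn_ord j; rewrite ltnS leq_eqVlt => /predU1P[-> //|jn].
  by apply: ltW; case: E => _ + _ _ _; exact.
pose ph j := eigen_deriv lam phi psi 0 j.
have phL j : L2r 0 P (ph j) := prim_L2r (prim_eigen_deriv E 0 j).
have eRL j : L2r 0 P (Rf (e j)) by case: ((L2P P _).1 (eL j)).
have eIL j : L2r 0 P (If (e j)) by case: ((L2P P _).1 (eL j)).
(* Hermitian products of the real eigenfunctions with the generators, whence the conjugation. *)
pose M : 'M[R[i]]_(n.+1, k) :=
  \matrix_(j, l) (ip 0 P (ph j) (Rf (e l)) -i* ip 0 P (ph j) (If (e l))).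
have : kermx M != 0.
  rewrite kermx_eq0 /row_free neq_ltn (leq_ltn_trans (rank_leq_col M))//.
case/rowV0Pn => z /sub_kermxP zM z0.
have [l0 zl] : exists l, z 0 l != 0.
  apply/existsP; apply: contraT; rewrite negb_exists => /forallP h.
  move: z0; rewrite (_ : z = 0) ?eqxx//; apply/rowP => l; rewrite mxE.
  by apply/eqP; have := h l; rewrite negbK.
pose a j := complex.Re (z 0 j); pose a' j := complex.Im (z 0 j).
pose C (c : 'I_n.+1 -> R) m := eigen_comb lam phi psi c m.
pose N2 := ip 0 P (C a 0%N) (C a 0%N) + ip 0 P (C a' 0%N) (C a' 0%N).
have N20 : 0 < N2.
  have [al|al] := eqVneq (a l0) 0.
    rewrite ltr_wpDl ?ip_ge0//; apply: (ip_eigen_comb_gt0 E (j := l0)).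
    by move: zl; rewrite eq_complex /= -/(a l0) al eqxx.
  by rewrite ltr_pwDl ?ip_ge0//; exact: (ip_eigen_comb_gt0 E al).
(* The scaled function has norm sig^r, and differentiating r times multiplies the norm by at most
   lam_n^r = sig^(-r). *)
pose t := sig ^+ r / Num.sqrt N2.
have t2 : t ^+ 2 * N2 = (sig ^+ 2) ^+ r.
  rewrite expr_div_n sqr_sqrtr ?ltW// divfK ?lt0r_neq0//.
  by rewrite -!exprM mulnC.
pose p m := C (fun j => t * a j) m; pose q m := C (fun j => t * a' j) m.
have CZ c m x : C (fun j => t * c j) m x = t * C c m x.
  by rewrite /C /eigen_comb /comb mulr_sumr; apply: eq_bigr => j _; rewrite mulrA.
have CL c m : L2r 0 P (C c m) := L2r_eigen_comb E c m.
have ipZ c : ip 0 P (C (fun j => t * c j) 0%N) (C (fun j => t * c j) 0%N) = t ^+ 2 * ip 0 P (C c 0%N) (C c 0%N).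
  rewrite (eq_ip (f' := fun x => t * C c 0%N x) (g' := fun x => t * C c 0%N x)) => [|x _|x _]; try exact: CZ.
  rewrite ipZl//; last exact: L2rZ.
  by rewrite ipC ipZl//; ring.
have nrm : ip 0 P (p 0%N) (p 0%N) + ip 0 P (q 0%N) (q 0%N) = (sig ^+ 2) ^+ r.
  by rewrite !ipZ -mulrDr.
have pS m : prim 0 P (p m) (p m.+1) by exact: (prim_eigen_comb E).
have qS m : prim 0 P (q m) (q m.+1) by exact: (prim_eigen_comb E).
have [su uD] := sobolev_cplx P0 r0 pS qS.
pose u := cplx (p 0%N) (q 0%N).
have RD m x : 0 <= x <= P -> Rf (deriven 0 P u m) x = p m x by move=> xP; rewrite /Rf uD.
have ID m x : 0 <= x <= P -> If (deriven 0 P u m) x = q m x by move=> xP; rewrite /If uD.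
have PP : 0 <= (0 : R) <= P by rewrite lexx ltW.
have PP' : 0 <= P <= P by rewrite lexx ltW.
have uA : smooth_class u.
  split=> //.
    move=> m _; have [h1 h2] := bc_eigen_comb E (fun j => t * a j) m.
    have [h3 h4] := bc_eigen_comb E (fun j => t * a' j) m.
    by split; split=> h; rewrite ?RD ?ID//; [exact: h1|exact: h2|exact: h3|exact: h4].
  rewrite -(@ler_pXn2r _ 2)// ?nnegrE ?L2norm_ge0// expr1n.
  have [_ _ _ rL] := su; rewrite L2norm_sqr//.
  rewrite (eq_ip (RD r) (RD r)) (eq_ip (ID r) (ID r)).
  apply: (le_trans (lerD (ip_eigen_comb_le E _ r lamP) (ip_eigen_comb_le E _ r lamP))).
  rewrite -mulrDr -/(p 0%N) -/(q 0%N) nrm -exprMn -exprMn mulrC slam.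
  by rewrite !expr1n.
apply: le_trans; last by apply: ereal_sup_ubound; exists u; [exact: uA|reflexivity].
apply: le_ereal_inf_tmp => _ [_ [c _ <-] <-].
set y := \sum_(j < k) _.
rewrite lee_fin -(@ler_pXn2r _ 2)// ?nnegrE ?L2norm_ge0 ?exprn_ge0 ?(ltW s0)//.
have yR := Rf_lin_comb e c; have yI := If_lin_comb e c; rewrite -/y in yR yI.
have yRL : L2r 0 P (Rf y) by rewrite yR; apply: L2rB; exact: L2r_comb.
have yIL : L2r 0 P (If y) by rewrite yI; apply: L2rD; exact: L2r_comb.
have [pL qL] : L2r 0 P (p 0%N) /\ L2r 0 P (q 0%N) by split; exact: CL.
have dL : L2 0 P (u - y).
  by apply/L2P; rewrite RfB IfB; split; apply: L2rB.
rewrite L2norm_sqr// RfB IfB -exprM mulnC exprM -nrm.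
(* Real and imaginary parts of the Hermitian product of u with [e l]. *)
have orth l : ip 0 P (p 0%N) (Rf (e l)) + ip 0 P (q 0%N) (If (e l)) = 0 /\
              ip 0 P (q 0%N) (Rf (e l)) - ip 0 P (p 0%N) (If (e l)) = 0.
  have ipC0 c0 g : L2r 0 P g -> ip 0 P (C (fun j => t * c0 j) 0%N) g = t * \sum_j c0 j * ip 0 P (ph j) g.
    move=> gL; rewrite ipC ip_comb//.
    by rewrite mulr_sumr; apply: eq_bigr => j _; rewrite ipC mulrA.
  have := congr1 (fun A : 'rV_k => A 0 l) zM; rewrite !mxE => zMl.
  have [e1 e2] := complex_sumE (index_enum 'I_n.+1) (fun j => z 0 j * M j l).
  rewrite zMl /= in e1 e2.
  rewrite !ipC0//; split.
    rewrite -mulrDr -big_split -[RHS](mulr0 t) [in RHS]e1; congr (_ * _).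
    by apply: eq_bigr => j _; rewrite (complex_mulE _ _).1 !mxE /= mulrN opprK.
  rewrite -mulrBr -sumrB -[RHS](mulr0 t) [in RHS]e2; congr (_ * _).
  by apply: eq_bigr => j _; rewrite (complex_mulE _ _).2 !mxE /= mulrN addrC.
have cross : ip 0 P (p 0%N) (Rf y) + ip 0 P (q 0%N) (If y) = 0.
  rewrite yR yI ipBr ?ipDr//; try exact: L2r_comb.
  rewrite !ip_comb//.
  transitivity (\sum_(l < k) (complex.Re (c l) * (ip 0 P (p 0%N) (Rf (e l)) + ip 0 P (q 0%N) (If (e l)))
    + complex.Im (c l) * (ip 0 P (q 0%N) (Rf (e l)) - ip 0 P (p 0%N) (If (e l))))).
    rewrite -sumrB -!big_split /=; apply: eq_bigr => l _; ring.
  by apply: big1 => l _; have [-> ->] := orth l; rewrite !mulr0 addr0.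
have X f g : L2r 0 P f -> L2r 0 P g -> ip 0 P (fun x => f x - g x) (fun x => f x - g x) =
    ip 0 P f f - 2 * ip 0 P f g + ip 0 P g g.
  move=> fL gL; have fgL := L2rB fL gL.
  by rewrite ipBl// !(ipC _ _ _ (fun x => _ - _)) !ipBl// (ipC _ _ g f); ring.
rewrite !X//; have := ip_ge0 0 P (Rf y); have := ip_ge0 0 P (If y); have := cross.
rewrite -/(Rf u) -/(If u); lra.
Qed.

End Widths.

(** * The three classes, their knots and the optimal spline spaces *)

Section Optimality.
Context {R : realType}.

Lemma bc_complexP (P : R) (b : bool * bool) (v : R -> R[i]^o) :
  (bc P b (Rf v) /\ bc P b (If v)) <-> ((b.1 -> v 0 = 0) /\ (b.2 -> v P = 0)).
Proof.
split=> [[[h1 h2] [h3 h4]]|[h1 h2]].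
  split=> h; apply/eqP; rewrite eq_complex; apply/andP; split; apply/eqP.
  - exact: h1.
  - exact: h3.
  - exact: h2.
  - exact: h4.
by split; split=> h; rewrite /Rf /If ?h1 ?h2.
Qed.

(** Conditions on the function itself; for the k-th derivative they become [iter k dualb (bcond i)],
    which encodes the alternation between even and odd k in the classes. *)
Definition bcond (i : nat) : bool * bool :=
  match i with 0 => (true, true) | 1 => (false, false) | _ => (true, false) end.

Lemma boundary_conditionsP i r (u : R -> R[i]^o) : boundary_conditions i r u <->
  forall k, (k < r)%N ->
    bc (seg_end i) (iter k dualb (bcond i)) (Rf (deriven 0 (seg_end i) u k)) /\
    bc (seg_end i) (iter k dualb (bcond i)) (If (deriven 0 (seg_end i) u k)).
Proof.
set D := deriven 0 (seg_end i) u.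
transitivity (forall k, (k < r)%N -> let b := iter k dualb (bcond i) in
    (b.1 -> D k 0 = 0) /\ (b.2 -> D k (seg_end i) = 0)).
  rewrite /boundary_conditions -/D /bcond; case: i @D => [|[|i]] D; split=> H.
  - move=> k kr; rewrite iter_dualb_odd; case: (boolP (odd k)) => //= ok.
    by have [h1 h2] := H k kr ok.
  - by move=> k kr ok; have := H k kr; rewrite iter_dualb_odd (negbTE ok) => -[/= h1 h2]; auto.
  - move=> k kr; rewrite iter_dualb_odd; case: (boolP (odd k)) => //= ok.
    by have [h1 h2] := H k kr ok.
  - by move=> k kr ok; have := H k kr; rewrite iter_dualb_odd ok => -[/= h1 h2]; auto.
  - case: H => H1 H2 k kr; rewrite iter_dualb_odd; case: (boolP (odd k)) => //= ok.
      by split=> // _; exact: H2.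
    by split=> // _; exact: H1.
  - split=> k kr ok; have := H k kr; rewrite iter_dualb_odd.
      by rewrite (negbTE ok) => -[/= h1 h2]; auto.
    by rewrite ok => -[/= h1 h2]; auto.
by split=> H k kr; apply/bc_complexP; exact: H.
Qed.

Lemma AclassE i r : @Aclass R i r = smooth_class (seg_end i) (bcond i) r.
Proof.
apply/seteqP; split=> u; rewrite /Aclass /Hclass /smooth_class /=.
  by move=> [[su /boundary_conditionsP bu] nu]; split.
by move=> [su /boundary_conditionsP bu nu]; split.
Qed.

(** Both sides equal sig^r: the frequency [lam n = 1 / sig] bounds the width from below, while the
    frequencies before it are at most [L < 1 / sig], which forces the space to have dimension n. *)
Lemma optimal_spline_space (P sig L : R) b r n d tau (lam : nat -> R)
    (phi psi : nat -> R -> R) (f : 'I_n -> R -> R) : 0 < P -> 0 < sig -> (0 < r)%N ->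
  (forall x, x \in tau -> 0 <= x <= P) ->
  eigen_system P b lam phi psi -> sig * lam n = 1 ->
  0 <= L -> sig * L < 1 -> (forall j : 'I_n, lam j <= L) ->
  (forall j, L2r 0 P (f j)) -> (forall j, rspline P tau d (f j)) ->
  real_approx P b sig r f ->
  exists X : set (R -> R[i]^o),
    [/\ subspace_of_dim (L2 0 P) (L2norm 0 P) n X, X `<=` splines 0 P d tau
      & deviation (L2norm 0 P) (smooth_class P b r) X
        = kolmogorov_width (L2 0 P) (L2norm 0 P) n (smooth_class P b r)].
Proof.
move=> P0 s0 r0 tauP E slam L0 sL lL fL fs ap.
have Xdim : subspace_of_dim (L2 0 P) (L2norm 0 P) n (emb_span f).
  exact: (emb_subspace s0 r0 E fL ap L0 sL lL).
exists (emb_span f); split=> //.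
  move=> _ [c _ <-]; rewrite lin_comb_emb; apply: splines_cplx => //; exact: rspline_comb.
apply/eqP; rewrite eq_le; apply/andP; split.
  apply: le_trans (deviation_le P0 s0 r0 fL ap) _.
  exact: (width_ge P0 s0 r0 E slam).
by apply: ereal_inf_lbound; exists (emb_span f) => //; exists n.
Qed.

Lemma approx_real_approx (P sig : R) b r d n (G : 'I_n -> R -> R) : (r <= d.+1)%N ->
  approx P sig b G d.+1 -> real_approx P b sig r G.
Proof. by move=> rd ap u uL ch; exact: (ap r rd u uL ch). Qed.

(** When an endpoint condition is imposed, index 0 holds the zero function; dropping it brings the
    dimension down to n. *)
Lemma real_approx_lift (P sig : R) b r n (G : 'I_n.+1 -> R -> R) : ~~ freeb b ->
  family P b G -> real_approx P b sig r G ->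
  real_approx P b sig r (fun j => G (lift ord0 j)).
Proof.
move=> fb [G0 GL] ap u uL ch; have [c cle] := ap u uL ch.
exists (fun j => c (lift ord0 j)).
rewrite (_ : comb _ _ = comb G c)//; apply/funext => x.
by rewrite /comb [RHS]big_ord_recl G0 (negbTE fb) mulr0 add0r.
Qed.

(** For i = 1 the conjunct [0 < n] keeps the shifted list empty at n = 0, where [n.-1 + 1] would be
    1. *)
Lemma knotsE i n (s : bool) (sig : R) :
  sig = match i with 0 => n.+1%:R^-1 | 1 => n%:R^-1 | _ => (2 * n + 1)%:R^-1 end ->
  (if s then shifted_knots i n else knots i n) = [seq node sig s k | k <-
    iota (~~ s) (match i with 0 => n + s | 1 => n.-1 + (s && (0 < n)%N) | _ => n end)].
Proof.
move=> ->; case: i => [|[|i]]; case: s => /=; rewrite ?addn0 ?addn1 /node.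
- apply: (@eq_map _ _ _ _ _ (iota 0 n.+1)) => k.
  have : n.+1%:R != 0 :> R by rewrite pnatr_eq0.
  by rewrite natrM /= mulr1n; move: n.+1%:R => N N0; field.
- by apply: eq_map => k; rewrite mul0r addr0 mulrA.
- case: n => [|n] /=; rewrite ?addn1 ?addn0//; apply: (@eq_map _ _ _ _ _ (iota 0 n.+1)) => k.
  have : n.+1%:R != 0 :> R by rewrite pnatr_eq0.
  by rewrite natrM /= mulr1n; move: n.+1%:R => N N0; field.
- by apply: eq_map => k; rewrite mul0r addr0 mulrA.
- apply: eq_map => k; have : (2 * n + 1)%:R != 0 :> R by rewrite pnatr_eq0 addn1.
  by rewrite natrM /= mulr1n; move: (2 * n + 1)%:R => N N0; field.
- by apply: eq_map => k; rewrite mul0r addr0 mulrA.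
Qed.

Lemma node_le_pi n (s : bool) k : (k < n + s + ~~ s)%N ->
  node n.+1%:R^-1 s k <= pi :> R.
Proof.
move=> kn; have nR : 0 < n.+1%:R :> R by rewrite ltr0n.
rewrite /node mulrCA ler_piMr ?pi_ge0// ler_pdivrMr// mul1r.
have kn' : k%:R <= n%:R :> R by rewrite ler_nat; case: (s) kn; rewrite /= ?addn0 addn1 ltnS.
have nE : n.+1%:R = n%:R + 1 :> R by rewrite natr1.
by rewrite nE; case: (s); rewrite /= ?mulr1n ?mulr0n; lra.
Qed.

Lemma node_le_pihalf n (s : bool) k : (k < n + ~~ s)%N ->
  node (2 * n + 1)%:R^-1 s k <= pi / 2 :> R.
Proof.
move=> kn; have nR : 0 < (2 * n + 1)%:R :> R by rewrite ltr0n addn1.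
rewrite /node mulrCA ler_wpM2l ?pi_ge0// ler_pdivrMr//.
have kn' : 2 * k%:R + s%:R <= 2 * n%:R + 1 :> R.
  have h : (2 * k + s <= 2 * n + 1)%N by case: (s) kn => /=; lia.
  by move: h; rewrite -(ler_nat R) !natrD; lra.
by rewrite natrD natrM; lra.
Qed.

End Optimality.

Theorem mainTheorem4 (R : realType) (r n d : nat) (i : 'I_3) (tau : seq R)
    (hr : (0 < r)%N) (hn : (0 < n)%N) (hd : (r - 1 <= d)%N)
    (htau : tau = knots i n \/ tau = shifted_knots i n) :
  exists X : set (R -> R[i]^o),
    [/\ subspace_of_dim (L2 0 (seg_end i)) (L2norm 0 (seg_end i)) n X,
        X `<=` splines 0 (seg_end i) d tau
      & deviation (L2norm 0 (seg_end i)) (Aclass i r) X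
        = kolmogorov_width (L2 0 (seg_end i)) (L2norm 0 (seg_end i)) n
            (Aclass i r)].
Proof.
have rd : (r <= d.+1)%N by rewrite -add1n -leq_subLR.
have [s ->] : exists s : bool, tau = if s then shifted_knots i n else knots i n.
  by case: htau => ->; [exists false|exists true].
rewrite AclassE {tau htau}.
have knots_in (P sig : R) (m : nat) : 0 < sig -> (forall k, (k < m + ~~ s)%N -> node sig s k <= P) ->
    forall x, x \in [seq node sig s k | k <- iota (~~ s) m] -> 0 <= x <= P.
  move=> s0 H x /mapP[k]; rewrite mem_iota => /andP[_ km] ->.
  by rewrite node_ge0// H// addnC.
case: i => [[|[|[|//]]] i3] /=; rewrite /seg_end /=.
(* Sines: the frequencies 1, ..., n are at most L = n and the next one is 1 / sig; the zero function
   at index 0 is dropped. *)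
- have sig0 : 0 < n.+1%:R^-1 :> R by rewrite invr_gt0 ltr0n.
  have nR : n.+1%:R != 0 :> R by rewrite pnatr_eq0.
  rewrite (@knotsE R 0 n s n.+1%:R^-1 erefl).
  have [G [GF Ga Gs]] := @splines_pi R n d (true, true) s erefl.
  apply: (optimal_spline_space (pi_gt0 R) sig0 hr _ eigen_system_sin (L := n%:R)
     (f := fun j => G (lift ord0 j))) => //.
  + apply: knots_in => // k kn; exact: node_le_pi.
  + by rewrite mulVf.
  + by rewrite mulrC ltr_pdivrMr ?ltr0n// mul1r ltr_nat.
  + by move=> j; rewrite ler_nat.
  + by move=> j; exact: GF.2.
  + exact: (real_approx_lift _ GF (approx_real_approx rd Ga)).
(* Cosines, with n + 1 in place of n: the constant at index 0 belongs to the space and counts toward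
   its dimension. Frequencies start at 0, so the one of index n + 1 is 1 / sig. *)
- case: n hn => // n _.
  have sig0 : 0 < n.+1%:R^-1 :> R by rewrite invr_gt0 ltr0n.
  have nR : n.+1%:R != 0 :> R by rewrite pnatr_eq0.
  rewrite (@knotsE R 1 n.+1 s n.+1%:R^-1 erefl) /= andbT.
  have [G [GF Ga Gs]] := @splines_pi R n d (false, false) s erefl.
  apply: (optimal_spline_space (pi_gt0 R) sig0 hr _ eigen_system_cos (L := n%:R) (f := G)) => //.
  + apply: knots_in => // k kn; exact: node_le_pi.
  + by rewrite mulVf.
  + by rewrite mulrC ltr_pdivrMr ?ltr0n// mul1r ltr_nat.
  + by move=> j; rewrite ler_nat -ltnS.
  + by move=> j; exact: GF.2.
  + exact: (approx_real_approx rd Ga).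
(* Sines of odd frequency: those of index below n are at most 2 n - 1, so L = 2 n separates them
   from 1 / sig = 2 n + 1. *)
- have sig0 : 0 < (2 * n + 1)%:R^-1 :> R by rewrite invr_gt0 ltr0n addn1.
  have nR : (2 * n + 1)%:R != 0 :> R by rewrite pnatr_eq0 addn1.
  have P0 : (0 : R) < pi / 2 by rewrite divr_gt0 ?pi_gt0.
  rewrite (@knotsE R 2 n s (2 * n + 1)%:R^-1 erefl).
  have [G [GF Ga Gs]] := @splines_pihalf R n d (true, false) s erefl.
  apply: (optimal_spline_space P0 sig0 hr _ eigen_system_sin_odd (L := (2 * n)%:R)
     (f := fun j => G (lift ord0 j))) => //.
  + apply: knots_in => // k kn; exact: node_le_pihalf.
  + by rewrite mulVf.
  + by rewrite mulrC ltr_pdivrMr ?ltr0n ?addn1// mul1r ltr_nat.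
  + by move=> j; rewrite ler_nat; have := ltn_ord j; lia.
  + by move=> j; exact: GF.2.
  + exact: (real_approx_lift _ GF (approx_real_approx rd Ga)).
Qed.
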